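(* Let $H$ be a second-countable Lie group acting smoothly from the right on a second-countable manifold $M$. The Dirac bialgebroid $\mathrm{Dirac}(M\rtimes H)$ of the action Lie groupoid $M\rtimes H$ is a locally convex bialgebroid with an antipode over $C^\infty_c(M)$.
   Context: Manifolds are smooth, Hausdorff and paracompact; functions are $\mathbb C$-valued. $C^\infty(Q)$ (for $Q$ second-countable) has the Fréchet topology of uniform convergence of all derivatives on compact sets; $C^\infty_c(M)$ has the LF-topology (inductive limit of the Fréchet spaces $C^\infty_c(L)$, $L\subset M$ compact). If $E,F$ are locally convex spaces which are $A$-modules, $\mathrm{Hom}_A(E,F)$ is the space of continuous $A$-linear maps with the topology of uniform convergence on bounded subsets of $E$. **Action groupoid.** $M\rtimes H$ is the Lie groupoid over $M$ with arrow manifold $M\times H$, $\mathrm t(x,h)=x$, $\mathrm s(x,h)=xh$, $(x,h)(xh,h')=(x,hh')$, $(x,h)^{-1}=(xh,h^{-1})$, units $(x,e)$. **Dirac bialgebroid.** Let $\mathcal E'_{\mathrm t}(M\rtimes H)=\mathrm{Hom}_{C^\infty_c(M)}(C^\infty(M\times H),C^\infty_c(M))$, where $(f\cdot F)(x,h)=f(x)F(x,h)$ and $(f\cdot T)(F)=T(f\cdot F)$. For $h\in H$, $f\in C^\infty_c(M)$ let $\llbracket E_h,f\rrbracket(F)(x)=f(x)F(x,h)$. $A=\mathrm{Dirac}(M\rtimes H)$ is the linear span of all $\llbracket E_h,f\rrbracket$ in $\mathcal E'_{\mathrm t}(M\rtimes H)$, with the induced topology; each element is $\sum_i\llbracket E_{h_i},f_i\rrbracket$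 with distinct $h_i$, uniquely up to zero terms. Its structure maps, extended linearly, are as follows, where $(hf)(x)=f(xh)$ and $1_f\in C^\infty_c(M)$ is any function with $1_ff=f$ (the choice does not matter): - product $\mu$: $\llbracket E_{h_1},f_1\rrbracket*\llbracket E_{h_2},f_2\rrbracket=\llbracket E_{h_1h_2},f_1\cdot(h_1f_2)\rrbracket$; - $C^\infty_c(M)\subset A$ via $f\mapsto\llbracket E_e,f\rrbracket$; - $\Delta(\llbracket E_h,f\rrbracket)=\llbracket E_h,f\rrbracket\otimes\llbracket E_h,1_f\rrbracket$ and $\epsilon(\llbracket E_h,f\rrbracket)=f$; - $S(\llbracket E_h,f\rrbracket)=\llbracket E_{h^{-1}},h^{-1}f\rrbracket$. **Topology on $A\otimes_{C^\infty_c(M)}A$** (tensor product of left modules): the $C^\infty_c(M)$-injective topology. For $F,G\in C^\infty(M\times H)$ set $(F\otimes G)(\sum_iu_i'\otimes u_i'')=\sum_iu_i'(F)u_i''(G)\in C^\infty_c(M)$. Basic neighbourhoods of zero are $K(B_1,B_2,V)=\{\tilde u:(F\otimes G)(\tilde u)\in V\text{ for all }F\in B_1,G\in B_2\}$, with $B_1,B_2\subset C^\infty(M\times H)$ bounded and $V$ a neighbourhood of zero in $C^\infty_c(M)$. **Bialgebroids.** Let $R$ be a commutative $\mathbb C$-algebra with local units (for $r_1,\dots,r_n\in R$ there is $r\in R$ with $rr_i=r_i$ for all $i$). A $\mathbb C$-algebra $A$ extends $R$ if $R$ is a (not necessarily central) subalgebra of $A$ and $A$ has local units in $R$ (for $a_1,\dots,a_n\in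 A$ there is $r\in R$ with $ra_i=a_i=a_ir$ for all $i$). $A\otimes_RA$ denotes the tensor product of left $R$-modules; it has two right $R$-actions $(a\otimes b)\cdot r=ar\otimes b$ and $(a\otimes b)\cdot r=a\otimes br$. $A\overline\otimes_RA$ is the algebra, with product $(a\otimes b)(c\otimes d)=ac\otimes bd$, of those elements of $A\otimes_RA$ on which the two right actions coincide. A bialgebroid over $R$ is a $\mathbb C$-algebra $A$ extending $R$ with left $R$-linear maps $\Delta:A\to A\otimes_RA$, $\epsilon:A\to R$ making it a coassociative, counital, cocommutative coalgebra over $R$ such that: (i) $\Delta(A)\subset A\overline\otimes_RA$; (ii) $\epsilon|_R=\mathrm{id}$ and $\Delta|_R$ is the canonical embedding $R\subset A\otimes_RA$; (iii) $\epsilon(ab)=\epsilon(a\epsilon(b))$ and $\Delta(ab)=\Delta(a)\Delta(b)$ for all $a,b\in A$. An antipode is a $\mathbb C$-linear involution $S:A\to A$ with $S|_R=\mathrm{id}$, $S(ab)=S(b)S(a)$, and $\mu_A\circ(S\otimes\mathrm{id})\circ\Delta=\epsilon\circ S$, where $\mu_A$ is the multiplication. A locally convex bialgebroid is a bialgebroid $(A,\Delta,\epsilon,\mu)$ with a locally convex structure such that $\Delta$ and $\epsilon$ are continuous and $\mu$ is separately continuous (no continuity of the antipode is required). *)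

(* Defs.v *)
From HB Require Import structures.
From mathcomp Require Import all_boot all_order all_algebra.
From mathcomp Require Import boolp classical_sets functions reals.
From mathcomp Require Import topology normedtype derive convex.
From mathcomp Require Import generic_quotient.
From mathcomp Require Import complex.

Set Implicit Arguments.
Unset Strict Implicit.
Unset Printing Implicit Defensive.

Import Order.TTheory GRing.Theory Num.Theory.
Import numFieldNormedType.Exports.

Local Open Scope classical_set_scope.
Local Open Scope ring_scope.
Local Open Scope complex_scope.
Local Open Scope quotient_scope.

Section SmoothEuclidean.
Variables (R : realType) (n : nat).
Implicit Types (f g : 'rV[R]_n -> R^o) (U : set 'rV[R]_n).

Definition partial (i : 'I_n) f : 'rV[R]_n -> R^o := 'D_(delta_mx 0 i) f.

Definition partials (s : seq 'I_n) f : 'rV[R]_n -> R^o :=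
  foldl (fun g i => partial i g) f s.

Definition smooth_on U f :=
  forall (s : seq 'I_n) x, U x ->
    {for x, continuous (partials s f)} /\
    forall i, derivable (partials s f) x (delta_mx 0 i).

(* Auxiliary, for the closure proofs only; see smooth_onP. *)
Fixpoint Ck (k : nat) U f : Prop :=
  (forall x, U x -> {for x, continuous f}) /\
  if k is k'.+1 then
    (forall x, U x -> forall i, derivable f x (delta_mx 0 i)) /\
    (forall i, Ck k' U (partial i f))
  else True.

Lemma Ck_cont k U f : Ck k U f -> forall x, U x -> {for x, continuous f}.
Proof. by case: k => [|k] /= []. Qed.

Lemma CkS k U f : Ck k.+1 U f -> Ck k U f.
Proof.
elim: k f => [|k IH] f; first by case.
by case=> cf [df Hf]; split=> //; split=> // i; exact: IH.
Qed.

Lemma smooth_onP U f : smooth_on U f <-> forall k, Ck k U f.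
Proof.
split=> [sf k|]; last first.
  move=> Hf s; elim: s f Hf => [|i s IH] f Hf x Ux.
    split; first exact: (Ck_cont (Hf 0%N)).
    by have [_ [df _]] := Hf 1%N; exact: df.
  by apply: (IH (partial i f)) => // k; have [_ [_]] := Hf k.+1; exact.
elim: k f sf => [|k IH] f sf /=; first by split=> // x /(sf [::])[].
split; first by move=> x /(sf [::])[].
split; first by move=> x /(sf [::])[].
by move=> i; apply: IH => s; exact: (sf (i :: s)).
Qed.

Lemma open_near_eq U f g x : open U -> (forall y, U y -> f y = g y) -> U x ->
  {near x, f =1 g}.
Proof. by move=> oU fg Ux; near=> y; apply: fg; near: y; exact: open_nbhs_nbhs. 
Unshelve. all: by end_near. Qed.

Lemma near_eq_continuous U f g x : open U -> (forall y, U y -> f y = g y) -> U x ->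
  {for x, continuous f} -> {for x, continuous g}.
Proof.
move=> oU fg Ux; rewrite /prop_for /continuous_at -(fg x Ux).
move=> cf; apply: cvg_trans cf; apply: (@near_eq_cvg _ _ (nbhs x)); exact: (open_near_eq oU fg Ux).
Qed.

Lemma Ck_ext k U f g : open U -> (forall y, U y -> f y = g y) ->
  Ck k U f -> Ck k U g.
Proof.
move=> oU; elim: k f g => [|k IH] f g fg.
  move=> [cf _]; split=> // x Ux.
  exact: (near_eq_continuous oU fg Ux (cf _ Ux)).
move=> [cf [df Hf]]; split.
  move=> x Ux; exact: (near_eq_continuous oU fg Ux (cf _ Ux)).
split=> [x Ux i|i].
  exact: near_eq_derivable (open_near_eq oU fg Ux) (df x Ux i).
apply: IH (Hf i) => y Uy; apply: near_eq_derive; exact: (open_near_eq oU fg Uy).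
Qed.

Lemma CkD k U f g : open U -> Ck k U f -> Ck k U g -> Ck k U (f + g).
Proof.
move=> oU; elim: k f g => [|k IH] f g.
  by move=> [cf _] [cg _]; split=> // x Ux; apply: continuousD; [exact: cf|exact: cg].
move=> [cf [df Hf]] [cg [dg Hg]]; split.
  by move=> x Ux; apply: continuousD; [exact: cf|exact: cg].
split=> [x Ux i|i]; first by apply: derivableD; [exact: df|exact: dg].
apply: Ck_ext (IH _ _ (Hf i) (Hg i)) => // y Uy.
by rewrite /partial deriveD //; [exact: df|exact: dg].
Qed.

Lemma CkM k U f g : open U -> Ck k U f -> Ck k U g ->
  Ck k U (fun x => (f x : R) * g x).
Proof.
move=> oU; elim: k f g => [|k IH] f g.
  move=> [cf _] [cg _]; split=> // x Ux.
  by apply: (@continuousM R); [exact: cf|exact: cg].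
move=> Hf' Hg'; have [cf [df Hf]] := Hf'; have [cg [dg Hg]] := Hg'; split.
  by move=> x Ux; apply: (@continuousM R); [exact: cf|exact: cg].
split=> [x Ux i|i]; first by apply: derivableM; [exact: df|exact: dg].
apply: (@Ck_ext _ _ ((fun x => (f x : R) * partial i g x) + (fun x => (g x : R) * partial i f x))) => //.
  by move=> y Uy; rewrite [RHS]deriveM //; [exact: df|exact: dg].
by apply: CkD oU _ _; apply: IH; [exact: CkS Hf'|exact: Hg|exact: CkS Hg'|exact: Hf].
Qed.

Lemma smooth_on_cst U (c : R) : smooth_on U (fun=> c).
Proof.
have H0 : forall (s : seq 'I_n) (x : R), exists y : R, partials s (fun=> x : R^o) = fun=> y.
  elim=> [|i s IH] x; first by exists x.
  rewrite /= (_ : partial i _ = fun=> 0); first exact: IH.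
  by apply/funext => y; rewrite /partial (derive_cst (x : R^o)).
move=> s x Ux; have [y ->] := H0 s c; split; first exact: cst_continuous.
move=> i; exact: derivable_cst.
Qed.

Lemma smooth_onD U f g : open U -> smooth_on U f -> smooth_on U g ->
  smooth_on U (fun x => (f x : R) + g x).
Proof. by move=> oU /smooth_onP Hf /smooth_onP Hg; apply/smooth_onP => k; exact: CkD. Qed.

Lemma smooth_onM U f g : open U -> smooth_on U f -> smooth_on U g ->
  smooth_on U (fun x => (f x : R) * g x).
Proof. by move=> oU /smooth_onP Hf /smooth_onP Hg; apply/smooth_onP => k; exact: CkM. Qed.

Lemma smooth_on_sub U V f : V `<=` U -> smooth_on U f -> smooth_on V f.
Proof. by move=> VU sf s x /VU; exact: sf. Qed.

Lemma smooth_on_ext U f g : open U -> (forall y, U y -> f y = g y) ->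
  smooth_on U f -> smooth_on U g.
Proof. by move=> oU fg /smooth_onP Hf; apply/smooth_onP => k; exact: Ck_ext (Hf k). Qed.

End SmoothEuclidean.

Section SmoothProduct.
Variables (R : realType) (m n : nat).

Lemma lsubmx_shift (x : 'rV[R]_(m + n)) (h : R) (i : 'I_m) :
  lsubmx (h *: delta_mx 0 (lshift n i) + x) = h *: delta_mx 0 i + lsubmx x.
Proof.
by apply/rowP => j; rewrite !mxE !eqxx (inj_eq (@lshift_inj _ _)).
Qed.

Lemma lsubmx_shift0 (x : 'rV[R]_(m + n)) (h : R) (i : 'I_n) :
  lsubmx (h *: delta_mx 0 (rshift m i) + x) = lsubmx x.
Proof. by apply/rowP => j; rewrite !mxE eq_lrshift andbF mulr0 add0r. Qed.

Lemma rsubmx_shift (x : 'rV[R]_(m + n)) (h : R) (i : 'I_n) :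
  rsubmx (h *: delta_mx 0 (rshift m i) + x) = h *: delta_mx 0 i + rsubmx x.
Proof.
by apply/rowP => j; rewrite !mxE !eqxx (inj_eq (@rshift_inj _ _)).
Qed.

Lemma rsubmx_shift0 (x : 'rV[R]_(m + n)) (h : R) (i : 'I_m) :
  rsubmx (h *: delta_mx 0 (lshift n i) + x) = rsubmx x.
Proof. by apply/rowP => j; rewrite !mxE eq_rlshift andbF mulr0 add0r. Qed.

Lemma smooth_on_lsubmx U (f : 'rV[R]_m -> R^o) : smooth_on U f ->
  smooth_on (lsubmx @^-1` U) (fun v : 'rV[R]_(m + n) => f (lsubmx v)).
Proof.
move=> sf; apply/smooth_onP => k; have {sf} := (smooth_onP U f).1 sf k.
elim: k f => [|k IH] f Hf.
  split=> // x Ux; apply: continuous_comp; first exact: continuous_lsubmx.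
  exact: Ck_cont Hf _ Ux.
have cf := Ck_cont Hf; have [_ [df {}Hf]] := Hf.
have dql (i : 'I_m) (x : 'rV[R]_(m + n)) :
    (fun h : R => h^-1 *: (((fun v => f (lsubmx v)) \o shift x)
        (h *: delta_mx 0 (lshift n i)) - f (lsubmx x)))
    = (fun h : R => h^-1 *: ((f \o shift (lsubmx x)) (h *: delta_mx 0 i)
        - f (lsubmx x))).
  by apply/funext => h /=; rewrite lsubmx_shift.
have dqr (i : 'I_n) (x : 'rV[R]_(m + n)) :
    (fun h : R => h^-1 *: (((fun v => f (lsubmx v)) \o shift x)
        (h *: delta_mx 0 (rshift m i)) - f (lsubmx x)))
    = (fun h : R => 0).
  by apply/funext => h /=; rewrite lsubmx_shift0 subrr scaler0.
split.
  move=> x Ux; apply: continuous_comp; first exact: continuous_lsubmx.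
  exact: cf _ Ux.
split=> [x Ux i|i].
  rewrite /derivable; case: (split_ordP i) => j ->.
    by rewrite dql; exact: (df _ Ux j).
  by rewrite dqr; apply: (@is_cvg_cst).
case: (split_ordP i) => j ->.
  rewrite (_ : partial _ _ = fun v => partial j f (lsubmx v)); first by apply: IH; exact: Hf.
  by apply/funext => x; rewrite /partial /derive dql.
rewrite (_ : partial _ _ = fun=> 0).
  exact: (smooth_onP _ _).1 (smooth_on_cst _) k.
by apply/funext => x; rewrite /partial /derive dqr; exact: lim_cst.
Qed.

Lemma smooth_on_rsubmx U (f : 'rV[R]_n -> R^o) : smooth_on U f ->
  smooth_on (rsubmx @^-1` U) (fun v : 'rV[R]_(m + n) => f (rsubmx v)).
Proof.
move=> sf; apply/smooth_onP => k; have {sf} := (smooth_onP U f).1 sf k.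
elim: k f => [|k IH] f Hf.
  split=> // x Ux; apply: continuous_comp; first exact: continuous_rsubmx.
  exact: Ck_cont Hf _ Ux.
have cf := Ck_cont Hf; have [_ [df {}Hf]] := Hf.
have dqr (i : 'I_n) (x : 'rV[R]_(m + n)) :
    (fun h : R => h^-1 *: (((fun v => f (rsubmx v)) \o shift x)
        (h *: delta_mx 0 (rshift m i)) - f (rsubmx x)))
    = (fun h : R => h^-1 *: ((f \o shift (rsubmx x)) (h *: delta_mx 0 i)
        - f (rsubmx x))).
  by apply/funext => h /=; rewrite rsubmx_shift.
have dql (i : 'I_m) (x : 'rV[R]_(m + n)) :
    (fun h : R => h^-1 *: (((fun v => f (rsubmx v)) \o shift x)
        (h *: delta_mx 0 (lshift n i)) - f (rsubmx x)))
    = (fun h : R => 0).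
  by apply/funext => h /=; rewrite rsubmx_shift0 subrr scaler0.
split.
  move=> x Ux; apply: continuous_comp; first exact: continuous_rsubmx.
  exact: cf _ Ux.
split=> [x Ux i|i].
  rewrite /derivable; case: (split_ordP i) => j ->.
    by rewrite dql; apply: (@is_cvg_cst).
  by rewrite dqr; exact: (df _ Ux j).
case: (split_ordP i) => j ->; last first.
  rewrite (_ : partial _ _ = fun v => partial j f (rsubmx v)); first by apply: IH; exact: Hf.
  by apply/funext => x; rewrite /partial /derive dqr.
rewrite (_ : partial _ _ = fun=> 0).
  exact: (smooth_onP _ _).1 (smooth_on_cst _) k.
by apply/funext => x; rewrite /partial /derive dql; exact: lim_cst.
Qed.

Lemma row_mx_shift (v : 'rV[R]_m) (w : 'rV[R]_n) (h : R) (i : 'I_m) :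
  h *: delta_mx 0 (lshift n i) + row_mx v w = row_mx (h *: delta_mx 0 i + v) w.
Proof.
apply/rowP => j; case: (split_ordP j) => k ->.
  by rewrite !mxE !(unsplitK (inl _)) !mxE (inj_eq (@lshift_inj _ _)).
by rewrite !mxE !(unsplitK (inr _)) eq_rlshift andbF mulr0 add0r.
Qed.

Lemma continuous_row_mx :
  continuous (fun p : 'rV[R]_m * 'rV[R]_n => row_mx p.1 p.2).
Proof.
move=> [v w] A /nbhs_ballP[e /= e0 eA].
apply/nbhs_ballP; exists e => //= -[v' w'] /= [[_ vv'] [_ ww']]; apply: eA.
split=> // i j; case: (split_ordP j) => k ->.
  by rewrite !mxE !(unsplitK (inl _)); exact: vv'.
by rewrite !mxE !(unsplitK (inr _)); exact: ww'.
Qed.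

Lemma continuous_row_mxl (w : 'rV[R]_n) :
  continuous (fun v : 'rV[R]_m => row_mx v w).
Proof.
move=> v; apply: (@continuous_comp _ _ _ (fun v => (v, w))
  (fun p : 'rV[R]_m * 'rV[R]_n => row_mx p.1 p.2)); last exact: continuous_row_mx.
exact: (cvg_pair (@cvg_id _ (nbhs v)) (@cvg_cst _ w _ (nbhs v) _)).
Qed.

Lemma smooth_on_row_mxl U (f : 'rV[R]_(m + n) -> R^o) (w : 'rV[R]_n) :
  smooth_on U f ->
  smooth_on [set v | U (row_mx v w)] (fun v : 'rV[R]_m => f (row_mx v w)).
Proof.
move=> sf; apply/smooth_onP => k; have {sf} := (smooth_onP U f).1 sf k.
elim: k f => [|k IH] f Hf.
  split=> // x Ux; apply: (@continuous_comp _ _ _ (row_mx^~ w)).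
    exact: continuous_row_mxl.
  exact: Ck_cont Hf _ Ux.
have cf := Ck_cont Hf; have [_ [df {}Hf]] := Hf.
have dql (i : 'I_m) (x : 'rV[R]_m) :
    (fun h : R => h^-1 *: (((fun v => f (row_mx v w)) \o shift x)
        (h *: delta_mx 0 i) - f (row_mx x w)))
    = (fun h : R => h^-1 *: ((f \o shift (row_mx x w))
        (h *: delta_mx 0 (lshift n i)) - f (row_mx x w))).
  by apply/funext => h /=; rewrite row_mx_shift.
split.
  move=> x Ux; apply: (@continuous_comp _ _ _ (row_mx^~ w)).
    exact: continuous_row_mxl.
  exact: cf _ Ux.
split=> [x Ux i|i].
  by rewrite /derivable dql; exact: (df _ Ux (lshift n i)).
rewrite (_ : partial _ _ = fun v => partial (lshift n i) f (row_mx v w)); first by apply: IH; exact: Hf.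
by apply/funext => x; rewrite /partial /derive dql.
Qed.
End SmoothProduct.

(* chart_inv is only meaningful on the image of chart_dom; see is_chart. *)
Record chart (R : realType) (n : nat) (M : Type) := Chart {
  chart_dom : set M;
  chart_map :> M -> 'rV[R]_n;
  chart_inv : 'rV[R]_n -> M }.

Lemma continuous_pair (T T1 T2 : topologicalType) (f : T -> T1) (g : T -> T2) x :
  {for x, continuous f} -> {for x, continuous g} ->
  {for x, continuous (fun y => (f y, g y))}.
Proof. by move=> cf cg; exact: (cvg_pair cf cg). Qed.

Section Charts.
Variables (R : realType) (n : nat) (M : topologicalType).
Implicit Types c d : chart R n M.

Definition is_chart c :=
  [/\ open (chart_dom c), open (c @` chart_dom c),
      forall x, chart_dom c x -> chart_inv c (c x) = x,
      forall x, chart_dom c x -> {for x, continuous c} &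
      forall v, (c @` chart_dom c) v -> {for v, continuous (chart_inv c)}].

Definition compatible c d :=
  forall j, smooth_on (c @` (chart_dom c `&` chart_dom d))
                      (fun v => d (chart_inv c v) 0 j).

End Charts.

(* Any atlas, not necessarily maximal: compatible atlases give the same smooth
   functions and the same topologies below. Paracompactness is not required here;
   it follows from second countability, which the theorem assumes. *)
HB.mixin Record Topological_isManifold (R : realType) (n : nat) M
    of Topological M := {
  atlas : set (chart R n M);
  atlas_chart : forall c, atlas c -> is_chart c;
  atlas_cover : forall x : M, exists2 c, atlas c & chart_dom c x;
  atlas_compatible : forall c d, atlas c -> atlas d -> compatible c d;
  manifold_hausdorff : hausdorff_space M }.

#[short(type="manifoldType")]
HB.structure Definition Manifold (R : realType) (n : nat) :=
  {M of Topological_isManifold R n M & Topological M}.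

Arguments atlas {R n} M : rename.
Arguments atlas_chart {R n M} c : rename.
Arguments atlas_cover {R n M} x : rename.
Arguments atlas_compatible {R n M} c d : rename.

Section ProductManifold.
Variables (R : realType) (m n : nat).
Variables (M : manifoldType R m) (N : manifoldType R n).

Definition prod_chart (c : chart R m M) (d : chart R n N) :
    chart R (m + n) (M * N)%type :=
  Chart [set p | chart_dom c p.1 /\ chart_dom d p.2]
        (fun p => row_mx (c p.1) (d p.2))
        (fun v => (chart_inv c (lsubmx v), chart_inv d (rsubmx v))).

Definition prod_atlas : set (chart R (m + n) (M * N)%type) :=
  [set e | exists c d, [/\ atlas M c, atlas N d & e = prod_chart c d]].

Lemma open_prod_preimage (T T1 T2 : topologicalType) (f : T -> T1) (g : T -> T2)
    A B : continuous f -> continuous g -> open A -> open B ->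
  open [set x | A (f x) /\ B (g x)].
Proof.
move=> cf cg oA oB; apply: (@openI _ (f @^-1` A) (g @^-1` B)).
  by apply: open_comp => // x _; exact: cf.
by apply: open_comp => // x _; exact: cg.
Qed.

Lemma prod_chart_image c d A B :
  prod_chart c d @` [set p | A p.1 /\ B p.2] =
  [set v | (c @` A) (lsubmx v) /\ (d @` B) (rsubmx v)].
Proof.
apply/seteqP; split=> [_ [[x y] /= [Ax By] <-]|v [[x Ax cx] [y By dy]]] /=.
  by rewrite row_mxKl row_mxKr; split; [exists x|exists y].
by exists (x, y) => //=; rewrite cx dy hsubmxK.
Qed.

Lemma prod_atlas_chart c : prod_atlas c -> is_chart c.
Proof.
move=> [{}c [d [/atlas_chart[oc oic cK cc cic] /atlas_chart[od oid dK cd cid] ->]]].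
split.
- by apply: open_prod_preimage => //= -[x y]; [exact: cvg_fst|exact: cvg_snd].
- rewrite prod_chart_image.
  by apply: open_prod_preimage => //; [exact: continuous_lsubmx|exact: continuous_rsubmx].
- by move=> [x y] /= [cx dy]; rewrite row_mxKl row_mxKr cK// dK.
- move=> [x y] /= [cx dy].
  apply: (@continuous_comp _ _ _ (fun p : M * N => (c p.1, d p.2))
            (fun p : 'rV[R]_m * 'rV[R]_n => row_mx p.1 p.2)); last first.
    exact: continuous_row_mx.
  apply: (@continuous_pair _ _ _ (fun p : M * N => c p.1) (fun p => d p.2)).
    by apply: (@continuous_comp _ _ _ fst c); [exact: cvg_fst|exact: cc].
  by apply: (@continuous_comp _ _ _ snd d); [exact: cvg_snd|exact: cd].
- move=> v; rewrite prod_chart_image => -[cv dv].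
  apply: (@continuous_pair _ _ _ (chart_inv c \o lsubmx) (chart_inv d \o rsubmx)).
    apply: (@continuous_comp _ _ _ lsubmx (chart_inv c)); last exact: cic.
    exact: continuous_lsubmx.
  apply: (@continuous_comp _ _ _ rsubmx (chart_inv d)); last exact: cid.
  exact: continuous_rsubmx.
Qed.

Lemma prod_atlas_cover (p : M * N) : exists2 c, prod_atlas c & chart_dom c p.
Proof.
have [c ac cp] := atlas_cover p.1; have [d ad dp] := atlas_cover p.2.
by exists (prod_chart c d) => //; exists c, d.
Qed.

Lemma prod_atlas_compatible e e' :
  prod_atlas e -> prod_atlas e' -> compatible e e'.
Proof.
move=> [c [d [ac ad ->]]] [c' [d' [ac' ad' ->]]] j.
rewrite [X in smooth_on X](_ : _ =
  [set v | (c @` (chart_dom c `&` chart_dom c')) (lsubmx v)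
        /\ (d @` (chart_dom d `&` chart_dom d')) (rsubmx v)]); last first.
  rewrite -prod_chart_image; congr (_ @` _).
  by apply/seteqP; split=> [p [[? ?] [? ?]]|p [[? ?] [? ?]]].
case: (split_ordP j) => i ->.
  rewrite (_ : (fun v => _) = (fun v : 'rV[R]_(m + n) =>
      (fun w => c' (chart_inv c w) 0 i) (lsubmx v))); last first.
    by apply/funext => v /=; rewrite row_mxEl.
  apply: smooth_on_sub (smooth_on_lsubmx (atlas_compatible c c' ac ac' i)).
  by move=> v [].
rewrite (_ : (fun v => _) = (fun v : 'rV[R]_(m + n) =>
    (fun w => d' (chart_inv d w) 0 i) (rsubmx v))); last first.
  by apply/funext => v /=; rewrite row_mxEr.
apply: smooth_on_sub (smooth_on_rsubmx (atlas_compatible d d' ad ad' i)).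
by move=> v [].
Qed.

Lemma prod_hausdorff : hausdorff_space (M * N)%type.
Proof.
move=> [x y] [x' y'] xy; congr pair; apply: manifold_hausdorff => A B nA nB.
  have [] := xy (fst @^-1` A) (fst @^-1` B).
  - exact: cvg_fst nA.
  - exact: cvg_fst nB.
  by move=> [a b] [/= ? ?]; exists a.
have [] := xy (snd @^-1` A) (snd @^-1` B).
- exact: cvg_snd nA.
- exact: cvg_snd nB.
by move=> [a b] [/= ? ?]; exists b.
Qed.

HB.instance Definition _ := Topological_isManifold.Build R (m + n) (M * N)%type
  prod_atlas_chart prod_atlas_cover prod_atlas_compatible prod_hausdorff.

End ProductManifold.

Section SmoothMaps.
Variables (R : realType) (m n : nat).
Variables (M : manifoldType R m) (N : manifoldType R n).

Definition smooth_map (f : M -> N) :=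
  continuous f /\
  forall c d, atlas M c -> atlas N d -> forall j,
    smooth_on (c @` (chart_dom c `&` f @^-1` chart_dom d))
              (fun v => d (f (chart_inv c v)) 0 j).

End SmoothMaps.

HB.mixin Record Manifold_isLieGroup (R : realType) (n : nat) G
    of Manifold R n G & Group G := {
  lie_mul_smooth : smooth_map (fun p : G * G => (p.1 * p.2)%g);
  lie_inv_smooth : smooth_map (fun g : G => g^-1%g) }.

#[short(type="lieGroupType")]
HB.structure Definition LieGroup (R : realType) (n : nat) :=
  {G of Manifold_isLieGroup R n G & Manifold R n G & Group G}.

Section Actions.
Variables (R : realType) (m n : nat).
Variables (M : manifoldType R m) (H : lieGroupType R n).

Record smooth_right_action (act : M -> H -> M) : Prop := {
  ract1 : forall x, act x 1%g = x;
  ractM : forall x h h', act (act x h) h' = act x (h * h')%g;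
  ract_smooth : smooth_map (fun p : M * H => act p.1 p.2) }.

End Actions.

Section SmoothFunctions.
Variables (R : realType) (n : nat) (M : manifoldType R n).
Implicit Types (f g : M -> R[i]) (c : chart R n M).

Definition smooth_fun f :=
  forall c, atlas M c ->
    smooth_on (c @` chart_dom c) (fun v => complex.Re (f (chart_inv c v))) /\
    smooth_on (c @` chart_dom c) (fun v => complex.Im (f (chart_inv c v))).

Lemma smooth_fun_cst (a : R[i]) : smooth_fun (fun=> a).
Proof. by move=> c ac; split; exact: smooth_on_cst. Qed.

Lemma smooth_funD f g : smooth_fun f -> smooth_fun g ->
  smooth_fun (fun x => f x + g x).
Proof.
move=> sf sg c ac; have [_ oc _ _ _] := atlas_chart _ ac.
have [rf If] := sf c ac; have [rg Ig] := sg c ac; split.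
  apply: smooth_on_ext oc _ (smooth_onD oc rf rg) => v _.
  by case: (f _) (g _) => [a b] [a' b'].
apply: smooth_on_ext oc _ (smooth_onD oc If Ig) => v _.
by case: (f _) (g _) => [a b] [a' b'].
Qed.

Lemma smooth_funM f g : smooth_fun f -> smooth_fun g ->
  smooth_fun (fun x => f x * g x).
Proof.
move=> sf sg c ac; have [_ oc _ _ _] := atlas_chart _ ac.
have [rf If] := sf c ac; have [rg Ig] := sg c ac; split.
  have H := smooth_onD oc (smooth_onM oc rf rg)
    (smooth_onM oc (@smooth_on_cst R n _ (-1)) (smooth_onM oc If Ig)).
  apply: smooth_on_ext oc _ H => v _.
  by case: (f _) (g _) => [a b] [a' b'] /=; rewrite mulN1r.
have H := smooth_onD oc (smooth_onM oc rf Ig) (smooth_onM oc If rg).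
apply: smooth_on_ext oc _ H => v _.
by case: (f _) (g _) => [a b] [a' b'].
Qed.

End SmoothFunctions.

Section SmoothOnProduct.
Variables (R : realType) (m n : nat).
Variables (M : manifoldType R m) (H : manifoldType R n).

Lemma smooth_fun_fst (f : M -> R[i]) : smooth_fun f ->
  smooth_fun (fun p : M * H => f p.1).
Proof.
move=> sf _ [c [d [ac ad ->]]]; rewrite prod_chart_image.
have [rf If] := sf c ac; split.
  by apply: smooth_on_sub (smooth_on_lsubmx rf) => v [].
by apply: smooth_on_sub (smooth_on_lsubmx If) => v [].
Qed.

Lemma smooth_fun_slice (F : M * H -> R[i]) (h : H) : smooth_fun F ->
  smooth_fun (fun x => F (x, h)).
Proof.
move=> sF c ac; have [d ad dh] := atlas_cover h.
have [_ oc _ _ _] := atlas_chart _ ac.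
have [_ _ dK _ _] := atlas_chart _ ad.
have [rF IF] := sF (prod_chart c d) (ex_intro _ c (ex_intro _ d (And3 ac ad erefl))).
have sub : c @` chart_dom c `<=`
    [set v | (prod_chart c d @` chart_dom (prod_chart c d)) (row_mx v (d h))].
  move=> v cv; rewrite prod_chart_image /= row_mxKl row_mxKr; split=> //.
  by exists h.
split.
  have G := smooth_on_sub sub (smooth_on_row_mxl (w := d h) rF).
  apply: smooth_on_ext oc _ G => v _ /=.
  by rewrite row_mxKl row_mxKr dK.
have G := smooth_on_sub sub (smooth_on_row_mxl (w := d h) IF).
apply: smooth_on_ext oc _ G => v _ /=.
by rewrite row_mxKl row_mxKr dK.
Qed.

End SmoothOnProduct.

Section FunctionSpaces.
Variables (R : realType) (n : nat) (M : manifoldType R n).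

Definition csupport (f : M -> R[i]) : set M := closure [set x | f x != 0].

Definition Cinf_pred : {pred M -> R[i]} := fun f => `[< smooth_fun f >].

Definition Cc_pred : {pred M -> R[i]} :=
  fun f => `[< smooth_fun f /\ compact (csupport f) >].

Lemma csupport_sub (f g : M -> R[i]) :
  (forall x, f x = 0 -> g x = 0) -> csupport g `<=` csupport f.
Proof.
by move=> fg; apply: closure_subset => x /= /eqP gx; apply/eqP; apply: contra_not gx; exact: fg.
Qed.

Lemma compact_csupport_sub (f g : M -> R[i]) :
  (forall x, f x = 0 -> g x = 0) -> compact (csupport f) -> compact (csupport g).
Proof.
move=> fg cf; apply: subclosed_compact cf (csupport_sub fg).
exact: closed_closure.
Qed.

Lemma Cinf_submod_closed : submod_closed Cinf_pred.
Proof.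
split; first exact/asboolP/smooth_fun_cst.
move=> a f g /asboolP sf /asboolP sg; apply/asboolP.
have H := smooth_funD (smooth_funM (@smooth_fun_cst R n M a) sf) sg; exact: H.
Qed.

HB.instance Definition _ := GRing.isSubmodClosed.Build _ _ Cinf_pred
  Cinf_submod_closed.

Lemma Cc_submod_closed : submod_closed Cc_pred.
Proof.
split.
  apply/asboolP; split; first exact: smooth_fun_cst.
  rewrite /csupport (_ : [set _ | _] = set0) ?closure0; first exact: compact0.
  by apply/seteqP; split=> // x /=; rewrite eqxx.
move=> a f g /asboolP[sf cf] /asboolP[sg cg]; apply/asboolP; split.
  have H := smooth_funD (smooth_funM (@smooth_fun_cst R n M a) sf) sg; exact: H.
apply: subclosed_compact (compactU cf cg) _; first exact: closed_closure.
rewrite -closureU; apply: closure_subset => x /= fgx.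
have [fx|fx] := eqVneq (f x) 0; last by left.
right; apply: contraNN fgx => /eqP gx.
by rewrite -[X in X == _]/(a * f x + g x) fx gx mulr0 addr0.
Qed.

HB.instance Definition _ := GRing.isSubmodClosed.Build _ _ Cc_pred
  Cc_submod_closed.

Record Cinf := MkCinf { Cinf_fun :> M -> R[i]; _ : Cinf_fun \in Cinf_pred }.
HB.instance Definition _ := [isSub for Cinf_fun].
HB.instance Definition _ := [Choice of Cinf by <:].
HB.instance Definition _ := [SubChoice_isSubLmodule of Cinf by <:].

Record Cc := MkCc { Cc_fun :> M -> R[i]; _ : Cc_fun \in Cc_pred }.
HB.instance Definition _ := [isSub for Cc_fun].
HB.instance Definition _ := [Choice of Cc by <:].
HB.instance Definition _ := [SubChoice_isSubLmodule of Cc by <:].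

Lemma Cinf_smooth (f : Cinf) : smooth_fun f.
Proof. exact/asboolP/(valP f). Qed.

Lemma Cc_smooth (f : Cc) : smooth_fun f.
Proof. by have /asboolP[] := valP f. Qed.

Lemma Cc_compact (f : Cc) : compact (csupport f).
Proof. by have /asboolP[] := valP f. Qed.

Fact Cc_mulP (f g : Cc) : (fun x => f x * g x) \in Cc_pred.
Proof.
apply/asboolP; split; first by apply: smooth_funM; exact: Cc_smooth.
by apply: compact_csupport_sub (@Cc_compact f) => x ->; rewrite mul0r.
Qed.

Definition Cc_mul (f g : Cc) : Cc := MkCc (Cc_mulP f g).

End FunctionSpaces.
Arguments Cinf {R n} M.
Arguments Cc {R n} M.

Section Tensor.
Variables (K : fieldType) (S : Type) (E F : lmodType K).
Variables (actE : S -> E -> E) (actF : S -> F -> F).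
Implicit Types (s t : seq (E * F)).

(* The finite sequence s stands for the formal sum of the a (x) b, (a, b) in s;
   the sum is concatenation and scalars act on the left components.  The relation
   is the least K-linear congruence making (x) bilinear and balanced. *)
Inductive tensor_eq : seq (E * F) -> seq (E * F) -> Prop :=
| TensorRefl s : tensor_eq s s
| TensorSym s t : tensor_eq s t -> tensor_eq t s
| TensorTrans s t u : tensor_eq s t -> tensor_eq t u -> tensor_eq s u
| TensorCat s1 t1 s2 t2 :
    tensor_eq s1 t1 -> tensor_eq s2 t2 -> tensor_eq (s1 ++ s2) (t1 ++ t2)
| TensorSwap s t : tensor_eq (s ++ t) (t ++ s)
| TensorZ (c : K) s t : tensor_eq s t ->
    tensor_eq [seq (c *: p.1, p.2) | p <- s] [seq (c *: p.1, p.2) | p <- t]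
| Tensor0l b : tensor_eq [:: (0, b)] [::]
| TensorDl a a' b : tensor_eq [:: (a + a', b)] [:: (a, b); (a', b)]
| TensorDr a b b' : tensor_eq [:: (a, b + b')] [:: (a, b); (a, b')]
| TensorZr (c : K) a b : tensor_eq [:: (a, c *: b)] [:: (c *: a, b)]
| TensorAct (r : S) a b : tensor_eq [:: (actE r a, b)] [:: (a, actF r b)].

Definition tensor_rel : rel (seq (E * F)) := fun s t => `[< tensor_eq s t >].

Fact tensor_rel_refl : reflexive tensor_rel.
Proof. by move=> s; apply/asboolP; exact: TensorRefl. Qed.

Fact tensor_rel_sym : symmetric tensor_rel.
Proof. by move=> s t; apply/asboolP/asboolP; exact: TensorSym. Qed.

Fact tensor_rel_trans : transitive tensor_rel.
Proof.
by move=> t s u /asboolP st /asboolP tu; apply/asboolP; exact: TensorTrans st tu.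
Qed.

Canonical tensor_equiv :=
  EquivRel tensor_rel tensor_rel_refl tensor_rel_sym tensor_rel_trans.

Definition tensor := {eq_quot tensor_equiv}.
HB.instance Definition _ := Choice.on tensor.
HB.instance Definition _ := EqQuotient.on tensor.

Lemma tensor_piP s t : tensor_eq s t -> \pi_tensor s = \pi_tensor t.
Proof. by move=> st; apply/eqmodP/asboolP. Qed.

Lemma tensor_repr s : tensor_eq (repr (\pi_tensor s)) s.
Proof.
have /eqmodP/asboolP : \pi_tensor (repr (\pi_tensor s)) = \pi_tensor s.
  exact: reprK.
by [].
Qed.

Definition tensor_add (x y : tensor) : tensor := \pi_tensor (repr x ++ repr y).
Definition tensor_scale (c : K) (x : tensor) : tensor :=
  \pi_tensor [seq (c *: p.1, p.2) | p <- repr x].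

Lemma tensorW (P : tensor -> Prop) : (forall s, P (\pi_tensor s)) -> forall x, P x.
Proof. by move=> Ps x; rewrite -[x]reprK. Qed.

Lemma tensor_addE s t : tensor_add (\pi_tensor s) (\pi_tensor t) = \pi_tensor (s ++ t).
Proof. by apply: tensor_piP; apply: TensorCat; exact: tensor_repr. Qed.

Lemma tensor_scaleE c s :
  tensor_scale c (\pi_tensor s) = \pi_tensor [seq (c *: p.1, p.2) | p <- s].
Proof. by apply: tensor_piP; apply: TensorZ; exact: tensor_repr. Qed.

Fact tensor_addA : associative tensor_add.
Proof.
by elim/tensorW=> s; elim/tensorW=> t; elim/tensorW=> u; rewrite !tensor_addE catA.
Qed.

Fact tensor_addC : commutative tensor_add.
Proof.
elim/tensorW=> s; elim/tensorW=> t; rewrite !tensor_addE.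
by apply: tensor_piP; exact: TensorSwap.
Qed.

Fact tensor_add0 : left_id (\pi_tensor [::]) tensor_add.
Proof. by elim/tensorW=> s; rewrite tensor_addE. Qed.

Lemma tensor_eq_scale0 s : tensor_eq [seq (0 *: p.1, p.2) | p <- s] [::].
Proof.
elim: s => [|[a b] s IH] /=; first exact: TensorRefl.
rewrite scale0r -cat1s -[[::]]/([::] ++ [::]).
by apply: TensorCat IH; exact: Tensor0l.
Qed.

Lemma tensor_eq_scaleDl c d s :
  tensor_eq [seq ((c + d) *: p.1, p.2) | p <- s]
    ([seq (c *: p.1, p.2) | p <- s] ++ [seq (d *: p.1, p.2) | p <- s]).
Proof.
elim: s => [|[a b] s IH] /=; first exact: TensorRefl.
rewrite scalerDl -cat1s.
apply: TensorTrans (TensorCat (TensorDl _ _ _) IH) _.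
set x := (c *: a, b); set y := (d *: a, b).
set C := [seq _ | _ <- s]; set D := [seq (d *: _, _) | _ <- s].
have -> : x :: C ++ y :: D = [:: x] ++ ((C ++ [:: y]) ++ D) by rewrite -catA.
apply: (@TensorCat [:: x] [:: x] (([:: y] ++ C) ++ D)); first exact: TensorRefl.
by apply: TensorCat; [exact: TensorSwap|exact: TensorRefl].
Qed.

Definition tensor_opp (x : tensor) := tensor_scale (-1) x.

Fact tensor_addN : left_inverse (\pi_tensor [::]) tensor_opp tensor_add.
Proof.
elim/tensorW=> s; rewrite /tensor_opp tensor_scaleE tensor_addE; apply: tensor_piP.
rewrite -[X in _ ++ X](_ : [seq (1 *: p.1, p.2) | p <- s] = s); last first.
  by rewrite -[RHS]map_id; apply: eq_map => -[a b] /=; rewrite scale1r.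
apply: TensorTrans (TensorSym (tensor_eq_scaleDl _ _ _)) _.
by rewrite addNr; exact: tensor_eq_scale0.
Qed.

HB.instance Definition _ := GRing.isZmodule.Build tensor
  tensor_addA tensor_addC tensor_add0 tensor_addN.

Fact tensor_scaleA a b (v : tensor) :
  tensor_scale a (tensor_scale b v) = tensor_scale (a * b) v.
Proof.
elim/tensorW: v => s; rewrite !tensor_scaleE -map_comp; congr \pi_tensor.
by apply: eq_map => p /=; rewrite scalerA.
Qed.

Fact tensor_scale1 : left_id 1 tensor_scale.
Proof.
elim/tensorW=> s; rewrite tensor_scaleE; congr \pi_tensor.
by rewrite -[RHS]map_id; apply: eq_map => -[a b] /=; rewrite scale1r.
Qed.

Fact tensor_scaleDr : right_distributive tensor_scale +%R.
Proof.
move=> c; elim/tensorW=> s; elim/tensorW=> t.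
by rewrite /GRing.add /= !(tensor_addE, tensor_scaleE) map_cat.
Qed.

Fact tensor_scaleDl (v : tensor) :
  {morph tensor_scale^~ v : a b / a + b}.
Proof.
move=> a b; elim/tensorW: v => s; rewrite [RHS]/GRing.add /= !tensor_scaleE tensor_addE.
by apply: tensor_piP; exact: tensor_eq_scaleDl.
Qed.

HB.instance Definition _ := GRing.Zmodule_isLmodule.Build K tensor
  tensor_scaleA tensor_scale1 tensor_scaleDr tensor_scaleDl.

Definition tens (a : E) (b : F) : tensor := \pi_tensor [:: (a, b)].

(* The map induced on the tensor product by a balanced bilinear beta; it is
   computed on a chosen representative, see tensor_liftE. *)
Definition tensor_lift (V : nmodType) (beta : E -> F -> V) (t : tensor) : V :=
  \sum_(p <- repr t) beta p.1 p.2.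

Lemma tensor_liftE (V : lmodType K) (beta : E -> F -> V) :
  (forall b, linear (beta^~ b)) -> (forall a, linear (beta a)) ->
  (forall r a b, beta (actE r a) b = beta a (actF r b)) ->
  forall s, tensor_lift beta (\pi_tensor s) = \sum_(p <- s) beta p.1 p.2.
Proof.
move=> linl linr bal s; rewrite /tensor_lift.
have betaDl a a' b : beta (a + a') b = beta a b + beta a' b.
  by have := linl b 1 a a'; rewrite !scale1r.
have betaDr a b b' : beta a (b + b') = beta a b + beta a b'.
  by have := linr a 1 b b'; rewrite !scale1r.
have beta0l b : beta 0 b = 0.
  by apply: (@addrI _ (beta 0 b)); rewrite -betaDl !addr0.
have beta0r a : beta a 0 = 0.
  by apply: (@addrI _ (beta a 0)); rewrite -betaDr !addr0.
have betaZl c a b : beta (c *: a) b = c *: beta a b.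
  by have := linl b c a 0; rewrite beta0l !addr0.
have betaZr c a b : beta a (c *: b) = c *: beta a b.
  by have := linr a c b 0; rewrite beta0r !addr0.
suff sum_eq s1 s2 : tensor_eq s1 s2 ->
    \sum_(p <- s1) beta p.1 p.2 = \sum_(p <- s2) beta p.1 p.2.
  exact: sum_eq (tensor_repr s).
elim=> {s s1 s2} //=.
- by move=> s t u _ -> _ ->.
- by move=> s1 t1 s2 t2 _ e1 _ e2; rewrite !big_cat /= e1 e2.
- by move=> s t; rewrite !big_cat /= addrC.
- move=> c s t _ IH; rewrite !big_map /=.
  under eq_bigr do rewrite betaZl.
  under [RHS]eq_bigr do rewrite betaZl.
  by rewrite -!scaler_sumr IH.
- by move=> b; rewrite big_seq1 big_nil beta0l.
- by move=> a a' b; rewrite big_seq1 !big_cons big_nil addr0 betaDl.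
- by move=> a b b'; rewrite big_seq1 !big_cons big_nil addr0 betaDr.
- by move=> c a b; rewrite !big_seq1 betaZl betaZr.
- by move=> r a b; rewrite !big_seq1 bal.
Qed.

End Tensor.
Arguments tens {K S E F actE actF} a b.

Section Bialgebroid.
Variables (K : fieldType) (R A : lmodType K).
(* Algebras here need not be unital, so they are lmodTypes with a product. *)
Variables (mulR : R -> R -> R) (mulA : A -> A -> A).
Variables (iota : R -> A) (act : R -> A -> A).
Local Notation "a ** b" := (mulA a b) (at level 40, left associativity).

Definition is_bilinear (U V W : lmodType K) (f : U -> V -> W) :=
  (forall v, linear (f^~ v)) /\ (forall u, linear (f u)).

Record comm_algebra_with_local_units : Prop := {
  base_bilinear : is_bilinear mulR;
  base_mulA : associative mulR;
  base_mulC : commutative mulR;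
  base_local_units : forall rs : seq R,
    exists r, forall r', r' \in rs -> mulR r r' = r' }.

Record algebra_extension : Prop := {
  ext_bilinear : is_bilinear mulA;
  ext_mulA : associative mulA;
  ext_linear : linear iota;
  ext_inj : injective iota;
  ext_mul : {morph iota : r r' / mulR r r' >-> r ** r'};
  ext_local_units : forall s : seq A,
    exists r, forall a, a \in s -> iota r ** a = a /\ a ** iota r = a;
  ext_act : forall r a, act r a = iota r ** a }.

Definition AA : Type := tensor act act.
HB.instance Definition _ := GRing.Lmodule.on AA.
Implicit Types t u : AA.

Definition actAA (r : R) (t : AA) : AA :=
  tensor_lift (fun a b => tens (act r a) b : AA) t.

Definition ractl (r : R) (t : AA) : AA :=
  tensor_lift (fun a b => tens (a ** iota r) b : AA) t.

Definition ractr (r : R) (t : AA) : AA :=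
  tensor_lift (fun a b => tens a (b ** iota r) : AA) t.

Definition takeuchi t := forall r, ractl r t = ractr r t.

(* (sum a (x) b)(sum c (x) d) = sum ac (x) bd, which is independent of the
   representatives when t satisfies takeuchi. *)
Definition mulAA t u : AA :=
  tensor_lift (fun c d => tensor_lift (fun a b => tens (a ** c) (b ** d) : AA) t) u.

Definition tensor_assoc (t : tensor actAA act) : tensor act actAA :=
  tensor_lift (fun u c => tensor_lift (fun a b => tens a (tens b c : AA)) u) t.

Record bialgebroid (Delta : A -> AA) (eps : A -> R) : Prop := {
  bialg_base : comm_algebra_with_local_units;
  bialg_ext : algebra_extension;
  bialg_Delta_linear : linear Delta;
  bialg_Delta_act : forall r a, Delta (act r a) = actAA r (Delta a);
  bialg_eps_linear : linear eps;
  bialg_eps_act : forall r a, eps (act r a) = mulR r (eps a);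
  bialg_coassoc : forall a,
    tensor_assoc (tensor_lift (fun b c => tens (Delta b) c : tensor actAA act) (Delta a))
    = tensor_lift (fun b c => tens b (Delta c) : tensor act actAA) (Delta a);
  bialg_counitl : forall a, tensor_lift (fun b c => act (eps b) c) (Delta a) = a;
  bialg_counitr : forall a, tensor_lift (fun b c => act (eps c) b) (Delta a) = a;
  bialg_cocomm : forall a, tensor_lift (fun b c => tens c b : AA) (Delta a) = Delta a;
  bialg_takeuchi : forall a, takeuchi (Delta a);
  bialg_eps_iota : forall r, eps (iota r) = r;
  (* the canonical embedding of R sends r to r (x) r', r' any local unit for r *)
  bialg_Delta_iota : forall r r', mulR r' r = r ->
    Delta (iota r) = tens (iota r) (iota r');
  bialg_eps_mul : forall a b, eps (a ** b) = eps (a ** iota (eps b));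
  bialg_Delta_mul : forall a b, Delta (a ** b) = mulAA (Delta a) (Delta b) }.

Record antipode (Delta : A -> AA) (eps : A -> R) (S : A -> A) : Prop := {
  antipode_linear : linear S;
  antipode_inv : involutive S;
  antipode_iota : forall r, S (iota r) = iota r;
  antipode_mul : forall a b, S (a ** b) = S b ** S a;
  antipode_Delta : forall a,
    tensor_lift (fun b c => S b ** c) (Delta a) = iota (eps (S a)) }.

End Bialgebroid.

(* A vector topology is given by its filter of neighbourhoods of zero; continuity
   of linear maps is continuity at zero. *)
Section LocallyConvex.
Variable K : numFieldType.

(* N comes from a locally convex topology: (E, N) is isomorphic to a tvsType. *)
Definition locally_convex_nbhs0 (E : lmodType K) (N : set_system E) :=
  exists (T : tvsType K) (f : {linear E -> T}),
    bijective f /\ forall V : set E, N V <-> nbhs (0 : T) (f @` V).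

Definition continuous0 (E F : lmodType K) (NE : set_system E) (NF : set_system F)
    (f : E -> F) := forall V, NF V -> NE (f @^-1` V).

Definition bounded0 (E : lmodType K) (N : set_system E) (B : set E) :=
  forall V, N V -> exists2 s : K, 0 < s &
    forall t : K, s <= `|t| -> B `<=` [set t *: v | v in V].

Definition absolutely_convex (E : lmodType K) (W : set E) :=
  convex_set (W : set (convex_lmodType E)) /\
  forall (t : K) v, `|t| <= 1 -> W v -> W (t *: v).

Record locally_convex_bialgebroid (R A : lmodType K) (mulR : R -> R -> R)
    (mulA : A -> A -> A) (iota : R -> A) (act : R -> A -> A)
    (NR : set_system R) (NA : set_system A) (NAA : set_system (AA act))
    (Delta : A -> AA act) (eps : A -> R) : Prop := {
  lcb_bialgebroid : bialgebroid mulR mulA iota Delta eps;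
  lcb_base : locally_convex_nbhs0 NR;
  lcb_alg : locally_convex_nbhs0 NA;
  lcb_tensor : locally_convex_nbhs0 NAA;
  lcb_Delta : continuous0 NA NAA Delta;
  lcb_eps : continuous0 NA NR eps;
  lcb_mull : forall a, continuous0 NA NA (mulA a);
  lcb_mulr : forall b, continuous0 NA NA (mulA^~ b) }.

End LocallyConvex.

Section FunctionTopologies.
Variables (R : realType) (n : nat) (M : manifoldType R n).

Definition cpartials (c : chart R n M) (s : seq 'I_n) (f : M -> R[i]) (x : M) : R[i] :=
  partials s (fun v => complex.Re (f (chart_inv c v))) (c x) +i*
  partials s (fun v => complex.Im (f (chart_inv c v))) (c x).

(* The sets { f | |d^s f| < eps on K for finitely many (chart, K, s) }. *)
Definition Cinf_basic_nbhs0 (B : set (M -> R[i])) :=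
  exists (l : nat) (c : 'I_l -> chart R n M) (K : 'I_l -> set M)
    (s : 'I_l -> seq 'I_n) (eps : R),
  [/\ 0 < eps,
      forall j, [/\ atlas M (c j), compact (K j) & K j `<=` chart_dom (c j)] &
      B = [set f | forall j x, K j x -> `|cpartials (c j) (s j) f x| < eps%:C]].

Definition Cinf_nbhs0 : set_system (Cinf M) :=
  [set V | exists2 B, Cinf_basic_nbhs0 B & forall f : Cinf M, B f -> V f].

(* The inductive limit, in locally convex spaces, of the subspaces of functions
   supported in a compact L. *)
Definition Cc_nbhs0 : set_system (Cc M) :=
  [set V | exists W, [/\ W `<=` V, absolutely_convex W &
    forall L : set M, compact L -> exists2 B, Cinf_basic_nbhs0 B &
      forall f : Cc M, csupport f `<=` L -> B f -> W f]].

End FunctionTopologies.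
Arguments Cinf_nbhs0 {R n} M.
Arguments Cc_nbhs0 {R n} M.

Section Dirac.
Variables (R : realType) (m n : nat).
Variables (M : manifoldType R m) (H : lieGroupType R n).
Local Notation CMH := (Cinf (M * H)%type).

Fact Cc_scaleP (f : Cc M) (F : CMH) :
  (fun p => f p.1 * F p) \in @Cinf_pred R (m + n) (M * H)%type.
Proof.
apply/asboolP; apply: smooth_funM (Cinf_smooth F).
exact: smooth_fun_fst (@Cc_smooth _ _ _ f).
Qed.

Definition Cc_scale (f : Cc M) (F : CMH) : CMH := MkCinf (Cc_scaleP f F).

(* Here (f . F)(x, h) = f x * F (x, h) is Cc_scale f F. *)
Definition E_t' (T : CMH -> Cc M) :=
  [/\ linear T, continuous0 (Cinf_nbhs0 _) (Cc_nbhs0 M) T &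
      forall f F, T (Cc_scale f F) = Cc_mul f (T F)].

Fact dirac_evalP (h : H) (f : Cc M) (F : CMH) :
  (fun x => f x * F (x, h)) \in @Cc_pred R m M.
Proof.
apply/asboolP; split.
  by apply: smooth_funM (@Cc_smooth _ _ _ f) (smooth_fun_slice _ (Cinf_smooth F)).
by apply: compact_csupport_sub (@Cc_compact _ _ _ f) => x ->; rewrite mul0r.
Qed.

Definition dirac_eval (h : H) (f : Cc M) (F : CMH) : Cc M := MkCc (dirac_evalP h f F).

Definition dirac_pred : {pred CMH -> Cc M} := fun T =>
  `[< exists s : seq (R[i] * (H * Cc M)),
        T = \sum_(p <- s) p.1 *: dirac_eval p.2.1 p.2.2 >].

Lemma dirac_submod_closed : submod_closed dirac_pred.
Proof.
split; first by apply/asboolP; exists [::]; rewrite big_nil.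
move=> a T U /asboolP[s ->] /asboolP[t ->]; apply/asboolP.
exists ([seq (a * p.1, p.2) | p <- s] ++ t).
rewrite big_cat big_map /= scaler_sumr; congr (_ + _).
by apply: eq_bigr => p _; rewrite scalerA.
Qed.

HB.instance Definition _ := GRing.isSubmodClosed.Build _ _ dirac_pred
  dirac_submod_closed.

Record Dirac := MkDirac { Dirac_fun :> CMH -> Cc M; _ : Dirac_fun \in dirac_pred }.
HB.instance Definition _ := [isSub for Dirac_fun].
HB.instance Definition _ := [Choice of Dirac by <:].
HB.instance Definition _ := [SubChoice_isSubLmodule of Dirac by <:].

Fact dirac_genP h f : dirac_eval h f \in dirac_pred.
Proof. by apply/asboolP; exists [:: (1, (h, f))]; rewrite big_seq1 scale1r. Qed.

(* [[E_h, f]] *)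
Definition dirac_gen h f : Dirac := MkDirac (dirac_genP h f).

Fact dirac_actP (f : Cc M) (u : Dirac) :
  (fun F => u (Cc_scale f F)) \in dirac_pred.
Proof.
have /asboolP[s us] := valP u; apply/asboolP.
exists [seq (p.1, (p.2.1, Cc_mul f p.2.2)) | p <- s].
rewrite big_map; apply/funext => F; rewrite us !fct_sumE.
apply: eq_bigr => p _; apply: val_inj; apply/funext => x /=.
congr (p.1 *: _); rewrite /= mulrA; congr (_ * _); exact: mulrC.
Qed.

Definition dirac_act (f : Cc M) (u : Dirac) : Dirac := MkDirac (dirac_actP f u).

Definition Dirac_nbhs0 : set_system Dirac :=
  [set U | exists B V, [/\ bounded0 (Cinf_nbhs0 _) B, Cc_nbhs0 M V &
     forall u : Dirac, (forall F, B F -> V (u F)) -> U u]].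

Definition dirac_pairing (F G : CMH) (t : AA dirac_act) : Cc M :=
  tensor_lift (fun u v : Dirac => Cc_mul (u F) (v G)) t.

Definition Dirac2_nbhs0 : set_system (AA dirac_act) :=
  [set U | exists B1 B2 V, [/\ bounded0 (Cinf_nbhs0 _) B1,
     bounded0 (Cinf_nbhs0 _) B2, Cc_nbhs0 M V &
     forall t, (forall F G, B1 F -> B2 G -> V (dirac_pairing F G t)) -> U t]].

Variable act : M -> H -> M.

(* x |-> f (xh) lies in C_c^oo(M) when act is a smooth action, so the default
   value 0 is never taken there. *)
Definition translate (h : H) (f : Cc M) : Cc M :=
  insubd (0 : Cc M) (fun x => f (act x h)).

(* These equations determine the maps, since the dirac_gen h f span and the
   maps are (bi)linear; g is any 1_f. *)
Record dirac_structure (mul : Dirac -> Dirac -> Dirac)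
    (Delta : Dirac -> AA dirac_act) (eps : Dirac -> Cc M) (S : Dirac -> Dirac) : Prop := {
  dirac_mulE : forall h1 f1 h2 f2,
    mul (dirac_gen h1 f1) (dirac_gen h2 f2)
    = dirac_gen (h1 * h2)%g (Cc_mul f1 (translate h1 f2));
  dirac_DeltaE : forall h f g, Cc_mul g f = f ->
    Delta (dirac_gen h f) = tens (dirac_gen h f) (dirac_gen h g);
  dirac_epsE : forall h f, eps (dirac_gen h f) = f;
  dirac_antipodeE : forall h f,
    S (dirac_gen h f) = dirac_gen h^-1%g (translate h^-1%g f) }.

End Dirac.

(* Main.v *)
Require Import Defs.
From HB Require Import structures.
From mathcomp Require Import all_boot all_order all_algebra.
From mathcomp Require Import boolp classical_sets functions reals.
From mathcomp Require Import topology normedtype derive complex.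
From mathcomp Require Import interval_inference convex landau sequences exp realfun.
From mathcomp Require Import ring lra.

(** The algebra Dirac(M x| H) is spanned by the elements [[E_h, f]], and each
    structure map is prescribed on them. So there are two things to prove: the
    prescriptions extend to linear maps satisfying the axioms, and these maps
    are continuous.

    Algebra. Given finitely many distinct points of H, bump functions produce
    smooth functions on H that are 1 at one of these points and 0 at the others.
    Evaluating a Dirac element at their pullbacks to M * H recovers its
    coefficients ([dirac_comb_eq0]); hence the Dirac elements form the direct
    sum of copies of C_c^oo(M) indexed by H, and linear maps out of it are given
    by arbitrary families of linear maps out of C_c^oo(M) ([dirac_lift]). The
    axioms that equate two linear maps can therefore be checked on generators
    ([dirac_ext]). There they follow from the axioms of an action and from the
    balancing relation
      [[E_h, r f]] (x) [[E_h, g]] = [[E_h, f]] (x) [[E_h, r g]],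
    which also shows that the choice of 1_f is irrelevant ([tens_gen_unit]).
    The functions 1_f exist because C_c^oo(M) has local units, again by bump
    functions ([Cc_bump], [Cc_unit_compact]).

    Topology. The topologies of the Dirac elements and of their tensor square
    are both topologies of uniform convergence, on bounded sets of functions,
    of maps to C_c^oo(M): the evaluations u |-> u(F), and the pairings with
    F (x) G. Such a topology is locally convex as soon as the values at each
    vector, over a bounded set of functions, form a bounded set
    ([uniform_locally_convex]). Each structure map is then transposed to an
    operation on functions:
      (F (x) G)(Delta u) = u(F G)                      ([pairing_Delta]),
      epsilon(u) = u(1)                                ([dirac_eps_at1]),
      ([[E_h, f]] * v)(F) = f (h v(F')),
        with F'(x, k) = F(x h^-1, h k)                 ([dirac_mul_genl]),
      (u * [[E_h, f]])(F) = u(F''),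
        with F''(x, k) = f(x k) F(x, k h)              ([dirac_mul_genr]).
    So continuity follows from three facts on smooth functions: bounded sets
    are stable under products ([bounded_Cinf_mul]), products with a fixed
    function and pullbacks along smooth maps are continuous
    ([Cinf_mul_continuous], [Cinf_pull_continuous]), and g |-> f (h g) is
    continuous on C_c^oo(M) ([translate_mul_continuous]).

    These in turn are estimates on compact sets. The derivatives of a product
    or of a composite with a smooth map are finite sums of products of
    derivatives with coefficients that do not depend on the function which
    varies ([partialsM], [weighted_pullback]). *)

Set Implicit Arguments.
Unset Strict Implicit.
Unset Printing Implicit Defensive.

Import Order.TTheory GRing.Theory Num.Theory.
Import numFieldNormedType.Exports.

Local Open Scope classical_set_scope.
Local Open Scope ring_scope.

(** * Differential calculus in several real variables *)

Lemma continuous_big_sum (R : realType) (T : topologicalType) (I : Type)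
    (s : seq I) (F : I -> T -> R^o) x :
  (forall i, {for x, continuous (F i)}) ->
  {for x, continuous (fun v => \sum_(i <- s) F i v)}.
Proof.
move=> cF; elim: s => [|i s IH].
  have -> : (fun v => \sum_(i <- [::]) F i v) = (fun=> 0).
    by apply/funext => v; rewrite big_nil.
  exact: cst_continuous.
have -> : (fun v => \sum_(i <- i :: s) F i v)
    = (fun v => F i v + \sum_(i <- s) F i v).
  by apply/funext => v; rewrite big_cons.
by apply: (@continuousD _ R^o); [exact: cF|exact: IH].
Qed.

Section LinearForm.
Variables (R : realType) (n : nat) (a : 'I_n -> R).

Definition lin_form (v : 'rV[R]_n) : R^o := \sum_j v 0 j * a j.

Fact lin_form_is_linear : linear lin_form.
Proof.
move=> c u v; rewrite /lin_form scaler_sumr -big_split; apply: eq_bigr => j _.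
by rewrite !mxE mulrDl -mulrA.
Qed.
HB.instance Definition _ := GRing.isLinear.Build R 'rV[R]_n R^o _ lin_form
  lin_form_is_linear.

Lemma continuous_lin_form : continuous lin_form.
Proof.
move=> v; apply: continuous_big_sum => j.
apply: (@continuousM R); last exact: cst_continuous.
exact: (@coord_continuous R 1 n 0 j).
Qed.

End LinearForm.

Section MeanValue.
Variables (R : realType) (n : nat).
Implicit Types (f : 'rV[R]_n -> R^o) (x : 'rV[R]_n).

Lemma coord_norm (v : 'rV[R]_n) j : `|v 0 j| <= `|v|.
Proof. rewrite [leRHS]/Num.Def.normr/= mx_normrE. exact: (le_bigmax _ _ (0, j)). Qed.

(** The end point a has no prescribed sign, because in a ball of the sup norm
    only the absolute values of the coordinates are controlled. *)
Lemma mean_value (g dg : R -> R) (a : R) :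
  (forall t : R, `|t| <= `|a| -> is_derive t 1 g (dg t)) ->
  exists2 t, `|t| <= `|a| & g a - g 0 = dg t * a.
Proof.
move=> dgP; have cg (t : R) : `|t| <= `|a| -> {for t, continuous g}.
  by move=> ta; apply/differentiable_continuous/derivable1_diffP; case: (dgP t ta).
have [a0|a0] := leP 0 a.
  have [||t] := @MVT_segment R g dg 0 a a0.
  - move=> t; rewrite in_itv /= => /andP[/ltW t0 /ltW ta]; apply: dgP.
    by rewrite !ger0_norm.
  - apply/continuous_in_subspaceT => t /[!inE] /=; rewrite in_itv /= => /andP[t0 ta].
    by apply: cg; rewrite !ger0_norm.
  rewrite in_itv /= => /andP[t0 ta]; rewrite subr0 => e.
  by exists t => //; rewrite !ger0_norm.
have [||t] := @MVT_segment R g dg a 0 (ltW a0).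
- move=> t; rewrite in_itv /= => /andP[t0 ta]; apply: dgP.
  by rewrite !ltr0_norm // lerN2 ltW.
- apply/continuous_in_subspaceT => t /[!inE] /=; rewrite in_itv /= => /andP[t0 ta].
  by apply: cg; rewrite !ler0_norm ?lerN2 // ltW.
rewrite in_itv /= => /andP[t0 ta]; rewrite sub0r mulrN => e.
exists t; first by rewrite !ler0_norm ?lerN2 // ltW.
by rewrite -[LHS]opprB e opprK.
Qed.

End MeanValue.

(** Turns a derivative in a direction into a derivative of a function of one
    real variable, where the mean value theorem and the chain rule apply. *)
Lemma is_derive_line (R : numFieldType) (V W : normedModType R) (f : V -> W)
    (x w : V) (t : R) d :
  is_derive (t *: w + x) w f d <-> is_derive t 1 (fun h : R => f (h *: w + x)) d.
Proof.
have E : (fun h : R => h^-1 *: ((f \o shift (t *: w + x)) (h *: w) - f (t *: w + x)))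
  = (fun h : R => h^-1 *: (((fun h => f (h *: w + x)) \o shift t) (h *: 1)
                          - f (t *: w + x))).
  by apply/funext => h /=; rewrite addrA -scalerDl [h *: 1]mulr1.
have dE : derivable f (t *: w + x) w = derivable (fun h : R => f (h *: w + x)) t 1.
  by rewrite /derivable E.
have DE : 'D_w f (t *: w + x) = 'D_1 (fun h : R => f (h *: w + x)) t.
  by rewrite /derive E.
by split=> -[df <-]; apply: DeriveDef; rewrite ?dE -?DE // -dE.
Qed.

Section ContinuouslyDifferentiable.
Variables (R : realType) (n : nat).
Variables (U : set 'rV[R]_n) (f : 'rV[R]_n -> R^o).
Implicit Types x : 'rV[R]_n.
Hypothesis oU : open U.
Hypothesis df : forall x, U x -> forall i, derivable f x (delta_mx 0 i).
Hypothesis cdf : forall x, U x -> forall i, {for x, continuous (partial i f)}.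

Let trunc (k : nat) (h : 'rV[R]_n) : 'rV[R]_n :=
  \row_j (if (j < k)%N then h 0 j else 0).

(** One coordinate of h is switched on at a time. Each switch is a mean value
    theorem along an axis, and replacing the partial derivative at the
    intermediate point by the one at x costs eps times the norm of h. *)
Let trunc_bound x (Ux : U x) (k : nat) (eps : R) : 0 < eps ->
  exists2 d : R, 0 < d & forall h : 'rV[R]_n, `|h| < d ->
    `|f (trunc k h + x) - f x - lin_form (fun j => partial j f x) (trunc k h)|
      <= k%:R * eps * `|h|.
Proof.
move=> e0; elim: k => [|k [d d0 IH]].
  exists 1 => // h _.
  rewrite (_ : trunc 0 h = 0) ?add0r ?subrr ?linear0 ?addr0 ?normr0 ?mul0r //.
  by apply/rowP => j; rewrite !mxE.
have [kn|nk] := ltnP k n; last first.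
  exists d => // h hd.
  have -> : trunc k.+1 h = trunc k h.
    by apply/rowP => j; rewrite !mxE (leq_trans (ltn_ord j) nk) leqW ?(leq_trans (ltn_ord j) nk).
  apply: le_trans (IH h hd) _; rewrite ler_wpM2r ?normr_ge0 // ler_wpM2r ?(ltW e0) //.
  by rewrite ler_nat.
pose i := Ordinal kn.
have [r r0 rP] : exists2 r : R, 0 < r & forall h : 'rV[R]_n, `|h| < r ->
    U (h + x) /\ `|partial i f (h + x) - partial i f x| < eps.
  have : \forall y \near x, U y /\ `|partial i f y - partial i f x| < eps.
    apply: filterI; first exact: open_nbhs_nbhs.
    by have /cvgr_distC_lt/(_ _ e0) := @cdf x Ux i.
  move=> /nbhs_ballP[r /= r0 rP]; exists r => // h hr; apply: rP.
  by rewrite -ball_normE /= opprD addrC subrK normrN.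
exists (Num.min d r); first by rewrite lt_min d0.
move=> h; rewrite lt_min => /andP[hd hr].
have nk (t : R) : `|t| <= `|h 0 i| -> `|t *: delta_mx 0 i + trunc k h| <= `|h|.
  move=> th; rewrite [leLHS]/Num.Def.normr/= mx_normrE.
  apply: bigmax_le => //= -[j1 j] _ /=; rewrite !mxE ord1 /=.
  have [->|ji] := eqVneq j i.
    by rewrite ltnn mulr1 addr0; apply: le_trans th (coord_norm _ _).
  by rewrite mulr0 add0r; case: ifP => _; rewrite ?normr0 // coord_norm.
have tE : trunc k.+1 h = h 0 i *: delta_mx 0 i + trunc k h.
  apply/rowP => j; rewrite !mxE /= ltnS leq_eqVlt.
  have [->|ji] := eqVneq j i; first by rewrite /= eqxx mulr1 ltnn addr0.
  by rewrite -(inj_eq val_inj) in ji; rewrite (negbTE ji) mulr0 add0r.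
pose g (t : R) := f (t *: delta_mx 0 i + (trunc k h + x)).
have dg (t : R) : `|t| <= `|h 0 i| ->
    is_derive t 1 g (partial i f (t *: delta_mx 0 i + trunc k h + x)).
  move=> th; have [Ut _] := rP _ (le_lt_trans (nk _ th) hr).
  apply/(is_derive_line f (trunc k h + x)); rewrite addrA.
  exact/derivableP/df.
have [t th] := mean_value dg.
rewrite {1}/g addrA -tE /g scale0r add0r => gE.
rewrite (_ : _ - _ = (f (trunc k.+1 h + x) - f (trunc k h + x))
    - h 0 i * partial i f x
    + (f (trunc k h + x) - f x - lin_form (fun j => partial j f x) (trunc k h))); last first.
  rewrite tE linearD linearZ /=; set L := lin_form _ (delta_mx 0 i).
  have -> : L = partial i f x.
    rewrite /L /lin_form (bigD1 i) //= big1 => [|j ji].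
      by rewrite mxE !eqxx mul1r addr0.
    by rewrite mxE (negbTE ji) andbF mul0r.
  rewrite -[_ *: partial i f x]/(h 0 i * partial i f x).
  set A := f _; set B := f _; set C := f _; set D := lin_form _ _; set G := _ * _.
  ring.
apply: le_trans (ler_normD _ _) _.
rewrite gE -natr1 mulrDl mulrDl mul1r addrC lerD //; first exact: IH.
rewrite [_ * h 0 i]mulrC -mulrBr normrM mulrC ler_pM //; last exact: coord_norm.
by have [_ /ltW] := rP _ (le_lt_trans (nk _ th) hr).
Qed.

(** Smoothness is defined by iterated partial derivatives, whereas the chain
    rule needs a total differential; continuity of the partial derivatives
    provides it. *)
Lemma C1_differentiable x : U x -> differentiable f x.
Proof.
move=> Ux; pose L : {linear 'rV[R]_n -> R^o} := lin_form (fun j => partial j f x).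
have cL : continuous L by exact: continuous_lin_form.
suff fE : (f : 'rV[R]_n -> R^o) \o shift x
    = cst (f x) + (L : 'rV[R]_n -> R^o) +o_ (0 : 'rV[R]_n) id.
  have dE := diff_unique cL fE.
  by apply/diff_locallyP; rewrite dE.
apply/eqaddoP => _/posnumP[eps].
have e0 : 0 < eps%:num / n.+1%:R by [].
have [d d0 dP] := trunc_bound Ux n e0.
apply/nbhs_ballP; exists d => // h; rewrite -ball_normE /= sub0r normrN => hd.
have := dP h hd.
have -> : trunc n h = h by apply/rowP => j; rewrite !mxE ltn_ord.
rewrite -[X in `|X| <= _ -> _]addrA -opprD.
move=> H; apply: le_trans H _.
rewrite ler_wpM2r ?normr_ge0 // mulrCA ger_pMr // ler_pdivrMr ?ltr0Sn // mul1r ler_nat.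
exact: leqnSn.
Qed.

End ContinuouslyDifferentiable.

Section ChainRule.
Variables (R : realType) (m n : nat).
Implicit Types (g : 'rV[R]_n -> R^o) (phi : 'rV[R]_m -> 'rV[R]_n).

(** On the line through x in direction w this is the chain rule for a curve,
    which is why phi need only be derivable in the direction w. *)
Lemma is_derive_comp g phi x w :
  differentiable g (phi x) ->
  (forall j, derivable (fun v => phi v 0 j : R^o) x w) ->
  is_derive x w (fun v => g (phi v) : R^o)
    (\sum_j 'D_w (fun v => phi v 0 j : R^o) x * partial j g (phi x)).
Proof.
move=> dg dphi.
have dphi' : derivable phi x w.
  by apply/derivable_mxP => i j; rewrite ord1; exact: dphi.
pose psi (h : R) := phi (h *: w + x).
have psi0 : psi 0 = phi x by rewrite /psi scale0r add0r.
have dpsi : differentiable psi 0 by move/derivable1P: dphi' => /derivable1_diffP.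
have dgp : differentiable (g \o psi) 0.
  by apply: differentiable_comp => //; rewrite psi0.
have D : 'D_1 (g \o psi) 0 = 'd g (phi x) ('D_w phi x) :> R^o.
  rewrite deriveE // diff_comp //=; last by rewrite psi0.
  rewrite psi0; congr ('d _ _ _); rewrite -deriveE //.
  have /is_derive_line[_ ->] : is_derive (0 *: w + x) w phi ('D_w phi x).
    by rewrite scale0r add0r; exact: derivableP.
  by [].
rewrite -[X in is_derive X](add0r x) -(scale0r w); apply/is_derive_line.
apply: DeriveDef; first exact: diff_derivable.
rewrite D derive_mx // {1}(row_sum_delta (\matrix_(i, j) _)) linear_sum.
apply: eq_bigr => j _; rewrite linearZ /= -deriveE // mxE.
by [].
Qed.

End ChainRule.

(** * Iterated partial derivatives of composites and products *)

Section SmoothOperators.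
Variables (R : realType) (n : nat).
Implicit Types (f g : 'rV[R]_n -> R^o) (U : set 'rV[R]_n).

Lemma smooth_on_continuous U f x : smooth_on U f -> U x -> {for x, continuous f}.
Proof. by move=> sf /(sf [::])[]. Qed.

Lemma smooth_on_partials U f s : smooth_on U f -> smooth_on U (partials s f).
Proof.
by move=> sf t x /(sf (s ++ t)); rewrite /partials foldl_cat.
Qed.

Lemma smooth_on_partial U f i : smooth_on U f -> smooth_on U (partial i f).
Proof. exact: (@smooth_on_partials _ _ [:: i]). Qed.

Lemma smooth_on_is_derive U f i x : smooth_on U f -> U x ->
  is_derive x (delta_mx 0 i) f (partial i f x).
Proof. by move=> sf /(sf [::])[_ /(_ i)] /derivableP. Qed.

Lemma partials_rcons s i f : partials (rcons s i) f = partial i (partials s f).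
Proof. by rewrite /partials foldl_rcons. Qed.

Lemma smooth_on_differentiable U f x : open U -> smooth_on U f -> U x ->
  differentiable f x.
Proof.
move=> oU sf; apply: C1_differentiable => // y Uy i; first by have [_] := sf [::] y Uy.
by have [] := sf [:: i] y Uy.
Qed.

Lemma is_derive_big_sum (I : Type) (s : seq I) (F dF : I -> 'rV[R]_n -> R^o) x v :
  (forall i, is_derive x v (F i) (dF i x)) ->
  is_derive x v (fun y => \sum_(i <- s) F i y : R^o) (\sum_(i <- s) dF i x).
Proof.
move=> dFP; elim: s => [|i s IH].
  rewrite big_nil (_ : (fun y => _) = cst 0); first exact: is_derive_cst.
  by apply/funext => y; rewrite big_nil.
rewrite big_cons (_ : (fun y => _) = F i + (fun y => \sum_(i <- s) F i y)).
  exact: is_deriveD.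
by apply/funext => y; rewrite big_cons.
Qed.

(** Computes all iterated derivatives of f at once: a family G indexed by
    multi-indices that starts at f and is closed under differentiation can only
    be the family of derivatives of f. The formulas for derivatives below are
    obtained by guessing such a family. *)
Lemma smooth_on_open_ext U f (G : seq 'I_n -> 'rV[R]_n -> R^o) : open U ->
  (forall x, U x -> f x = G [::] x) ->
  (forall s x, U x -> {for x, continuous (G s)}) ->
  (forall s i x, U x -> is_derive x (delta_mx 0 i) (G s) (G (rcons s i) x)) ->
  smooth_on U f /\ forall s x, U x -> partials s f x = G s x.
Proof.
move=> oU f0 cG dG.
have fE s : forall x, U x -> partials s f x = G s x.
  elim/last_ind: s => [//|s i IH] x Ux; rewrite partials_rcons /partial.
  have [_ <-] := dG s i x Ux; apply: near_eq_derive; exact: open_near_eq oU IH Ux.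
split=> // s x Ux; split.
  by apply: near_eq_continuous oU _ Ux (cG s x Ux) => y Uy; rewrite fE.
move=> i; have [dGx _] := dG s i x Ux.
by apply: near_eq_derivable dGx; apply: open_near_eq oU _ Ux => y Uy; rewrite fE.
Qed.

End SmoothOperators.

Section WeightedPullback.
Variables (R : realType) (m n : nat) (phi : 'rV[R]_m -> 'rV[R]_n).
Implicit Types (L : seq (seq 'I_n * ('rV[R]_m -> R^o))) (g : 'rV[R]_n -> R^o).

(** A list of pairs (t, a) stands for the differential operator along phi that
    sums the products of a with the t-th derivative of g composed with phi. The
    steps are the product rule and the chain rule, so that operators of this
    form are stable under differentiation. *)
Definition pull_op L g (x : 'rV[R]_m) : R^o :=
  \sum_(p <- L) p.2 x * partials p.1 g (phi x).

Definition pull_step L (i : 'I_m) : seq (seq 'I_n * ('rV[R]_m -> R^o)) :=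
  flatten [seq (p.1, partial i p.2) ::
    [seq (rcons p.1 j, fun x => p.2 x * partial i (fun v => phi v 0 j) x : R^o)
      | j <- enum 'I_n] | p <- L].

Definition pull_list (a : 'rV[R]_m -> R^o) s := foldl pull_step [:: ([::], a)] s.

Variables (U : set 'rV[R]_m) (V : set 'rV[R]_n).
Hypotheses (oU : open U) (oV : open V) (UV : forall x, U x -> V (phi x)).
Hypothesis sphi : forall j, smooth_on U (fun v => phi v 0 j : R^o).

Let smooth_coefs L := forall p, List.In p L -> smooth_on U p.2.

Lemma continuous_coords x : U x -> {for x, continuous phi}.
Proof.
move=> Ux A /nbhs_ballP[e /= e0 eA].
have : \forall y \near x, forall j, `|phi x 0 j - phi y 0 j| < e.
  apply: (@filter_forall _ _ (fun j y => `|phi x 0 j - phi y 0 j| < e) (nbhs x)) => j.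
  exact: ((cvgrPdist_lt _ _).1 (smooth_on_continuous (sphi j) Ux)).
by apply: filterS => y ye; apply: eA; split=> // i j; rewrite ord1; exact: ye.
Qed.

Lemma pull_step_smooth L i : smooth_coefs L -> smooth_coefs (pull_step L i).
Proof.
elim: L => [//|q L IH] sL p /=.
rewrite /pull_step /=; case=> [<-|/(List.in_app_or _ _ _) pL]; last case: pL.
- by apply: smooth_on_partial; apply: sL; left.
- move=> /List.in_map_iff[j [<- _]] /=; apply: smooth_onM => //.
    by apply: sL; left.
  exact: smooth_on_partial.
- by apply: IH => r rL; apply: sL; right.
Qed.

Lemma pull_list_smooth a s : smooth_on U a -> smooth_coefs (pull_list a s).
Proof.
move=> sa; elim/last_ind: s => [p [<-|]//|s i IH].
by rewrite /pull_list foldl_rcons; exact: pull_step_smooth.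
Qed.

Lemma continuous_pull_op L g x : smooth_coefs L -> smooth_on V g -> U x ->
  {for x, continuous (pull_op L g)}.
Proof.
move=> + sg Ux; elim: L => [|p L IH] sL.
  rewrite (_ : pull_op _ _ = fun=> 0); first exact: cst_continuous.
  by apply/funext => y; rewrite /pull_op big_nil.
rewrite (_ : pull_op _ _ =
    (fun y => p.2 y * partials p.1 g (phi y)) + pull_op L g); last first.
  by apply/funext => y; rewrite /pull_op big_cons.
apply: continuousD; last by apply: IH => q qL; apply: sL; right.
apply: (@continuousM R).
  by apply: smooth_on_continuous Ux; apply: sL; left.
apply: continuous_comp; first exact: continuous_coords.
exact: smooth_on_continuous (smooth_on_partials _ sg) (UV Ux).
Qed.

Lemma is_derive_pull_op L g i x : smooth_coefs L -> smooth_on V g -> U x ->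
  is_derive x (delta_mx 0 i) (pull_op L g) (pull_op (pull_step L i) g x).
Proof.
move=> + sg Ux; elim: L => [|p L IH] sL.
  rewrite [pull_op (pull_step _ _) _ _]big_nil (_ : pull_op _ _ = cst 0).
    exact: is_derive_cst.
  by apply/funext => y; rewrite /pull_op big_nil.
rewrite (_ : pull_op (_ :: _) _ =
    (fun y => (p.2 y : R^o) * partials p.1 g (phi y)) + pull_op L g); last first.
  by apply/funext => y; rewrite /pull_op big_cons.
have -> : pull_op (pull_step (p :: L) i) g x =
    (p.2 x * (\sum_j partial i (fun v => phi v 0 j) x
        * partial j (partials p.1 g) (phi x)))
    + partials p.1 g (phi x) * partial i p.2 x + pull_op (pull_step L i) g x.
  rewrite /pull_op /pull_step /= big_cons big_cat /= addrA; congr (_ + _).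
  rewrite addrC big_map [RHS]/GRing.add /= -/(GRing.add _ _); congr (_ + _); last exact: mulrC.
  rewrite mulr_sumr big_enum /=; apply: eq_bigr => j _.
  by rewrite partials_rcons mulrA.
apply: is_deriveD; last by apply: IH => q qL; apply: sL; right.
apply: (@is_deriveM R 'rV[R]_m).
  by apply: smooth_on_is_derive Ux; apply: sL; left.
apply: is_derive_comp.
  exact: smooth_on_differentiable (smooth_on_partials _ sg) (UV Ux).
by move=> j; have [] := smooth_on_is_derive i (sphi j) Ux.
Qed.

(** The list of coefficients depends on a, phi and s but not on g. This
    uniformity is what makes pullbacks continuous for topologies defined by
    derivatives. *)
Lemma weighted_pullback a g : smooth_on U a -> smooth_on V g ->
  smooth_on U (fun x => a x * g (phi x) : R^o) /\
  forall s x, U x ->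
    partials s (fun x => a x * g (phi x) : R^o) x = pull_op (pull_list a s) g x.
Proof.
move=> sa sg; apply: smooth_on_open_ext => //.
- by move=> x _; rewrite /pull_op big_seq1.
- by move=> s x; apply: continuous_pull_op => //; exact: pull_list_smooth.
- move=> s i x Ux; rewrite /pull_list foldl_rcons.
  by apply: is_derive_pull_op => //; exact: pull_list_smooth.
Qed.

Lemma smooth_on_comp g : smooth_on V g -> smooth_on U (fun x => g (phi x)).
Proof.
move=> sg; have [H _] := weighted_pullback (@smooth_on_cst R m U 1) sg.
by apply: smooth_on_ext oU _ H => x _; rewrite mul1r.
Qed.

End WeightedPullback.

Section Leibniz.
Variables (R : realType) (n : nat) (U : set 'rV[R]_n).
Hypothesis oU : open U.
Implicit Types (f g : 'rV[R]_n -> R^o).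

Definition leibniz_step (L : seq (seq 'I_n * seq 'I_n)) (i : 'I_n) :=
  flatten [seq [:: (rcons p.1 i, p.2); (p.1, rcons p.2 i)] | p <- L].

(** The pairs of multi-indices that occur in the Leibniz formula for the s-th
    derivative, repeated as often as the formula requires instead of carrying
    binomial coefficients. *)
Definition leibniz_list (s : seq 'I_n) := foldl leibniz_step [:: ([::], [::])] s.

Lemma partialsM f g s x : smooth_on U f -> smooth_on U g -> U x ->
  partials s (fun y => f y * g y : R^o) x
  = \sum_(p <- leibniz_list s) partials p.1 f x * partials p.2 g x.
Proof.
move=> sf sg; pose G s y : R^o :=
  \sum_(p <- leibniz_list s) (partials p.1 f y : R) * partials p.2 g y.
apply: (proj2 (@smooth_on_open_ext R n U _ G oU _ _ _)).
- by move=> y _; rewrite /G big_seq1.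
- move=> t y Uy; apply: continuous_big_sum => p.
  by apply: (@continuousM R); apply: smooth_on_continuous Uy; exact: smooth_on_partials.
- move=> t i y Uy; rewrite {2}/G /leibniz_list foldl_rcons -/(leibniz_list t).
  have -> : \sum_(p <- leibniz_step (leibniz_list t) i)
        (partials p.1 f y : R) * partials p.2 g y
      = \sum_(p <- leibniz_list t)
         ((partials p.1 f y : R) * partial i (partials p.2 g) y
          + partials p.2 g y * partial i (partials p.1 f) y).
    elim: (leibniz_list t) => [|p L IH]; first by rewrite !big_nil.
    rewrite /leibniz_step /= !big_cons /= -/(leibniz_step L i) IH !partials_rcons addrA.
    by rewrite [partial i _ y * _]mulrC [X in X + _ = _]addrC.
  apply: (@is_derive_big_sum R n _ _
    (fun p z => (partials p.1 f z : R) * partials p.2 g z)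
    (fun p z => (partials p.1 f z : R) * partial i (partials p.2 g) z
          + (partials p.2 g z : R) * partial i (partials p.1 f) z)) => p.
  apply: (@is_deriveM R 'rV[R]_n); apply: smooth_on_is_derive Uy; exact: smooth_on_partials.
Qed.

End Leibniz.

(** * Plateau functions *)

Section FlatFunction.
Variable R : realType.
Implicit Types (p : {poly R}) (t y : R).

(** The functions p(1/t) exp(-1/t), prolonged by 0, are stable under
    differentiation. The usual flat function is the case p = 1, and its
    iterated derivatives are all of this form. *)
Definition flat p t : R := if 0 < t then p.[t^-1] * expR (- t^-1) else 0.

(** For t > 0 the derivative of p(1/t) exp(-1/t) is (1/t)^2 (p - p')(1/t)
    exp(-1/t). *)
Definition flat_deriv p : {poly R} := 'X^2 * (p - p^`()).

Lemma expR_ge_pow y k : 0 <= y -> y ^+ k <= k`!%:R * expR y.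
Proof.
case: k => [|k] y0; first by rewrite expr0 mul1r -[X in X <= _]expR0 ler_expR.
have := expR_ge1Dxn k y0; rewrite -ler_pdivrMl ?ltr0n ?fact_gt0 // mulrC.
by apply: le_trans; rewrite lerDr.
Qed.

Lemma poly_le_expR p : exists C, forall y, 0 <= y -> `|p.[y]| <= C * expR y.
Proof.
exists (\sum_(i < size p) `|p`_i| * i`!%:R) => y y0.
rewrite horner_coef mulr_suml; apply: le_trans (ler_norm_sum _ _ _) _.
apply: ler_sum => i _; rewrite normrM -mulrA ler_wpM2l //.
by rewrite ger0_norm ?exprn_ge0 // expR_ge_pow.
Qed.

(** With y = 1/t the claim is that y^2 p(y) is dominated by exp y. A quadratic
    bound forces the derivative at 0 to vanish. *)
Lemma flat_le_sqr p : exists2 C, 0 <= C & forall t, `|flat p t| <= C * t ^+ 2.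
Proof.
have [C CP] := poly_le_expR ('X^2 * p).
have C0 : 0 <= C by have := CP 0 (lexx 0); rewrite expR0 mulr1; exact: le_trans.
exists C => // t; rewrite /flat; case: ifP => t0; last by rewrite normr0 mulr_ge0 ?sqr_ge0.
have := CP t^-1; rewrite invr_ge0 ltW // => /(_ isT).
rewrite hornerM hornerXn normrM expRN exprVn normfV.
rewrite [`|t ^+ 2|]ger0_norm ?sqr_ge0 // ler_pdivrMl ?exprn_gt0 // => H.
rewrite normrM [X in _ * X]ger0_norm ?invr_ge0 ?expR_ge0 // ler_pdivrMr ?expR_gt0 //.
by rewrite [C * _]mulrC -mulrA.
Qed.

Lemma is_derive_flat0 p : is_derive (0 : R) 1 (flat p : R -> R^o) 0.
Proof.
have [C C0 CP] := flat_le_sqr p.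
have f0 : flat p 0 = 0 by rewrite /flat ltxx.
have cvg0 : (h^-1 *: ((flat p : R -> R^o) (h *: 1 + 0) - flat p 0)) @[h --> (0:R)^'] --> (0 : R^o).
  apply/cvgr0Pnorm_lt => e e0; near=> h.
  have h0 : h != 0 by near: h; exact: nbhs_dnbhs_neq.
  rewrite f0 subr0 addr0 [h *: 1]mulr1 normrM normfV ltr_pdivrMl ?normr_gt0 //.
  apply: le_lt_trans (CP h) _; rewrite -[h ^+ 2]ger0_norm ?sqr_ge0 // normrX expr2.
  rewrite mulrCA ltr_pM2l ?normr_gt0 //.
  have : `|h| < e / (C + 1) by near: h; apply: dnbhs0_lt; rewrite divr_gt0 // ltr_wpDl.
  rewrite ltr_pdivlMr ?ltr_wpDl // => H; apply: le_lt_trans H.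
  by rewrite mulrC ler_wpM2l // lerDl.
by apply: DeriveDef; [apply/cvg_ex; exists 0|exact: cvg_lim cvg0].
Unshelve. all: by end_near. Qed.

Lemma is_derive_flat p t :
  is_derive t 1 (flat p : R -> R^o) (flat (flat_deriv p) t).
Proof.
have [t0|t0|->] := ltgtP t 0; last first.
- by rewrite {2}/flat ltxx; exact: is_derive_flat0.
- have tn0 : t != 0 by rewrite gt_eqF.
  have nt : nbhs t [set y | 0 < y].
    by apply: open_nbhs_nbhs; split=> //; exact: open_gt.
  have dV : is_derive t 1 (fun x : R => x^-1) (- t ^- 2).
    by have := @is_deriveV R id t 1 1 tn0 _; rewrite /= [_ *: 1]mulr1; apply.
  have dN : is_derive t 1 (fun x : R => - x^-1) (t ^- 2).
    by have := is_deriveN dV; rewrite opprK.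
  apply: (@near_eq_is_derive _ _ _ ((fun x => horner p x^-1 * expR (- x^-1)) : R -> R^o)).
    by near=> x; rewrite /flat ifT //; near: x; exact: nt.
  rewrite /flat t0.
  have d1 := @is_derive1_comp _ (horner p) _ t _ _ (is_derive_poly p t^-1) dV.
  have d2 := @is_derive1_comp _ expR _ t _ _ (is_derive_expR (- t^-1)) dN.
  apply: is_derive_eq (is_deriveM d1 d2) _.
  rewrite /= /flat_deriv !(hornerM, hornerD, hornerN, hornerX, hornerXn).
  by rewrite -![_ *: _]/(_ * _); field.
- rewrite {2}/flat ltNge ltW //=.
  apply: (@near_eq_is_derive _ _ _ (cst 0 : R -> R^o)).
  by near=> x; rewrite /flat ltNge ltW //=; near: x; exact: lt_nbhsl.
Unshelve. all: by end_near. Qed.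

Definition exp_flat t : R := flat 1 t.

Lemma exp_flat_eq0 t : (exp_flat t == 0) = (t <= 0).
Proof.
rewrite /exp_flat /flat; case: ltP => t0; rewrite ?eqxx //.
by rewrite hornerE mul1r expR_eq0.
Qed.

Lemma exp_flat_ge0 t : 0 <= exp_flat t.
Proof. by rewrite /exp_flat /flat hornerE mul1r; case: ifP; rewrite ?expR_ge0. Qed.

Lemma exp_flat_homo : {homo exp_flat : s t / s <= t}.
Proof.
move=> s t st; rewrite {1}/exp_flat /flat; case: ifP => s0; last exact: exp_flat_ge0.
have t0 := lt_le_trans s0 st.
by rewrite /exp_flat /flat t0 !(hornerE, mul1r) ler_expR lerN2 lef_pV2 ?posrE.
Qed.

End FlatFunction.

Section Plateau.
Variables (R : realType) (n : nat).

Lemma smooth_exp_flat :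
  smooth_on setT (fun v : 'rV[R]_1 => exp_flat (v 0 0) : R^o).
Proof.
pose G (s : seq 'I_1) (v : 'rV[R]_1) : R^o :=
  flat (iter (size s) (@flat_deriv R) 1) (v 0 0).
apply: (proj1 (@smooth_on_open_ext R 1 setT _ G openT _ _ _)) => //.
- move=> s x _; apply: (@continuous_comp _ _ _ (fun v : 'rV[R]_1 => v 0 0)).
    exact: coord_continuous.
  apply/differentiable_continuous/derivable1_diffP.
  exact: (@ex_derive _ _ _ _ _ _ _ (is_derive_flat _ _)).
- move=> s i x _; rewrite {2}/G size_rcons iterS.
  rewrite -[X in is_derive X](add0r x) -(scale0r (delta_mx 0 i)); apply/is_derive_line.
  rewrite /G (ord1 i).
  set q := iter _ _ _.
  have -> : (fun h : R => flat q ((h *: delta_mx 0 0 + x) 0 0) : R^o)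
      = (flat q : R -> R^o) \o (fun h => h + x 0 0).
    by apply/funext => h /=; rewrite !mxE mulr1.
  rewrite -[flat _ _]mulr1; apply: is_derive1_comp.
    by rewrite add0r; exact: is_derive_flat.
  by apply: is_derive_eq (is_deriveD _ _) _; rewrite ?addr0.
Qed.

Lemma smooth_coord j : smooth_on setT (fun v : 'rV[R]_n => v 0 j : R^o).
Proof.
have dc x i : is_derive x (delta_mx 0 i) (fun v : 'rV[R]_n => v 0 j : R^o) (i == j)%:R.
  rewrite -[X in is_derive X](add0r x) -(scale0r (delta_mx 0 i)); apply/is_derive_line.
  have -> : (fun h : R => (h *: delta_mx 0 i + x) 0 j : R^o)
      = ((i == j)%:R \*: (id : R -> R^o)) + cst (x 0 j).
    by apply/funext => h /=; rewrite !mxE eq_sym mulrC.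
  by apply: is_derive_eq (is_deriveD _ _) _; rewrite addr0 [_ *: _]mulr1.
apply/smooth_onP => -[|k]; first by split=> // x _; exact: coord_continuous.
split; first by move=> x _; exact: coord_continuous.
split=> [x _ i|i]; first by have [] := dc x i.
rewrite (_ : partial i _ = fun=> (i == j)%:R).
  exact: ((smooth_onP _ _).1 (smooth_on_cst _)).
by apply/funext => x; rewrite /partial; have [_ ->] := dc x i.
Qed.

Lemma smooth_on_sum (I : Type) (s : seq I) U (F : I -> 'rV[R]_n -> R^o) :
  open U -> (forall i, smooth_on U (F i)) ->
  smooth_on U (fun v => \sum_(i <- s) F i v : R^o).
Proof.
move=> oU sF; elim: s => [|i s IH].
  by apply: smooth_on_ext oU _ (smooth_on_cst (0 : R)) => v _; rewrite big_nil.
by apply: smooth_on_ext oU _ (smooth_onD oU (sF i) IH) => v _; rewrite big_cons.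
Qed.

(** Write e for exp_flat. The function e (e 3 - \sum_j e ((v_j - a_j)^2 / r^2 -
    1)) is constant where all coordinates of v - a have absolute value at most
    r, since every inner term vanishes there. It is zero as soon as one of
    these absolute values is at least 2 r, since one inner term is then at
    least e (4 - 1). Composition and sums suffice, so that no quotient of
    functions has to be differentiated. *)
Lemma plateau (a : 'rV[R]_n) (r : R) : 0 < r ->
  exists b : 'rV[R]_n -> R^o, [/\ smooth_on setT b,
    forall v, `|v - a| <= r -> b v = 1 & forall v, 2 * r <= `|v - a| -> b v = 0].
Proof.
move=> r0; pose w j (v : 'rV[R]_n) : R^o := (r^-1 * (v 0 j - a 0 j)) ^+ 2 - 1.
pose phi (v : 'rV[R]_n) : 'rV[R]_1 :=
  \row__ (exp_flat 3 - \sum_(j <- enum 'I_n) exp_flat (w j v)).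
have sw j : smooth_on setT (w j).
  have s1 := smooth_onM openT (@smooth_on_cst R n setT r^-1)
    (smooth_onD openT (smooth_coord j) (@smooth_on_cst R n setT (- a 0 j))).
  apply: smooth_on_ext openT _ (smooth_onD openT (smooth_onM openT s1 s1)
    (@smooth_on_cst R n setT (-1))) => v _.
  by rewrite /w expr2.
have sew j : smooth_on setT (fun v => exp_flat (w j v) : R^o).
  have H := @smooth_on_comp R n 1 (fun v => \row__ w j v) setT setT openT openT
    (fun _ _ => I) _ _ smooth_exp_flat.
  have {}H := H (fun i => smooth_on_ext openT (fun v _ => esym (mxE _ _ _ _)) (sw j)).
  by apply: smooth_on_ext openT _ H => v _; rewrite mxE.
have sphi j : smooth_on setT (fun v => phi v 0 j : R^o).
  have H := smooth_onD openT (@smooth_on_cst R n setT (exp_flat 3))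
    (smooth_onM openT (@smooth_on_cst R n setT (-1))
       (smooth_on_sum (enum 'I_n) openT sew)).
  by apply: smooth_on_ext openT _ H => v _; rewrite mxE mulN1r.
have e3 : exp_flat 3 != 0 :> R by rewrite exp_flat_eq0 -ltNge.
exists (fun v => (exp_flat (exp_flat (3 : R)))^-1 * exp_flat (phi v 0 0)); split.
- have H := @smooth_on_comp R n 1 phi setT setT openT openT (fun _ _ => I) sphi _ smooth_exp_flat.
  exact: smooth_onM openT (@smooth_on_cst R n setT _) H.
- move=> v vr; rewrite mxE big1 ?subr0 => [|j _].
    by rewrite mulVf // exp_flat_eq0 -ltNge lt_def e3 exp_flat_ge0.
  apply/eqP; rewrite exp_flat_eq0 /w subr_le0 -real_normK ?num_real //.
  rewrite expr_le1 // normrM normfV (gtr0_norm r0) ler_pdivrMl // mulr1.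
  by apply: le_trans vr; have := coord_norm (v - a) j; rewrite !mxE.
- move=> v vr; have [j jr] : exists j, 2 * r <= `|v 0 j - a 0 j|.
    apply: contrapT => /forallNP nj; suff : `|v - a| < 2 * r by rewrite ltNge vr.
    rewrite [ltLHS]/Num.Def.normr/= mx_normrE; apply: bigmax_lt => [|[i j] _] /=.
      by rewrite mulr_gt0.
    by rewrite !mxE ord1 ltNge; apply/negP/nj.
  have -> : exp_flat (phi v 0 0) = 0; last by rewrite mulr0.
  apply/eqP; rewrite exp_flat_eq0 mxE subr_le0 big_enum (bigD1 j) //=.
  apply: le_trans (_ : exp_flat (w j v) <= _).
    apply: exp_flat_homo; rewrite /w lerBrDr -real_normK ?num_real //.
    rewrite (_ : 3 + 1 = 2 ^+ 2); last by ring.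
    rewrite lerXn2r ?nnegrE // normrM normfV (gtr0_norm r0) ler_pdivlMl //.
    by rewrite mulrC.
  by rewrite lerDl sumr_ge0 // => i _; exact: exp_flat_ge0.
Qed.

End Plateau.

(** * Charts and smooth maps *)

Section LocalSmoothness.
Variables (R : realType) (m : nat).

Lemma smooth_on_local U (f : 'rV[R]_m -> R^o) :
  (forall x, U x -> exists2 W, W x & smooth_on W f) -> smooth_on U f.
Proof. by move=> loc s x Ux; have [W Wx sf] := loc x Ux; exact: sf. Qed.

Variables (M : manifoldType R m).

Lemma chart_image_open (c : chart R m M) O : is_chart c -> open O ->
  open (c @` (chart_dom c `&` O)).
Proof.
move=> [oc oic cK cc cic] oO; rewrite openE => _ [x [cx Ox] <-].
have icx : (c @` chart_dom c) (c x) by exists x.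
have nO : nbhs (c x) (chart_inv c @^-1` O).
  by apply: cic icx _ _; rewrite cK //; exact: open_nbhs_nbhs.
have nI : nbhs (c x) (c @` chart_dom c) by exact: open_nbhs_nbhs.
apply: filterS (filterI nI nO) => _ [[y cy <-]] /=; rewrite cK // => Oy.
by exists y.
Qed.

Lemma box_compact (a : 'rV[R]_m) (r : R) : compact [set v : 'rV[R]_m | `|v - a| <= r].
Proof.
have [r0|r0] := ltP r 0.
  rewrite (_ : [set _ | _] = set0); first exact: compact0.
  by apply/seteqP; split=> // v /= vr; have := le_lt_trans vr r0; rewrite normr_lt0.
rewrite [X in compact X](_ : _ = [set v : 'rV[R]_m | forall i, `[a 0 i - r, a 0 i + r]%classic (v ord0 i)]).
  apply: (@rV_compact R m (fun i => `[a 0 i - r, a 0 i + r]%classic)) => i.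
  exact: segment_compact.
apply/seteqP; split=> v /= vr.
  move=> i; rewrite /= in_itv /=; have := le_trans (coord_norm _ i) vr.
  by rewrite !mxE ler_norml; move: (v 0 i) (a 0 i) => s t; lra.
rewrite [leLHS]/Num.Def.normr/= mx_normrE; apply: bigmax_le => //= -[i j] _.
rewrite !mxE ord1 /=; have := vr j; rewrite /= in_itv /= ler_norml.
by move: (v 0 j) (a 0 j) => s t; lra.
Qed.

(** The factor 2 leaves room for a plateau function that is 1 on the box of
    radius r. *)
Lemma chart_box (O : set M) x : open O -> O x ->
  exists (c : chart R m M) (r : R), [/\ atlas M c, chart_dom c x, 0 < r &
    forall v, `|v - c x| <= 2 * r -> (c @` (chart_dom c `&` O)) v].
Proof.
move=> oO Ox; have [c ac cx] := atlas_cover x.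
have oI := chart_image_open (atlas_chart _ ac) oO.
have : nbhs (c x) (c @` (chart_dom c `&` O)).
  by apply: open_nbhs_nbhs; split=> //; exists x.
move=> /nbhs_ballP[e /= e0 eI]; exists c, (e / 3); split=> //; first by rewrite divr_gt0.
move=> v vx; apply: eI; rewrite -ball_normE /= distrC; apply: le_lt_trans vx _.
by lra.
Qed.

Lemma box_preimage (c : chart R m M) x (r : R) : is_chart c -> chart_dom c x ->
  0 < r ->
  (forall v, `|v - c x| <= r -> (c @` chart_dom c) v) ->
  let K := chart_dom c `&` [set y | `|c y - c x| <= r] in
  compact K /\ nbhs x K.
Proof.
move=> [oc oic cK cc cic] cx r0 rI K; split.
  rewrite (_ : K = chart_inv c @` [set v | `|v - c x| <= r]).
    apply: continuous_compact; last exact: box_compact.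
    by apply/continuous_in_subspaceT => v /[!inE] /= /rI; exact: cic.
  apply/seteqP; split=> [y [cy yr]|_ [v vr <-]].
    by exists (c y) => //; exact: cK.
  by have [y cy vE] := rI v vr; rewrite -vE cK //; split=> //=; rewrite vE.
apply: filterI; first exact: open_nbhs_nbhs.
have := cc x cx; move/cvgrPdist_le => /(_ r r0); apply: filterS => y.
by rewrite distrC.
Qed.

(** Local compactness: closed boxes are compact in the chart, and so are their
    images under the inverse chart. *)
Lemma compact_nbhs (O : set M) x : open O -> O x ->
  exists2 K, compact K /\ nbhs x K & K `<=` O.
Proof.
move=> oO Ox; have [c [r [ac cx r0 rI]]] := chart_box oO Ox.
have r20 : 0 < 2 * r by rewrite mulr_gt0.
have rI' v : `|v - c x| <= 2 * r -> (c @` chart_dom c) v.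
  by move=> /rI[y [cy _] <-]; exists y.
eexists; first exact: box_preimage (atlas_chart _ ac) cx r20 rI'.
move=> y [cy] /= /rI[z [cz Oz] zy].
have [_ _ cK _ _] := atlas_chart _ ac.
by rewrite -(cK y cy) -zy cK.
Qed.

End LocalSmoothness.

Section SmoothMapCalculus.
Variable R : realType.

Definition smooth_on_charts m (M : manifoldType R m) (Q : set M) (h : M -> R^o) :=
  forall c, atlas M c ->
    smooth_on (c @` (chart_dom c `&` Q)) (fun v => h (chart_inv c v)).

Lemma smooth_fun_charts m (M : manifoldType R m) (F : M -> R[i]) :
  smooth_fun F <->
  smooth_on_charts setT (fun x => complex.Re (F x)) /\
  smooth_on_charts setT (fun x => complex.Im (F x)).
Proof.
rewrite /smooth_on_charts; split=> [sF|[sR sI] c ac].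
  by split=> c ac; rewrite setIT; have [] := sF c ac.
by have := sR c ac; have := sI c ac; rewrite !setIT.
Qed.

(** Around a point the composite is h read in a chart at the image point,
    composed with f read in two charts. *)
Lemma smooth_on_charts_comp m n (M : manifoldType R m) (N : manifoldType R n)
    (f : M -> N) (Q : set N) (h : N -> R^o) :
  smooth_map f -> open Q -> smooth_on_charts Q h ->
  smooth_on_charts (f @^-1` Q) (fun x => h (f x)).
Proof.
move=> [cf sf] oQ sh c ac; apply: smooth_on_local => _ [x [cx Qfx] <-].
have [e ae ex] := atlas_cover (f x).
have [oe _ eK _ _] := atlas_chart _ ae; have [_ _ cK _ _] := atlas_chart _ ac.
have oO : open (f @^-1` (chart_dom e `&` Q)).
  by apply: open_comp => [y _|]; [exact: cf|exact: openI].
exists (c @` (chart_dom c `&` f @^-1` (chart_dom e `&` Q))); first by exists x.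
have oW := chart_image_open (atlas_chart _ ac) oO.
have H := @smooth_on_comp R m n (fun v => e (f (chart_inv c v))) _ _ oW
  (chart_image_open (atlas_chart _ ae) oQ) _ _ _ (sh e ae).
apply: smooth_on_ext oW _ (H _ _).
- by move=> _ [y [cy [ey Qy]] <-]; rewrite cK // eK.
- by move=> _ [y [cy [ey Qy]] <-]; rewrite cK //; exists (f y).
- move=> j; apply: smooth_on_sub (sf c e ac ae j).
  by move=> _ [y [cy [ey Qy]] <-]; exists y.
Qed.

Lemma smooth_fun_comp m n (M : manifoldType R m) (N : manifoldType R n)
    (f : M -> N) (F : N -> R[i]) :
  smooth_map f -> smooth_fun F -> smooth_fun (fun x => F (f x)).
Proof.
move=> sf /smooth_fun_charts[sR sI]; apply/smooth_fun_charts; split.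
  exact: (smooth_on_charts_comp sf openT sR).
exact: (smooth_on_charts_comp sf openT sI).
Qed.

Lemma smooth_map_comp m n p (M : manifoldType R m) (N : manifoldType R n)
    (P : manifoldType R p) (f : M -> N) (g : N -> P) :
  smooth_map f -> smooth_map g -> smooth_map (fun x => g (f x)).
Proof.
move=> sf [cg sg]; have [cf _] := sf; split.
  by move=> x; apply: continuous_comp; [exact: cf|exact: cg].
move=> c d ac ad j; have [od _ _ _ _] := atlas_chart _ ad.
have oQ : open (g @^-1` chart_dom d) by apply: open_comp => // y _; exact: cg.
apply: (smooth_on_charts_comp (h := fun y => d (g y) 0 j) sf oQ) => // e ae.
exact: sg.
Qed.

Lemma smooth_map_id m (M : manifoldType R m) : smooth_map (fun x : M => x).
Proof.
split; first by move=> x; exact: cvg_id.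
by move=> c d ac ad j; exact: atlas_compatible.
Qed.

Lemma smooth_map_cst m n (M : manifoldType R m) (N : manifoldType R n) (y : N) :
  smooth_map (fun _ : M => y).
Proof.
split; first exact: cst_continuous.
by move=> c d ac ad j; exact: smooth_on_cst.
Qed.

Lemma smooth_map_pair m n p (M : manifoldType R m) (N : manifoldType R n)
    (P : manifoldType R p) (f : M -> N) (g : M -> P) :
  smooth_map f -> smooth_map g -> smooth_map (fun x => (f x, g x) : (N * P)%type).
Proof.
move=> [cf sf] [cg sg]; split.
  by move=> x; apply: continuous_pair; [exact: cf|exact: cg].
move=> c _ ac [d [e [ad ae ->]]] j; case: (split_ordP j) => i ->.
  have H := sf c d ac ad i.
  rewrite (_ : (fun v => _) = (fun v => d (f (chart_inv c v)) 0 i : R^o)).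
    by apply: smooth_on_sub H => _ [y [cy [dy ey]] <-]; exists y.
  by apply/funext => v /=; rewrite row_mxEl.
have H := sg c e ac ae i.
rewrite (_ : (fun v => _) = (fun v => e (g (chart_inv c v)) 0 i : R^o)).
  by apply: smooth_on_sub H => _ [y [cy [dy ey]] <-]; exists y.
by apply/funext => v /=; rewrite row_mxEr.
Qed.

Lemma smooth_map_fst m n (M : manifoldType R m) (N : manifoldType R n) :
  smooth_map (fun p : (M * N)%type => p.1).
Proof.
split; first by move=> p; exact: cvg_fst.
move=> _ c' [c [d [ac ad ->]]] ac' j.
apply: smooth_on_sub (smooth_on_lsubmx (atlas_compatible c c' ac ac' j)).
by move=> _ [[x y] [[/= cx dy] c'x] <-] /=; rewrite row_mxKl; exists x.
Qed.

Lemma smooth_map_snd m n (M : manifoldType R m) (N : manifoldType R n) :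
  smooth_map (fun p : (M * N)%type => p.2).
Proof.
split; first by move=> p; exact: cvg_snd.
move=> _ d' [c [d [ac ad ->]]] ad' j.
apply: smooth_on_sub (smooth_on_rsubmx (atlas_compatible d d' ad ad' j)).
by move=> _ [[x y] [[/= cx dy] d'y] <-] /=; rewrite row_mxKr; exists y.
Qed.

End SmoothMapCalculus.

(** * Bump functions and local units on a manifold *)

(** Extraction of finite subcovers, in the form of an induction on compact
    sets. The filter used is generated by the families of all sets that contain
    a given A with P A. *)
Lemma compact_ind (T : topologicalType) (P : set T -> Prop) (K : set T) :
  P set0 -> (forall A B, A `<=` B -> P B -> P A) ->
  (forall A B, P A -> P B -> P (A `|` B)) ->
  (forall x, K x -> exists2 A, nbhs x A & P A) ->
  compact K -> P K.
Proof.
move=> P0 Pmono PU loc /compact_near_coveringP cK.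
pose F : set_system (set T) :=
  [set D | exists2 A, P A & forall B, A `<=` B -> D B].
have FF : Filter F.
  split; first by exists set0.
    move=> D E [A PA AD] [B PB BE]; exists (A `|` B); first exact: PU.
    move=> C; rewrite subUset => -[AC BC]; split; [exact: AD|exact: BE].
  by move=> D E DE [A PA AD]; exists A => // B /AD /DE.
have [|A PA /(_ A) KA] := cK _ F (fun B x => B x) FF.
  move=> x Kx; have [A nA PA] := loc x Kx.
  exists (A, [set B | A `<=` B]); first by split=> //; exists A.
  by move=> [y B] [/= Ay]; exact.
by apply: Pmono PA; exact: KA.
Qed.

Section Bumps.
Variables (R : realType) (m : nat) (M : manifoldType R m).

Lemma csupportP (f : M -> R[i]) x : f x != 0 -> csupport f x.
Proof. by move=> fx; exact: subset_closure. Qed.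

Lemma Cc_eqP (f g : Cc M) : (forall x, f x = g x) -> f = g.
Proof. by move=> fg; apply: val_inj; apply/funext. Qed.

Lemma Cinf_eqP (f g : Cinf M) : (forall x, f x = g x) -> f = g.
Proof. by move=> fg; apply: val_inj; apply/funext. Qed.

(** A plateau function read in a chart, prolonged by 0. The prolongation is
    smooth because it vanishes outside a compact box, and compact sets are
    closed in a Hausdorff space. *)
Lemma Cc_bump (O : set M) x : open O -> O x ->
  exists b : Cc M, (\forall y \near x, b y = 1) /\ forall y, ~ O y -> b y = 0.
Proof.
move=> oO Ox; have [c [r [ac cx r0 rI]]] := chart_box oO Ox.
have [oc _ cK cc _] := atlas_chart _ ac.
have [b0 [sb b1 b00]] := plateau (c x) r0.
have r20 : 0 < 2 * r by rewrite mulr_gt0.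
have rI' v : `|v - c x| <= 2 * r -> (c @` chart_dom c) v.
  by move=> /rI[y [cy _] <-]; exists y.
have [cptK _] := box_preimage (atlas_chart _ ac) cx r20 rI'.
set K := chart_dom c `&` _ in cptK.
have clK : closed K by apply: compact_closed cptK; exact: manifold_hausdorff.
pose h y : R^o := if `[< chart_dom c y >] then b0 (c y) else 0.
have hK y : ~ K y -> h y = 0.
  move=> nKy; rewrite /h; case: asboolP => // cy; apply: b00.
  by rewrite leNgt; apply/negP => /ltW yr; apply: nKy.
have sh : smooth_on_charts setT h.
  move=> d ad; have [_ _ dK _ _] := atlas_chart _ ad.
  apply: smooth_on_local => _ [y [dy _] <-].
  have [cy|ncy] := pselect (chart_dom c y).
    exists (d @` (chart_dom d `&` chart_dom c)); first by exists y.
    have oW := chart_image_open (atlas_chart _ ad) oc.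
    apply: smooth_on_ext oW _ (@smooth_on_comp R m m (fun v => c (chart_inv d v)) _ setT oW openT _ _ _ sb) => //.
      by move=> _ [z [dz cz] <-]; rewrite dK // /h; case: asboolP.
    exact: atlas_compatible.
  have oW := chart_image_open (atlas_chart _ ad) (closed_openC clK).
  exists (d @` (chart_dom d `&` ~` K)); first by exists y => //; split=> // -[].
  apply: smooth_on_ext oW _ (@smooth_on_cst R m _ 0) => _ [z [dz nz] <-].
  by rewrite dK // hK.
have hP : (fun y => (h y)%:C%C) \in @Cc_pred R m M.
  apply/asboolP; split.
    by apply/smooth_fun_charts; split=> // d ad; exact: smooth_on_cst.
  apply: subclosed_compact cptK _; first exact: closed_closure.
  apply: (subset_trans (B := closure K)); last by move: clK => /closure_id <-.
  by apply: closureS => y /= hy; apply: contrapT => /hK hy0; rewrite hy0 eqxx in hy.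
exists (MkCc hP); split=> [|y nOy] /=.
  have rI1 v : `|v - c x| <= r -> (c @` chart_dom c) v.
    by move=> vr; apply: rI'; apply: le_trans vr _; rewrite ler_peMl ?(ltW r0) // ler1n.
  have [_] := box_preimage (atlas_chart _ ac) cx r0 rI1.
  by apply: filterS => y [cy yr]; rewrite /h; case: asboolP => // _; rewrite b1.
rewrite /h; case: asboolP => // cy; rewrite b00 // leNgt; apply/negP => /ltW /rI[z [cz Oz] zy].
by apply: nOy; rewrite -(cK y cy) -zy cK.
Qed.

Lemma Cc_unit_compact (L : set M) : compact L ->
  exists g : Cc M, forall x, L x -> g x = 1.
Proof.
apply: (@compact_ind _ (fun A => exists g : Cc M, forall x, A x -> g x = 1)).
- by exists 0.
- by move=> A B AB [g gB]; exists g => x /AB /gB.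
(* 1 - (1 - f) (1 - g) is 1 wherever f or g is. *)
- move=> A B [f fA] [g gB]; exists (f + g - Cc_mul f g) => x ABx.
  rewrite -[LHS]/(f x + g x - f x * g x).
  by case: ABx => [/fA|/gB] ->; rewrite ?mul1r ?mulr1 ?addrK // addrAC subrr add0r.
- move=> x _; have [b [b1 _]] := Cc_bump openT (I : setT x).
  by exists [set y | b y = 1] => //; exists b.
Qed.

Lemma compact_supports (s : seq (Cc M)) :
  exists2 L : set M, compact L & forall f, f \in s -> csupport f `<=` L.
Proof.
elim: s => [|g s [L cL sL]]; first by exists set0 => //; exact: compact0.
exists (csupport g `|` L); first by apply: compactU => //; exact: Cc_compact.
by move=> f; rewrite inE => /predU1P[->|/sL fL] x fx; [left|right; exact: fL].
Qed.

Lemma Cc_mulC : commutative (@Cc_mul R m M).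
Proof. by move=> f g; apply: Cc_eqP => x /=; exact: mulrC. Qed.

Lemma Cc_mulA : associative (@Cc_mul R m M).
Proof. by move=> f g h; apply: Cc_eqP => x /=; exact: mulrA. Qed.

Lemma Cc_mul_bilinear : is_bilinear (@Cc_mul R m M).
Proof.
split=> g c f h; apply: Cc_eqP => x /=.
  by rewrite -[LHS]/((c * f x + h x) * g x) -[RHS]/(c * (f x * g x) + h x * g x) mulrDl mulrA.
by rewrite -[LHS]/(g x * (c * f x + h x)) -[RHS]/(c * (g x * f x) + g x * h x) mulrDr mulrCA.
Qed.

Lemma Cc_mul_unitE (g f : Cc M) :
  (forall x, csupport f x -> g x = 1) -> Cc_mul g f = f.
Proof.
move=> g1; apply: Cc_eqP => x /=; have [->|fx] := eqVneq (f x) 0; first by rewrite mulr0.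
by rewrite g1 ?mul1r //; exact: csupportP.
Qed.

Lemma Cc_local_unit (s : seq (Cc M)) :
  exists g, forall f, f \in s -> Cc_mul g f = f.
Proof.
have [L cL sL] := compact_supports s; have [g gL] := Cc_unit_compact cL.
by exists g => f /sL fL; apply: Cc_mul_unitE => x /fL /gL.
Qed.

End Bumps.

(** * Bounds for derivatives read in a chart *)

Section ComplexModulus.
Variable R : realType.
Implicit Types z w : R[i].

(** The norm of a complex number is itself a complex number; the estimates are
    made with the real number behind it. *)
Definition modulus z : R := complex.Re `|z|.

Lemma modulusE z : `|z| = (modulus z)%:C%C.
Proof. by rewrite /modulus normc_def. Qed.

Lemma modulus_ge0 z : 0 <= modulus z.
Proof. by rewrite -ler0c -modulusE. Qed.

Lemma modulusM z w : modulus (z * w) = modulus z * modulus w.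
Proof.
by apply: (@complexI R); rewrite rmorphM -!modulusE normrM.
Qed.

Lemma modulusD z w : modulus (z + w) <= modulus z + modulus w.
Proof. by rewrite -lecR rmorphD -!modulusE ler_normD. Qed.

Lemma modulusR (a : R) : modulus a%:C%C = `|a|.
Proof. by rewrite /modulus normc_def /= expr0n /= addr0 sqrtr_sqr. Qed.

Lemma modulus0 : modulus 0 = 0.
Proof. by rewrite modulusR normr0. Qed.

Lemma Re_le_modulus z : `|complex.Re z| <= modulus z.
Proof. by rewrite -lecR -modulusE normc_ge_Re. Qed.

Lemma modulus_i : modulus (0 +i* 1)%C = 1.
Proof. by rewrite /modulus normc_def /= expr0n expr1n /= add0r sqrtr1. Qed.

Lemma Im_le_modulus z : `|complex.Im z| <= modulus z.
Proof.
have := Re_le_modulus ((0 +i* 1)%C * z); rewrite modulusM modulus_i mul1r.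
by case: z => a b /=; rewrite mul0r mul1r sub0r normrN.
Qed.

Lemma modulus_le_ReIm z : modulus z <= `|complex.Re z| + `|complex.Im z|.
Proof.
rewrite [X in modulus X]complexE; apply: le_trans (modulusD _ _) _.
by rewrite modulusM !modulusR modulus_i mul1r.
Qed.

Lemma modulus_sum (I : Type) (s : seq I) (F : I -> R[i]) :
  modulus (\sum_(i <- s) F i) <= \sum_(i <- s) modulus (F i).
Proof.
elim: s => [|i s IH]; first by rewrite !big_nil modulus0.
by rewrite !big_cons; apply: le_trans (modulusD _ _) _; rewrite lerD2l.
Qed.

Lemma complex_eq (z w : R[i]) :
  complex.Re z = complex.Re w -> complex.Im z = complex.Im w -> z = w.
Proof. by case: z w => [a b] [a' b'] /= -> ->. Qed.

Lemma Re_sum (I : Type) (s : seq I) (f : I -> R[i]) :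
  complex.Re (\sum_(i <- s) f i) = \sum_(i <- s) complex.Re (f i).
Proof.
by elim: s => [|i s IH]; rewrite ?big_nil // !big_cons -IH; case: (f i) (\sum_(_ <- _) _) => [? ?] [].
Qed.

Lemma Im_sum (I : Type) (s : seq I) (f : I -> R[i]) :
  complex.Im (\sum_(i <- s) f i) = \sum_(i <- s) complex.Im (f i).
Proof.
by elim: s => [|i s IH]; rewrite ?big_nil // !big_cons -IH; case: (f i) (\sum_(_ <- _) _) => [? ?] [].
Qed.

Lemma ReM (z w : R[i]) :
  complex.Re (z * w) = complex.Re z * complex.Re w - complex.Im z * complex.Im w.
Proof. by case: z w => [a b] [a' b']. Qed.

Lemma ImM (z w : R[i]) :
  complex.Im (z * w) = complex.Re z * complex.Im w + complex.Im z * complex.Re w.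
Proof. by case: z w => [a b] [a' b']. Qed.

Lemma complex_gt0 z : 0 < z -> z = (complex.Re z)%:C%C /\ 0 < complex.Re z.
Proof. by case: z => a b; rewrite ltcE /= => /andP[/eqP -> a0]. Qed.

End ComplexModulus.

Section PartialDerivatives.
Variables (R : realType) (n : nat) (U : set 'rV[R]_n).
Hypothesis oU : open U.
Implicit Types (f g : 'rV[R]_n -> R^o).

Lemma partials_ext f g s x : (forall y, U y -> f y = g y) -> U x ->
  partials s f x = partials s g x.
Proof.
move=> fg; elim/last_ind: s x => [|s i IH] x Ux; first exact: fg.
rewrite !partials_rcons; apply: near_eq_derive; exact: open_near_eq oU IH Ux.
Qed.

Lemma partials_linear f g (a b : R) s x : smooth_on U f -> smooth_on U g -> U x ->
  partials s (fun y => a * f y + b * g y : R^o) x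
  = a * partials s f x + b * partials s g x.
Proof.
move=> sf sg; pose G s y : R^o := a * (partials s f y : R) + b * partials s g y.
apply: (proj2 (@smooth_on_open_ext R n U _ G oU _ _ _)) => //.
  move=> t y Uy; apply: (@continuousD R R^o).
    apply: (@continuousM R); first exact: cst_continuous.
    exact: smooth_on_continuous (smooth_on_partials _ sf) Uy.
  apply: (@continuousM R); first exact: cst_continuous.
  exact: smooth_on_continuous (smooth_on_partials _ sg) Uy.
move=> t i y Uy; rewrite {2}/G !partials_rcons.
have df := smooth_on_is_derive i (smooth_on_partials t sf) Uy.
have dg := smooth_on_is_derive i (smooth_on_partials t sg) Uy.
exact: (is_deriveD (is_deriveZ a df) (is_deriveZ b dg)).
Qed.

End PartialDerivatives.

Section ChartPartials.
Variables (R : realType) (m : nat) (M : manifoldType R m).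
Implicit Types F G : M -> R[i].

Variable c : chart R m M.
Hypothesis ac : atlas M c.

Let oc : open (c @` chart_dom c).
Proof. by have [_ ? _ _ _] := atlas_chart _ ac. Qed.

Let chart_image x : chart_dom c x -> (c @` chart_dom c) (c x).
Proof. by exists x. Qed.

Lemma cpartialsZ F a s x : smooth_fun F -> chart_dom c x ->
  cpartials c s (fun y => a * F y) x = a * cpartials c s F x.
Proof.
move=> sF /chart_image cx; have [sR sI] := sF c ac.
apply: complex_eq; rewrite ?ReM ?ImM /=.
  rewrite -mulNr -(partials_linear oc _ _ _ sR sI cx).
  by apply: (partials_ext oc) cx => v _; rewrite ReM mulNr.
rewrite -(partials_linear oc _ _ _ sI sR cx).
by apply: (partials_ext oc) cx => v _; rewrite ImM.
Qed.

Lemma cpartialsM F G s x : smooth_fun F -> smooth_fun G -> chart_dom c x ->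
  cpartials c s (fun y => F y * G y) x
  = \sum_(p <- leibniz_list s) cpartials c p.1 F x * cpartials c p.2 G x.
Proof.
move=> sF sG /chart_image cx; have [FR FI] := sF c ac; have [GR GI] := sG c ac.
apply: complex_eq; rewrite ?Re_sum ?Im_sum.
  under eq_bigr do rewrite ReM /=.
  rewrite sumrB -!(partialsM oc) // -[X in _ - X]mul1r -mulNr -[X in X + _]mul1r.
  rewrite -(partials_linear oc _ _ _ (smooth_onM oc FR GR) (smooth_onM oc FI GI) cx).
  by apply: (partials_ext oc) cx => v _; rewrite ReM mul1r mulN1r.
under eq_bigr do rewrite ImM /=.
rewrite big_split /= -!(partialsM oc) // -[X in _ + X]mul1r -[X in X + _]mul1r.
rewrite -(partials_linear oc _ _ _ (smooth_onM oc FR GI) (smooth_onM oc FI GR) cx).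
by apply: (partials_ext oc) cx => v _; rewrite ImM !mul1r.
Qed.

Lemma cpartials_locally_bounded F s x : smooth_fun F -> chart_dom c x ->
  exists C, \forall y \near x, modulus (cpartials c s F y) <= C.
Proof.
move=> sF cx; have [_ _ _ cc _] := atlas_chart _ ac.
have bnd (f : 'rV[R]_m -> R^o) : {for c x, continuous f} ->
    \forall y \near x, `|f (c y)| <= `|f (c x)| + 1.
  move=> cf; have cfc : {for x, continuous (f \o c)}.
    by apply: continuous_comp => //; exact: cc.
  have /cvgrPdist_le/(_ 1 ltr01) := cfc.
  apply: filterS => y; rewrite /= distrC => fy; rewrite addrC -lerBlDr.
  exact: le_trans (lerB_dist _ _) fy.
have [sR sI] := sF c ac; have icx := chart_image cx.
have bR := bnd _ (smooth_on_continuous (smooth_on_partials s sR) icx).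
have bI := bnd _ (smooth_on_continuous (smooth_on_partials s sI) icx).
eexists; apply: filterS (filterI bR bI) => y [yR yI].
apply: le_trans (modulus_le_ReIm _) _; exact: lerD yR yI.
Qed.

(** By compactness from the local bounds, which come from continuity of the
    derivatives. *)
Lemma cpartials_bounded F s K : smooth_fun F -> compact K -> K `<=` chart_dom c ->
  exists C, forall x, K x -> modulus (cpartials c s F x) <= C.
Proof.
move=> sF cK Kc; apply: (@compact_ind _
  (fun A => exists C, forall x, A x -> modulus (cpartials c s F x) <= C)) cK.
- by exists 0.
- by move=> A B AB [C CB]; exists C => x /AB /CB.
- move=> A B [C CA] [D DB]; exists (Num.max C D) => x [/CA|/DB] h; rewrite le_max h ?orbT //.
- move=> x /Kc cx; have [C nC] := cpartials_locally_bounded s sF cx.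
  by eexists; first exact: nC; exists C.
Qed.

Variables (n : nat) (N : manifoldType R n) (f : M -> N) (e : chart R n N).
Hypotheses (sf : smooth_map f) (ae : atlas N e).

(** In charts this is the formula for the derivatives of a pullback, whose
    coefficients are continuous and hence bounded near x0. Neither the bound C,
    nor the list T of derivatives, nor the neighbourhood depends on F. *)
Lemma cpartials_pullback_bound s x0 : chart_dom c x0 -> chart_dom e (f x0) ->
  exists (T : seq (seq 'I_n)) (C : R), 0 <= C /\ \forall x \near x0,
    chart_dom e (f x) /\ forall F : N -> R[i], smooth_fun F ->
    modulus (cpartials c s (fun y => F (f y)) x)
      <= C * \sum_(t <- T) modulus (cpartials e t F (f x)).
Proof.
move=> cx0 ex0; have [oe oie eK _ _] := atlas_chart _ ae.
have [odc _ cK cc _] := atlas_chart _ ac.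
have [cf _] := sf.
have oO : open (f @^-1` chart_dom e) by apply: open_comp => // y _; exact: cf.
set U := c @` (chart_dom c `&` f @^-1` chart_dom e).
have oU : open U by exact: chart_image_open (atlas_chart _ ac) oO.
pose phi v := e (f (chart_inv c v)).
have UV v : U v -> (e @` chart_dom e) (phi v).
  by move=> [y [cy ey] <-]; rewrite /phi cK //; exists (f y).
have sphi j : smooth_on U (fun v => phi v 0 j : R^o) by exact: sf.2.
have s1 : smooth_on U (fun=> 1 : R^o) by exact: smooth_on_cst.
pose L := pull_list phi (fun=> 1) s.
have partE (g : 'rV[R]_n -> R^o) (h : 'rV[R]_m -> R^o) x :
    smooth_on (e @` chart_dom e) g -> chart_dom c x -> chart_dom e (f x) ->
    (forall v, U v -> h v = g (phi v)) ->
    partials s h (c x) = \sum_(p <- L) p.2 (c x) * partials p.1 g (e (f x)).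
  move=> sg cx ex hg; have Ux : U (c x) by exists x.
  have [_ /(_ s _ Ux)] := weighted_pullback oU oie UV sphi s1 sg.
  have phic : phi (c x) = e (f x) by rewrite /phi cK.
  rewrite /pull_op phic => <-; apply: (partials_ext oU) Ux => v /hg ->.
  by rewrite mul1r.
have Ux0 : U (c x0) by exists x0.
have [C C0 nC] : exists2 C : R, 0 <= C & \forall x \near x0,
    forall p, List.In p L -> `|p.2 (c x)| <= C.
  have : forall p, List.In p L -> smooth_on U p.2 by exact: pull_list_smooth s1.
  elim: L {partE} => [|p L IH] sL; first by exists 0 => //; apply: filterE => x p [].
  have [|C C0 nC] := IH; first by move=> q qL; apply: sL; right.
  have cp : {for x0, continuous (p.2 \o c)}.
    apply: continuous_comp; first exact: cc.
    by apply: smooth_on_continuous Ux0; apply: sL; left.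
  have /cvgrPdist_le/(_ 1 ltr01) := cp.
  exists (C + (`|p.2 (c x0)| + 1)); first by rewrite !addr_ge0.
  near=> x => q [<-|qL]; last first.
    by rewrite ler_wpDr ?addr_ge0 //; apply: (near nC x).
  rewrite ler_wpDl // addrC -lerBlDr; apply: le_trans (lerB_dist _ _) _.
  by rewrite distrC; near: x.
(* The factor 2 adds the bounds for the real and the imaginary part. *)
exists (map fst L), (2 * C); split; first by rewrite mulr_ge0.
have ncx : \forall x \near x0, chart_dom c x by exact: open_nbhs_nbhs.
have nex : \forall x \near x0, chart_dom e (f x) by exact: (@open_nbhs_nbhs _ _ (f @^-1` chart_dom e)).
near=> x.
have cx : chart_dom c x by near: x.
have ex : chart_dom e (f x) by near: x.
have xC : forall p, List.In p L -> `|p.2 (c x)| <= C by near: x.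
split=> // F sF; have [FR FI] := sF e ae.
apply: le_trans (modulus_le_ReIm _) _; rewrite /=.
have eKv v : U v -> chart_inv e (phi v) = f (chart_inv c v).
  by move=> [y [cy ey] <-]; rewrite /phi cK // eK.
rewrite (partE _ _ _ FR cx ex) => [|v Uv]; last by rewrite eKv.
rewrite (partE _ _ _ FI cx ex) => [|v Uv]; last by rewrite eKv.
rewrite big_map -mulrA mulr_natl mulr2n mulr_sumr.
have bnd (g : seq 'I_n -> R) :
    (forall t, `|g t| <= modulus (cpartials e t F (f x))) ->
    `|\sum_(p <- L) p.2 (c x) * g p.1| <= \sum_(p <- L) C * modulus (cpartials e p.1 F (f x)).
  move=> gb; apply: le_trans (ler_norm_sum _ _ _) _.
  move: (L) xC => L'; elim: L' => [|p L' IH] xC'; first by rewrite !big_nil.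
  rewrite !big_cons; apply: lerD; last by apply: IH => q qL; apply: xC'; right.
  by rewrite normrM ler_pM //; apply: xC'; left.
apply: lerD; apply: (bnd (fun t => partials t _ _)) => t.
  exact: (Re_le_modulus (cpartials e t F (f x))).
exact: (Im_le_modulus (cpartials e t F (f x))).
Unshelve. all: by end_near. Qed.

End ChartPartials.

(** * Locally convex topologies from neighbourhoods of zero *)

Section LocallyConvexSpaces.
Variable K : numFieldType.

(** A workable criterion for a filter to be the neighbourhoods of zero of a
    locally convex topology. Absorption is phrased as boundedness of points. *)
Record locally_convex_base (E : lmodType K) (N : set_system E) : Prop := {
  lcbase_filter : Filter N;
  lcbase_convex : forall V, N V -> exists W, [/\ N W, W `<=` V & absolutely_convex W];
  lcbase_scale : forall (t : K) V, t != 0 -> N V -> N [set v | V (t *: v)];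
  lcbase_absorb : forall v, bounded0 N [set v] }.

Lemma convex_setP (E : lmodType K) (W : set E) :
  convex_set (W : set (convex_lmodType E)) <->
  forall (x y : E) (t : K), 0 <= t -> t <= 1 -> W x -> W y ->
    W (t *: x + (1 - t) *: y).
Proof.
split=> cW x y t.
  move=> t0 t1 Wx Wy.
  have tI : 0 <= t <= 1 by rewrite t0.
  by have := cW x y (Itv01 t0 t1) (mem_set Wx) (mem_set Wy); rewrite inE.
by move=> /set_mem Wx /set_mem Wy; rewrite inE; apply: cW.
Qed.

Section Space.
Variables (E : lmodType K) (N : set_system E) (NP : locally_convex_base N).

(** A copy of E on which the neighbourhoods of x are the translates by x of the
    sets of N. The proof NP is a parameter of the type so that the topological
    structures can be inferred from it. *)
Definition lc_space : Type := let _ := NP in E.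
HB.instance Definition _ := GRing.Lmodule.on lc_space.

Definition lc_nbhs (x : lc_space) : set_system lc_space := [set V | N [set v | V (x + v)]].
HB.instance Definition _ := hasNbhs.Build lc_space lc_nbhs.

Local Instance NF : Filter N := lcbase_filter NP.

Lemma absorbing (V : set E) v : N V ->
  exists2 s : K, 0 < s & forall t : K, s <= `|t| -> exists2 w, V w & v = t *: w.
Proof.
move=> NV; have [s s0 sP] := lcbase_absorb NP v NV; exists s => // t st.
by have [w Vw wv] := sP t st v erefl; exists w.
Qed.

Lemma lc_nbhs0_singleton (V : set E) : N V -> V 0.
Proof.
move=> /(absorbing 0)[s s0 sP]; have [|w Vw /esym/eqP] := sP s.
  by rewrite ger0_norm // ltW.
by rewrite scaler_eq0 gt_eqF //= => /eqP w0; rewrite -w0.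
Qed.

(** For W convex, v + w is twice the midpoint of v and w, so that W inside V
    and inside one half of V is enough. *)
Lemma lc_nbhs0_split (V : set E) : N V ->
  exists W, [/\ N W, absolutely_convex W, W `<=` V &
    forall v w, W v -> W w -> V (v + w)].
Proof.
move=> NV; have n2 : (2 : K) != 0 by rewrite pnatr_eq0.
have [W [NW WV2 aW]] := lcbase_convex NP (filterI NV (lcbase_scale NP n2 NV)).
exists W; split=> // [v /WV2[]//|v w Wv Ww].
have [/convex_setP cW _] := aW.
have h0 : (0 : K) <= 2^-1 by rewrite invr_ge0.
have h1 : (2^-1 : K) <= 1 by rewrite invf_le1 // ler1n.
have [_] := WV2 _ (cW v w _ h0 h1 Wv Ww).
have -> : 1 - 2^-1 = 2^-1 :> K by field.
by rewrite /= -scalerDr scalerA divff // scale1r.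
Qed.

Lemma lc_nbhsE (x : lc_space) V : nbhs x V = N [set v | V (x + v)].
Proof. by []. Qed.

Lemma lc_nbhs_shift (W : set E) (x : lc_space) :
  N W -> nbhs x [set u : lc_space | W (u - x)].
Proof. by rewrite lc_nbhsE; apply: filterS => w Ww; rewrite /= [_ + w]addrC addrK. Qed.

Fact lc_nbhs_filter (x : lc_space) : ProperFilter (nbhs x).
Proof.
have FL : Filter (nbhs x).
  split; first by rewrite lc_nbhsE; exact: filterT.
    by move=> A B nA nB; rewrite lc_nbhsE; apply: filterI nA nB.
  by move=> A B AB nA; rewrite lc_nbhsE; apply: filterS nA => v; exact: AB.
by apply: Build_ProperFilter_ex => V NV; exists (x + 0); exact: (lc_nbhs0_singleton NV).
Qed.

Fact lc_nbhs_singleton (x : lc_space) (A : set lc_space) : nbhs x A -> A x.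
Proof. by move=> /lc_nbhs0_singleton; rewrite /= addr0. Qed.

Fact lc_nbhs_nbhs (x : lc_space) (A : set lc_space) : nbhs x A -> nbhs x (nbhs^~ A).
Proof.
move=> /lc_nbhs0_split[W [NW _ _ WA]]; have NW' := NW.
rewrite lc_nbhsE; apply: filterS NW' => v Wv; rewrite /= lc_nbhsE.
by apply: filterS NW => w Ww; rewrite /= -addrA; exact: WA.
Qed.

HB.instance Definition _ := Nbhs_isNbhsTopological.Build lc_space
  lc_nbhs_filter lc_nbhs_singleton lc_nbhs_nbhs.

Lemma lc_add_continuous : continuous (fun x : lc_space * lc_space => x.1 + x.2).
Proof.
move=> [x y] A /lc_nbhs0_split[W [NW _ _ WA]].
exists ([set u : lc_space | W (u - x)], [set u : lc_space | W (u - y)]).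
  by split; exact: lc_nbhs_shift.
move=> [u v] /= [Wu Wv]; have := WA _ _ Wu Wv.
by rewrite /= addrACA [x + _]addrC subrK [y + _]addrC subrK.
Qed.

(** The difference d *: u - c *: x is d *: (u - x) + (d - c) *: x. The first
    term is small because |d| is at most |c| + 1 and W is balanced, the second
    because W absorbs x. *)
Lemma lc_scale_continuous : continuous (fun z : K^o * lc_space => z.1 *: z.2).
Proof.
move=> [c x] A /lc_nbhs0_split[W [NW aW _ WA]] /=.
have W0 := lc_nbhs0_singleton NW.
have [s s0 sP] := absorbing x NW.
have k0 : 0 < `|c| + 1 :> K by rewrite ltr_wpDl.
have NW' := lcbase_scale NP (lt0r_neq0 k0) NW.
have nx : nbhs x [set u : lc_space | W ((`|c| + 1) *: (u - x))].
  exact: lc_nbhs_shift NW'.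
have nc : nbhs (c : K^o) [set d : K^o | `|d - c| < s^-1 /\ `|d - c| < 1].
  by apply: filterI; apply/nbhs_ballP; [exists s^-1; rewrite /= ?invr_gt0//|exists 1 => //=];
    move=> d; rewrite -ball_normE /= distrC.
exists ([set d : K^o | `|d - c| < s^-1 /\ `|d - c| < 1],
   [set u : lc_space | W ((`|c| + 1) *: (u - x))]) => // -[d u] /= [[ds d1] Wu].
have Wdx : W ((d - c) *: x).
  have [->|dc0] := eqVneq (d - c) 0; first by rewrite scale0r.
  have [|w Ww ->] := sP (d - c)^-1.
    by rewrite normfV -[s]invrK lef_pV2 ?posrE ?invr_gt0 ?normr_gt0 // ltW.
  by rewrite scalerA mulfV // scale1r.
have Wdu : W (d *: (u - x)).
  rewrite (_ : d *: _ = (d / (`|c| + 1)) *: ((`|c| + 1) *: (u - x))).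
    apply: (aW.2) Wu; rewrite normrM normfV (gtr0_norm k0) ler_pdivrMr // mul1r.
    rewrite -[d in X in X <= _](subrK c); apply: le_trans (ler_normD _ _) _.
    by rewrite addrC lerD2l ltW.
  by rewrite scalerA divfK // gt_eqF.
have := WA _ _ Wdx Wdu; rewrite /= scalerBl scalerBr.
by rewrite [X in _ + X]addrC addrA [c *: x + _]addrC -addrA [c *: x + _]addrC !subrK.
Qed.

(** The interiors of the translates of absolutely convex sets form a basis, as
    the interior of a convex set is convex. *)
Lemma lc_locally_convex : exists2 B : set_system lc_space,
  (forall b, b \in B -> convex_set b) & basis B.
Proof.
exists [set b : set lc_space | open b /\ convex_set b] => [b /set_mem[]//|].
split=> [b []//|x A /= /(lcbase_convex NP)[W [NW WA aW]]].
have nW := lc_nbhs_shift x NW.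
exists (interior [set u : lc_space | W (u - x)]); last first.
  by move=> u /interior_subset /WA /=; rewrite addrC subrK.
split=> //; split; first exact: open_interior.
apply/convex_setP => y z t t0 t1; rewrite /interior /= !lc_nbhsE => ny nz.
have [/convex_setP cW _] := aW.
apply: filterS (filterI ny nz) => w [/= Wy Wz].
have := cW _ _ t t0 t1 Wy Wz; congr W.
rewrite -![_ + w - x]addrA ![_ *: (_ + (w - x))]scalerDr addrACA -scalerDl.
by rewrite [t + _]addrC subrK scale1r.
Qed.

HB.instance Definition _ := PreTopologicalLmod_isTvs.Build K lc_space
  lc_add_continuous lc_scale_continuous lc_locally_convex.
HB.instance Definition _ := PreTopologicalNmodule_isTopologicalNmodule.Build
  lc_space lc_add_continuous.
HB.instance Definition _ := TopologicalNmodule_isTopologicalLmodule.Build K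
  lc_space lc_scale_continuous.
HB.instance Definition _ := Uniform_isTvs.Build K lc_space lc_locally_convex.

Lemma locally_convex_baseW : locally_convex_nbhs0 N.
Proof.
exists (lc_space : tvsType K), (idfun : {linear E -> lc_space}); split.
  by exists id.
move=> V; rewrite image_id lc_nbhsE.
by split; apply: filterS => v; rewrite /= add0r.
Qed.

End Space.

Lemma bounded0_image (E F : lmodType K) (NE : set_system E) (NF : set_system F)
    (f : {linear E -> F}) B :
  continuous0 NE NF f -> bounded0 NE B -> bounded0 NF (f @` B).
Proof.
move=> cf bB V /cf /bB[s s0 sP]; exists s => // t /sP tB _ [v Bv <-].
by have [w Vw <-] := tB v Bv; exists (f w) => //; rewrite linearZ.
Qed.

Lemma bounded0_sub (E : lmodType K) (N : set_system E) (B B' : set E) :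
  B `<=` B' -> bounded0 N B' -> bounded0 N B.
Proof. by move=> BB' bB' V /bB'[s s0 sP]; exists s => // t /sP; exact: subset_trans. Qed.

Lemma bounded0_set0 (E : lmodType K) (N : set_system E) :
  bounded0 N set0.
Proof. by move=> V _; exists 1 => // t _ v []. Qed.

Lemma bounded0U (E : lmodType K) (N : set_system E) A B :
  bounded0 N A -> bounded0 N B -> bounded0 N (A `|` B).
Proof.
move=> bA bB V NV; have [s s0 sP] := bA V NV; have [r r0 rP] := bB V NV.
exists (s + r); first exact: addr_gt0.
move=> t st v [Av|Bv]; [apply: sP Av|apply: rP Bv]; apply: le_trans st.
  by rewrite lerDl ltW.
by rewrite lerDr ltW.
Qed.

Lemma absolutely_convex_preimage (E F : lmodType K) (f : {linear E -> F}) W :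
  absolutely_convex W -> absolutely_convex (f @^-1` W).
Proof.
move=> [/convex_setP cW bW]; split; last by move=> t v t1 Wv; rewrite /= linearZ; exact: bW.
by apply/convex_setP => x y t t0 t1 Wx Wy; rewrite /= linearD !linearZ; exact: cW.
Qed.

Lemma absolutely_convexI (E : lmodType K) (V W : set E) :
  absolutely_convex V -> absolutely_convex W -> absolutely_convex (V `&` W).
Proof.
move=> [/convex_setP cV bV] [/convex_setP cW bW]; split.
  by apply/convex_setP => x y t t0 t1 [Vx Wx] [Vy Wy]; split; [exact: cV|exact: cW].
by move=> t v t1 [Vv Wv]; split; [exact: bV|exact: bW].
Qed.

Section UniformTopology.
Variables (E F : lmodType K) (NF : set_system F) (FP : locally_convex_base NF).
Variables (I : Type) (T : I -> {linear E -> F}) (bdd : set (set I)).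
Hypothesis bdd0 : bdd set0.
Hypothesis bddU : forall A B, bdd A -> bdd B -> bdd (A `|` B).
Hypothesis bdd_image : forall v A, bdd A -> bounded0 NF [set T i v | i in A].

(** The topology of the Dirac elements has this form, with evaluations for T,
    and so does the injective topology of their tensor square, with pairings
    for T. *)
Definition uniform_nbhs0 : set_system E :=
  [set U | exists A V, [/\ bdd A, NF V & forall v, (forall i, A i -> V (T i v)) -> U v]].

(** Everything is inherited from F, except absorption: v is absorbed because
    its images under the T i, for i in one set of bdd, form a bounded set. *)
Lemma uniform_locally_convex : locally_convex_base uniform_nbhs0.
Proof.
have FF := lcbase_filter FP.
split.
- split.
  + by exists set0, setT; split=> //; exact: filterT.
  + move=> U U' [A [V [bA NV AU]]] [A' [V' [bA' NV' AU']]].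
    exists (A `|` A'), (V `&` V'); split; [exact: bddU|exact: filterI|move=> v vAA'].
    split; first by apply: AU => i Ai; have [] := vAA' i (or_introl Ai).
    by apply: AU' => i Ai; have [] := vAA' i (or_intror Ai).
  + by move=> U U' UU' [A [V [bA NV AU]]]; exists A, V; split=> // v /AU /UU'.
- move=> U [A [V [bA NV AU]]]; have [W [NW WV aW]] := lcbase_convex FP NV.
  exists [set v | forall i, A i -> W (T i v)]; split.
  + by exists A, W.
  + by move=> v vA; apply: AU => i /vA /WV.
  + have aT i := absolutely_convex_preimage (T i) aW; split.
      apply/convex_setP => x y t t0 t1 xA yA i Ai.
      have [/convex_setP cT _] := aT i; exact: cT (xA i Ai) (yA i Ai).
    by move=> t v t1 vA i Ai; have [_ bT] := aT i; exact: bT t1 (vA i Ai).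
- move=> t U t0 [A [V [bA NV AU]]].
  exists A, [set w | V (t *: w)]; split=> //; first exact: (lcbase_scale FP).
  by move=> v vA; apply: AU => i Ai; rewrite linearZ; exact: vA.
- move=> v U [A [V [bA NV AU]]].
  have [W [NW WV aW]] := lcbase_convex FP NV.
  have [s s0 sP] := bdd_image v bA NW; exists s => // t st _ ->.
  have t0 : t != 0 by rewrite -normr_gt0 (lt_le_trans s0).
  exists (t^-1 *: v); last by rewrite scalerA divff // scale1r.
  apply: AU => i Ai; have [|w Ww tw] := sP t st (T i v); first by exists i.
  by apply: WV; rewrite linearZ /= -tw scalerA mulVf // scale1r.
Qed.

End UniformTopology.

End LocallyConvexSpaces.

(** * The topology of smooth functions *)

Lemma filter_forall_seq (T : Type) (I : eqType) (F : set_system T)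
    (P : I -> T -> Prop) (s : seq I) : Filter F ->
  (forall i, \forall x \near F, P i x) -> \forall x \near F, forall i, i \in s -> P i x.
Proof.
move=> FF nP; elim: s => [|i s IH]; first exact: filterE.
by apply: filterS (filterI (nP i) IH) => x [Pi Ps] j; rewrite inE => /predU1P[->|/Ps].
Qed.

Lemma sum_seq_le (R : realType) (I : eqType) (s : seq I) (g : I -> R) d :
  (forall i, i \in s -> g i <= d) -> \sum_(i <- s) g i <= (size s)%:R * d.
Proof.
elim: s => [|i s IH] gd; first by rewrite big_nil mul0r.
rewrite big_cons /= -natr1 mulrDl mul1r addrC lerD ?gd ?mem_head //.
by apply: IH => j js; apply: gd; rewrite inE js orbT.
Qed.

Section SeminormTopology.
Variables (R : realType) (m : nat) (M : manifoldType R m).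
Implicit Types (c : chart R m M) (K : set M) (s : seq 'I_m).

(** Convergence to 0 of all derivatives, uniformly on compact sets, for maps T
    into bare functions. It is tested on one chart, one compact set and one
    derivative at a time, and serves smooth functions and compactly supported
    ones alike. *)
Definition cpartials_near (X : Type) (F : set_system X) (T : X -> M -> R[i]) :=
  forall c K s (eps : R), atlas M c -> compact K -> K `<=` chart_dom c -> 0 < eps ->
    \forall u \near F, forall x, K x -> modulus (cpartials c s (T u) x) < eps.

Lemma Cinf_basic_near (X : Type) (F : set_system X) (T : X -> M -> R[i]) B :
  Filter F -> cpartials_near F T -> Cinf_basic_nbhs0 B -> \forall u \near F, B (T u).
Proof.
move=> FF nT [l [c [K [s [eps [e0 cK ->]]]]]].
have : \forall u \near F, forall j x, K j x -> modulus (cpartials (c j) (s j) (T u) x) < eps.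
  by apply: filter_forall => j; have [ac cKj Kc] := cK j; exact: nT.
by apply: filterS => u uP j x /uP; rewrite modulusE ltcR.
Qed.

Lemma Cinf_basic1 c K s (eps : R) : atlas M c -> compact K -> K `<=` chart_dom c ->
  0 < eps ->
  Cinf_basic_nbhs0 [set f | forall x, K x -> modulus (cpartials c s f x) < eps].
Proof.
move=> ac cK Kc e0; exists 1%N, (fun=> c), (fun=> K), (fun=> s), eps; split=> //.
apply/seteqP; split=> [f fK _ x /fK|f fK x /(fK ord0)].
  by rewrite modulusE ltcR.
by rewrite modulusE ltcR.
Qed.

Lemma Cinf_basicI B1 B2 : @Cinf_basic_nbhs0 R m M B1 -> Cinf_basic_nbhs0 B2 ->
  exists2 B, Cinf_basic_nbhs0 B & B `<=` B1 `&` B2.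
Proof.
move=> [l1 [c1 [K1 [s1 [e1 [e10 cK1 ->]]]]]] [l2 [c2 [K2 [s2 [e2 [e20 cK2 ->]]]]]].
pose comb T (u1 : 'I_l1 -> T) (u2 : 'I_l2 -> T) (j : 'I_(l1 + l2)) : T :=
  match fintype.split j with inl i => u1 i | inr i => u2 i end.
eexists.
  exists (l1 + l2)%N, (comb _ c1 c2), (comb _ K1 K2), (comb _ s1 s2), (Num.min e1 e2).
  split=> //; first by rewrite lt_min e10.
  by move=> j; rewrite /comb; case: (fintype.split j) => i; [exact: cK1|exact: cK2].
move=> f fP; split=> j x Kx.
  have := fP (lshift l2 j) x; rewrite /comb (unsplitK (inl j)) => /(_ Kx).
  by move/lt_le_trans; apply; rewrite lecR ge_min lexx.
have := fP (rshift l1 j) x; rewrite /comb (unsplitK (inr j)) => /(_ Kx).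
by move/lt_le_trans; apply; rewrite lecR ge_min lexx orbT.
Qed.

Lemma Cinf_basicT : Cinf_basic_nbhs0 [set: M -> R[i]].
Proof.
have f0 T : 'I_0 -> T by case.
exists 0%N, (f0 _), (f0 _), (f0 _), 1; split=> //; first by case.
by apply/seteqP; split=> // f _ [].
Qed.

Global Instance Cinf_nbhs0_filter : Filter (Cinf_nbhs0 M).
Proof.
split; first by exists setT => //; exact: Cinf_basicT.
  move=> U V [A bA AU] [B bB BV]; have [C bC CAB] := Cinf_basicI bA bB.
  by exists C => // f /CAB[/AU Uf /BV Vf].
by move=> U V UV [A bA AU]; exists A => // f /AU /UV.
Qed.

Lemma Cinf_near_cpartials : cpartials_near (Cinf_nbhs0 M) (fun F : Cinf M => F : M -> R[i]).
Proof.
move=> c K s eps ac cK Kc e0; exists [set f | forall x, K x -> modulus (cpartials c s f x) < eps] => //.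
exact: Cinf_basic1.
Qed.

(** In the Leibniz formula the derivatives of a are bounded on the compact set
    K. *)
Lemma cpartials_near_mul (a : M -> R[i]) : smooth_fun a ->
  cpartials_near (Cinf_nbhs0 M) (fun (F : Cinf M) x => a x * F x).
Proof.
move=> sa c K s eps ac cK Kc e0.
pose bnd p := xget 0 [set C | forall x, K x -> modulus (cpartials c p a x) <= C].
have bndP p x : K x -> modulus (cpartials c p a x) <= bnd p.
  exact: (xgetPex 0 (cpartials_bounded ac p sa cK Kc) x).
pose L := leibniz_list s.
(* With this d each term of the Leibniz formula is at most eps divided by one
    more than the number of terms. *)
pose d := eps / ((size L).+1%:R * (\sum_(p <- L) `|bnd p.1| + 1)).
have S0 : 0 <= \sum_(p <- L) `|bnd p.1| by apply: sumr_ge0.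
have d0 : 0 < d by rewrite divr_gt0 // mulr_gt0 ?ltr0Sn // ltr_wpDl.
have : \forall F \near Cinf_nbhs0 M, forall p, p \in L ->
    forall x, K x -> modulus (cpartials c p.2 (F : Cinf M) x) < d.
  by apply: filter_forall_seq => p; exact: Cinf_near_cpartials.
apply: filterS => F FP x Kx; rewrite (cpartialsM ac _ sa (Cinf_smooth F) (Kc _ Kx)).
apply: le_lt_trans (modulus_sum _ _) _.
apply: (@le_lt_trans _ _ ((size L)%:R * ((\sum_(p <- L) `|bnd p.1| + 1) * d))).
  apply: sum_seq_le => p pL; rewrite modulusM ler_pM ?modulus_ge0 //; last exact/ltW/FP.
  apply: le_trans (bndP _ _ Kx) _; apply: le_trans (ler_norm _) _.
  by rewrite (big_rem p) //= -addrA lerDl addr_ge0 // sumr_ge0.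
rewrite /d invfM; set S := _ + 1; have S1 : 0 < S by rewrite ltr_wpDl.
rewrite (_ : S * _ = eps / (size L).+1%:R); last first.
  by rewrite mulrCA [_ / S]mulrC mulVKf // gt_eqF.
by rewrite mulrCA gtr_pMr // ltr_pdivrMr ?ltr0Sn // mul1r ltr_nat.
Qed.

End SeminormTopology.
Arguments cpartials_near {R m M X} F T.

Section Pullback.
Variables (R : realType) (m n : nat) (M : manifoldType R m) (N : manifoldType R n).
Variables (f : M -> N) (sf : smooth_map f).

(** The bounds for the derivatives of a pullback are local, since f moves from
    one chart of N to another on K; compactness of K combines them. *)
Lemma cpartials_near_pullback :
  cpartials_near (Cinf_nbhs0 N) (fun (F : Cinf N) (x : M) => F (f x)).
Proof.
move=> c K s eps ac cptK Kc e0.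
have [cf _] := sf.
apply: (compact_near_coveringP K).1 cptK _ _ _ _ _ => x0 Kx0.
have cx0 := Kc _ Kx0.
have [e ae ex0] := atlas_cover (f x0).
have [T [C [C0 nT]]] := cpartials_pullback_bound ac sf ae s cx0 ex0.
have [A [cA nA] AP] := compact_nbhs (@open_interior _ _) nT.
have fAe : f @` A `<=` chart_dom e.
  by move=> _ [x Ax <-]; have [] := interior_subset (AP _ Ax).
have cfA : compact (f @` A).
  by apply: continuous_compact cA; apply: continuous_subspaceT.
pose d := eps / (C + 1) / (size T).+1%:R.
have C1 : 0 < C + 1 by rewrite ltr_wpDl.
have d0 : 0 < d by rewrite !divr_gt0 // ltr0Sn.
have nF : \forall F \near Cinf_nbhs0 N, forall t, t \in T ->
    forall y, (f @` A) y -> modulus (cpartials e t (F : Cinf N) y) < d.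
  by apply: filter_forall_seq => t; exact: Cinf_near_cpartials.
exists (A, [set F : Cinf N | forall t, t \in T ->
    forall y, (f @` A) y -> modulus (cpartials e t F y) < d]) => //=.
move=> [x F] /= [Ax FP]; have [_ /(_ F (Cinf_smooth F))] := interior_subset (AP _ Ax).
move/le_lt_trans; apply.
apply: (@le_lt_trans _ _ (C * ((size T)%:R * d))).
  rewrite ler_wpM2l //; apply: sum_seq_le => t tT; apply/ltW/FP => //; by exists x.
apply: (@le_lt_trans _ _ (C * (eps / (C + 1)))).
  rewrite ler_wpM2l // /d mulrCA ger_pMr ?divr_gt0 // ler_pdivrMr ?ltr0Sn // mul1r.
  by rewrite ler_nat.
rewrite mulrCA gtr_pMr // ltr_pdivrMr // mul1r ltrDl; exact: ltr01.
Qed.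

Fact Cinf_pullP (F : Cinf N) : (fun x => F (f x)) \in @Cinf_pred R m M.
Proof. by apply/asboolP; exact: smooth_fun_comp sf (Cinf_smooth F). Qed.

Definition Cinf_pull (F : Cinf N) : Cinf M := MkCinf (Cinf_pullP F).

Fact Cinf_pull_linear : linear Cinf_pull.
Proof. by move=> a F G; apply: Cinf_eqP. Qed.
HB.instance Definition _ := GRing.isLinear.Build R[i] (Cinf N) (Cinf M) _ Cinf_pull
  Cinf_pull_linear.

Lemma Cinf_pull_continuous : continuous0 (Cinf_nbhs0 N) (Cinf_nbhs0 M) Cinf_pull.
Proof.
move=> V [B bB BV]; have := Cinf_basic_near (@Cinf_nbhs0_filter R n N) cpartials_near_pullback bB.
by apply: filterS => F BF; exact: BV.
Qed.

End Pullback.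

Section BoundedSets.
Variables (R : realType) (m : nat) (M : manifoldType R m).

Fact Cinf_mulP (F G : Cinf M) : (fun x => F x * G x) \in @Cinf_pred R m M.
Proof. by apply/asboolP; apply: smooth_funM; exact: Cinf_smooth. Qed.

Definition Cinf_mul (F G : Cinf M) : Cinf M := MkCinf (Cinf_mulP F G).

Fact Cinf_mul_linear F : linear (Cinf_mul F).
Proof.
move=> a G1 G2; apply: Cinf_eqP => x.
by rewrite -[LHS]/(F x * (a * G1 x + G2 x)) -[RHS]/(a * (F x * G1 x) + F x * G2 x) mulrDr mulrCA.
Qed.
HB.instance Definition _ F := GRing.isLinear.Build R[i] (Cinf M) (Cinf M) _ (Cinf_mul F)
  (Cinf_mul_linear F).

Lemma Cinf_mul_continuous F : continuous0 (Cinf_nbhs0 M) (Cinf_nbhs0 M) (Cinf_mul F).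
Proof.
move=> V [B bB BV]; have := Cinf_basic_near (@Cinf_nbhs0_filter R m M) (cpartials_near_mul (Cinf_smooth F)) bB.
by apply: filterS => G BG; exact: BV.
Qed.

(** Scaling a neighbourhood by t scales each seminorm by the modulus of t, so
    that being absorbed by every basic neighbourhood means that every seminorm
    is bounded. *)
Lemma bounded_CinfP (B : set (Cinf M)) :
  bounded0 (Cinf_nbhs0 M) B <->
  forall c K s, atlas M c -> compact K -> K `<=` chart_dom c ->
    exists C, forall (F : Cinf M) x, B F -> K x -> modulus (cpartials c s F x) <= C.
Proof.
split=> [bB c K s ac cK Kc|bB V [A [l [c [K [s [eps [e0 cK ->]]]]]] AV]].
  have [r /complex_gt0[-> r0] rP] := bB _ (Cinf_near_cpartials s ac cK Kc ltr01).
  set r1 := complex.Re r in r0 rP; exists r1 => F x BF Kx.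
  have [|G GP <-] := rP r1%:C%C _ F BF; first by rewrite modulusE modulusR gtr0_norm.
  rewrite (cpartialsZ ac _ _ (Cinf_smooth G) (Kc _ Kx)) modulusM modulusR gtr0_norm //.
  by rewrite ger_pMr //; apply/ltW/GP.
have {}bB j : exists C, forall (F : Cinf M) x, B F -> K j x ->
    modulus (cpartials (c j) (s j) F x) <= C.
  by have [ac cKj Kc] := cK j; exact: bB.
pose C j := xget 0 [set C | forall (F : Cinf M) x, B F -> K j x ->
    modulus (cpartials (c j) (s j) F x) <= C].
have CP j (F : Cinf M) x : B F -> K j x -> modulus (cpartials (c j) (s j) F x) <= C j.
  exact: (xgetPex 0 (bB j) F x).
pose D := \sum_j `|C j| + 1.
have D0 : 0 < D by rewrite ltr_wpDl // sumr_ge0.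
have r0 : 0 < D / eps by rewrite divr_gt0.
exists (D / eps)%:C%C; first by rewrite ltcR.
move=> t rt F BF; rewrite modulusE lecR in rt.
have t0 : t != 0.
  by apply: contraTneq rt => ->; rewrite modulus0 -ltNge.
exists (t^-1 *: F); last by rewrite scalerA divff // scale1r.
apply: AV => j x Kx; have [ac cKj Kc] := cK j.
rewrite (cpartialsZ ac _ _ (Cinf_smooth F) (Kc _ Kx)) modulusE ltcR modulusM.
have mt : modulus t^-1 * modulus t = 1 by rewrite -modulusM mulVf // modulusR normr1.
have mt0 : 0 < modulus t by apply: lt_le_trans r0 rt.
rewrite -(ltr_pM2l mt0) mulrA [modulus t * _]mulrC mt mul1r.
apply: le_lt_trans (CP _ _ _ BF Kx) _; apply: (@lt_le_trans _ _ D); last first.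
  by rewrite -ler_pdivrMr.
apply: le_lt_trans (ler_norm _) _.
by rewrite /D (bigD1 j) //= -addrA ltrDl ltr_wpDl // sumr_ge0.
Qed.

(** By the Leibniz formula each seminorm of F G is at most a sum of products of
    seminorms of F and of G. The functions F and G vary here simultaneously. *)
Lemma bounded_Cinf_mul A B :
  bounded0 (Cinf_nbhs0 M) A -> bounded0 (Cinf_nbhs0 M) B ->
  bounded0 (Cinf_nbhs0 M) [set H | exists F G, [/\ A F, B G & H = Cinf_mul F G]].
Proof.
move=> /bounded_CinfP bA /bounded_CinfP bB; apply/bounded_CinfP => c K s ac cK Kc.
have {}bA t := bA c K t ac cK Kc; have {}bB t := bB c K t ac cK Kc.
pose bd (X : set (Cinf M)) t := xget 0 [set C | forall (F : Cinf M) x, X F -> K x ->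
  modulus (cpartials c t F x) <= C].
have AP t (F : Cinf M) x : A F -> K x -> modulus (cpartials c t F x) <= bd A t.
  exact: (xgetPex 0 (bA t) F x).
have BP t (F : Cinf M) x : B F -> K x -> modulus (cpartials c t F x) <= bd B t.
  exact: (xgetPex 0 (bB t) F x).
exists (\sum_(p <- leibniz_list s) bd A p.1 * bd B p.2) => _ x [F [G [AF BG ->]]] Kx.
rewrite (cpartialsM ac _ (Cinf_smooth F) (Cinf_smooth G) (Kc _ Kx)).
apply: le_trans (modulus_sum _ _) _; apply: ler_sum => p _.
by rewrite modulusM ler_pM ?modulus_ge0 //; [exact: AP|exact: BP].
Qed.

Lemma bounded_Cinf1 F : bounded0 (Cinf_nbhs0 M) [set F].
Proof.
apply/bounded_CinfP => c K s ac cK Kc.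
have [C CP] := cpartials_bounded ac s (Cinf_smooth F) cK Kc.
by exists C => _ x -> /CP.
Qed.

End BoundedSets.

(** * The topology of compactly supported smooth functions *)

Section TestFunctions.
Variables (R : realType) (m : nat) (M : manifoldType R m).

Fact Cc_cutP (f : Cc M) (F : Cinf M) : (fun x => f x * F x) \in @Cc_pred R m M.
Proof.
apply/asboolP; split; first by apply: smooth_funM; [exact: Cc_smooth|exact: Cinf_smooth].
by apply: compact_csupport_sub (@Cc_compact _ _ _ f) => x ->; rewrite mul0r.
Qed.

Definition Cc_cut (f : Cc M) (F : Cinf M) : Cc M := MkCc (Cc_cutP f F).

Fact Cc_cut_linear f : linear (Cc_cut f).
Proof.
move=> a F G; apply: Cc_eqP => x.
by rewrite -[LHS]/(f x * (a * F x + G x)) -[RHS]/(a * (f x * F x) + f x * G x) mulrDr mulrCA.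
Qed.
HB.instance Definition _ f := GRing.isLinear.Build R[i] (Cinf M) (Cc M) _ (Cc_cut f)
  (Cc_cut_linear f).

Fact Cinf_of_CcP (f : Cc M) : (f : M -> R[i]) \in @Cinf_pred R m M.
Proof. by apply/asboolP; exact: Cc_smooth. Qed.

Definition Cinf_of_Cc (f : Cc M) : Cinf M := MkCinf (Cinf_of_CcP f).

(** Functions supported in a fixed compact set L carry the topology of smooth
    functions, by the very definition of the inductive limit. *)
Lemma Cc_continuous (E : lmodType R[i]) (N : set_system E) (T : E -> Cc M) (L : set M) :
  Filter N -> compact L -> (forall u, csupport (T u) `<=` L) ->
  cpartials_near N (fun u => T u : M -> R[i]) -> continuous0 N (Cc_nbhs0 M) T.
Proof.
move=> FN cL TL nT V [W [WV aW WP]]; have [B bB BW] := WP L cL.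
by have := Cinf_basic_near FN nT bB; apply: filterS => u Bu; apply/WV/BW.
Qed.

Lemma cpartials_near_continuous (E : lmodType R[i]) (N : set_system E) (T : E -> Cinf M) :
  continuous0 N (Cinf_nbhs0 M) T -> cpartials_near N (fun u => T u : M -> R[i]).
Proof.
move=> cT c K s eps ac cK Kc e0.
exact: cT _ (Cinf_near_cpartials s ac cK Kc e0).
Qed.

Lemma Cc_cut_continuous f : continuous0 (Cinf_nbhs0 M) (Cc_nbhs0 M) (Cc_cut f).
Proof.
apply: (@Cc_continuous _ _ _ (csupport f)).
- exact: Cc_compact.
- by move=> F; apply: csupport_sub => x /= ->; rewrite mul0r.
- exact: cpartials_near_mul (@Cc_smooth _ _ _ f).
Qed.

(** A single function f is absorbed because it lies in the step of functions
    supported in its own support, where the topology is that of smooth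
    functions; there the seminorms of f are finite. *)
Lemma Cc_nbhs0_base : locally_convex_base (Cc_nbhs0 M).
Proof.
split.
- split.
  + exists setT; split=> //.
      by split=> // x y t _ _; rewrite inE.
    by move=> L cL; exists setT => //; exact: Cinf_basicT.
  + move=> U V [A [AU aA AP]] [B [BV aB BP]]; exists (A `&` B); split.
    * by move=> f [/AU Uf /BV Vf].
    * exact: absolutely_convexI.
    * move=> L cL; have [C bC CA] := AP L cL; have [D bD DB] := BP L cL.
      have [X bX XCD] := Cinf_basicI bC bD.
      by exists X => // f fL /XCD[Cf Df]; split; [exact: CA|exact: DB].
  + by move=> U V UV [W [WU aW WP]]; exists W; split=> // f /WU /UV.
- by move=> V [W [WV aW WP]]; exists W; split=> //; exists W; split.
- move=> t V t0 [W [WV aW WP]]; exists [set f | W (t *: f)]; split.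
  + by move=> f /WV.
  + exact: (@absolutely_convex_preimage _ _ _ ( *:%R t)).
  + move=> L cL; have [B bB BW] := WP L cL.
    have [D bD DB] := Cinf_basic_near (@Cinf_nbhs0_filter R m M)
       (cpartials_near_mul (@smooth_fun_cst R m M t)) bB.
    exists D => // f fL Df; apply: BW; last exact: (DB (Cinf_of_Cc f)).
    apply: subset_trans fL; apply: csupport_sub => x fx.
    by rewrite -[LHS]/(t * f x) fx mulr0.
- move=> f V [W [WV aW WP]]; have [B bB BW] := WP _ (@Cc_compact _ _ _ f).
  have [|s s0 sP] := bounded_Cinf1 (Cinf_of_Cc f) (V := [set F : Cinf M | B F]).
    by exists B.
  exists s => // t st _ ->; have t0 : t != 0 by rewrite -normr_gt0 (lt_le_trans s0).
  exists (t^-1 *: f); last by rewrite scalerA divff // scale1r.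
  apply/WV/BW.
    by apply: csupport_sub => x fx; rewrite -[LHS]/(t^-1 * f x) fx mulr0.
  have [F BF tF] := sP t st _ erefl.
  rewrite (_ : Cc_fun _ = F) //; apply/funext => x.
  rewrite -[LHS]/(t^-1 * (Cinf_of_Cc f) x) -tF.
  by rewrite -[X in _ * X]/(t * F x) mulKf.
Qed.

End TestFunctions.

Section WeightedTranslation.
Variables (R : realType) (m n : nat) (M : manifoldType R m) (N : manifoldType R n).

(** S prolongs T to all smooth functions. The preimage of an absolutely convex
    neighbourhood W is absolutely convex, and by continuity of S it contains a
    neighbourhood of 0 in each step of the inductive limit, because the images
    under T all live in the step of L. *)
Lemma Cc_Cc_continuous (T : {linear Cc N -> Cc M}) (S : Cinf N -> Cinf M) (L : set M) :
  compact L -> (forall f, csupport (T f) `<=` L) ->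
  continuous0 (Cinf_nbhs0 N) (Cinf_nbhs0 M) S ->
  (forall f x, T f x = S (Cinf_of_Cc f) x) ->
  continuous0 (Cc_nbhs0 N) (Cc_nbhs0 M) T.
Proof.
move=> cL TL cS TS V [W [WV aW WP]]; have [B bB BW] := WP L cL.
have [D bD DB] := Cinf_basic_near (@Cinf_nbhs0_filter R n N) (cpartials_near_continuous cS) bB.
exists (T @^-1` W); split; first by move=> f /WV.
  exact: absolutely_convex_preimage.
move=> L' _; exists D => // f _ Df; apply: BW => //.
have := DB (Cinf_of_Cc f) Df; congr B; apply/funext => x; rewrite -TS //.
Qed.

End WeightedTranslation.

Section ContinuousLinear.
Variable K : numFieldType.
Variables (E F : lmodType K) (NE : set_system E) (NF : set_system F).
Hypotheses (FE : Filter NE) (FP : locally_convex_base NF).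

Lemma nbhs0_scale_any (a : K) W : NF W -> NF [set v | W (a *: v)].
Proof.
move=> NW; have FF := lcbase_filter FP.
have [->|a0] := eqVneq a 0; last exact: (lcbase_scale FP a0 NW).
by apply: filterE => v; rewrite /= scale0r; exact: (lc_nbhs0_singleton FP).
Qed.

Lemma continuous0_lin (T U : E -> F) (a : K) :
  continuous0 NE NF T -> continuous0 NE NF U ->
  continuous0 NE NF (fun v => a *: T v + U v).
Proof.
move=> cT cU V NV; have [W [NW _ _ WA]] := lc_nbhs0_split FP NV.
by apply: filterS (filterI (cT _ (nbhs0_scale_any a NW)) (cU _ NW)) => v [? ?]; exact: WA.
Qed.

(** The index sets of T and of U are the same, and it is the map, not the sets
    of values, that is combined: this is what evaluations of a linear
    combination on one bounded set require. *)
Lemma bounded0_lin (I : Type) (A : set I) (T U : I -> F) (a : K) :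
  bounded0 NF (T @` A) -> bounded0 NF (U @` A) ->
  bounded0 NF ((fun i => a *: T i + U i) @` A).
Proof.
move=> bT bU V NV; have [W [NW _ _ WA]] := lc_nbhs0_split FP NV.
have [s s0 sP] := bT _ (nbhs0_scale_any a NW); have [r r0 rP] := bU _ NW.
exists (s + r); first exact: addr_gt0.
move=> t srt _ [i Ai <-].
have st : s <= `|t| by apply: le_trans srt; rewrite lerDl ltW.
have rt : r <= `|t| by apply: le_trans srt; rewrite lerDr ltW.
have [v Wv tv] := sP t st _ (ex_intro2 _ _ i Ai erefl).
have [w Ww tw] := rP t rt _ (ex_intro2 _ _ i Ai erefl).
exists (a *: v + w); first exact: WA.
by rewrite scalerDr tw -tv !scalerA mulrC.
Qed.

End ContinuousLinear.

(** * Dirac elements as a direct sum *)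

Lemma linear_zero (K : pzRingType) (E F : lmodType K) (f : E -> F) : linear f -> f 0 = 0.
Proof.
by move=> lf; apply: (@addrI _ (f 0)); have := lf 1 0 0; rewrite !scale1r !addr0 => {1}<-.
Qed.

Lemma linear_compose (K : pzRingType) (E F G : lmodType K) (f : F -> G) (g : E -> F) :
  linear f -> linear g -> linear (fun x => f (g x)).
Proof. by move=> lf lg a u v; rewrite lg lf. Qed.

Section DiracElements.
Variables (R : realType) (m n : nat).
Variables (M : manifoldType R m) (H : lieGroupType R n).
Local Notation A := (Dirac M H).
Local Notation CMH := (Cinf (M * H)%type).
Local Notation AA := (AA (@dirac_act R m n M H)).
Implicit Types (u v : A) (f g : Cc M) (h k : H).

Lemma Dirac_eqP u v : (forall F x, u F x = v F x) -> u = v.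
Proof. by move=> uv; apply: val_inj; apply/funext => F; apply: Cc_eqP => x; exact: uv. Qed.

Lemma DiracE (a : R[i]) u v F : (a *: u + v) F = a *: u F + v F.
Proof. by []. Qed.

Lemma Dirac_sumE (I : Type) (s : seq I) (G : I -> A) F :
  (\sum_(i <- s) G i) F = \sum_(i <- s) G i F.
Proof.
elim: s => [|i s IH]; first by rewrite !big_nil.
by rewrite !big_cons -IH.
Qed.

Lemma Cc_sumE (I : Type) (s : seq I) (G : I -> Cc M) x :
  (\sum_(i <- s) G i) x = \sum_(i <- s) G i x.
Proof.
elim: s => [|i s IH]; first by rewrite !big_nil.
by rewrite !big_cons -IH.
Qed.

Lemma dirac_gen_linear h : linear (@dirac_gen R m n M H h).
Proof.
move=> a f g; apply: Dirac_eqP => F x.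
by rewrite -[LHS]/((a * f x + g x) * F (x, h)) -[RHS]/(a * (f x * F (x, h)) + g x * F (x, h)) mulrDl mulrA.
Qed.
HB.instance Definition _ h := GRing.isLinear.Build R[i] (Cc M) A _ (@dirac_gen R m n M H h)
  (dirac_gen_linear h).

Definition dirac_comb (s : seq (R[i] * (H * Cc M))) : A :=
  \sum_(p <- s) p.1 *: dirac_gen p.2.1 p.2.2.

Lemma dirac_comb_ex u : exists s, u = dirac_comb s.
Proof.
have /asboolP[s us] := valP u; exists s; apply: val_inj; rewrite us /dirac_comb.
by rewrite raddf_sum.
Qed.

Lemma dirac_ind (P : A -> Prop) : P 0 ->
  (forall a u v, P u -> P v -> P (a *: u + v)) ->
  (forall h f, P (dirac_gen h f)) -> forall u, P u.
Proof.
move=> P0 PD Pg u; have [s ->] := dirac_comb_ex u; rewrite /dirac_comb.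
by elim: s => [|p s IH]; rewrite ?big_nil // big_cons; exact: PD.
Qed.

(** A finite product of bump functions at h, each vanishing at one of the other
    points. *)
Lemma separating_function h (s : seq H) :
  exists b : Cinf H, b h = 1 /\ forall k, k \in s -> k != h -> b k = 0.
Proof.
elim: s => [|k s [b [b1 b0]]].
  have H1 : (fun=> 1 : R[i]) \in @Cinf_pred R n H.
    by apply/asboolP; exact: smooth_fun_cst.
  by exists (MkCinf H1).
have [kh|kh] := eqVneq k h.
  by exists b; split=> // l; rewrite inE => /predU1P[->|]; [rewrite kh eqxx|exact: b0].
have oO : open (~` [set k]).
  apply: closed_openC; apply: compact_closed; first exact: manifold_hausdorff.
  exact: compact_set1.
have [c [c1 c0]] := Cc_bump oO (fun hk : h = k => negP kh (introT eqP (esym hk))).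
exists (Cinf_mul (Cinf_of_Cc c) b); split=> /=; first by rewrite (nbhs_singleton c1) b1 mul1r.
move=> l; rewrite inE => /predU1P[->|ls] lh.
  by rewrite c0 ?mul0r // => /(_ erefl).
by rewrite b0 // mulr0.
Qed.

(** Uniqueness of the coefficients: the combination is evaluated at the
    function (x, k) |-> b k, where b separates h from the other points
    involved. *)
Lemma dirac_comb_eq0 s : dirac_comb s = 0 ->
  forall h, \sum_(p <- s | p.2.1 == h) p.1 *: p.2.2 = 0.
Proof.
move=> s0 h; apply: Cc_eqP => x.
have [b [b1 b0]] := separating_function h [seq p.2.1 | p <- s].
have := congr1 (fun u : A => u (Cinf_pull (smooth_map_snd M H) b) x) s0.
rewrite /dirac_comb Dirac_sumE Cc_sumE => {}s0; rewrite -[RHS]s0 big_mkcond Cc_sumE.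
apply: eq_big_seq => p ps.
rewrite -[RHS]/(p.1 * (p.2.2 x * b p.2.1)).
case: eqP => [->|/eqP ph]; first by rewrite b1 mulr1.
by rewrite b0 ?mulr0 //; apply/mapP; exists p.
Qed.

Section Lift.
Variables (V : lmodType R[i]) (phi : H -> Cc M -> V).
Hypothesis phi_linear : forall h, linear (phi h).

Definition comb_image (s : seq (R[i] * (H * Cc M))) : V :=
  \sum_(p <- s) p.1 *: phi p.2.1 p.2.2.

Lemma comb_image_eq0 s : dirac_comb s = 0 -> comb_image s = 0.
Proof.
move=> s0; pose hs := undup [seq p.2.1 | p <- s].
(* The terms are grouped by their point of H, since only the sums of the
    coefficients at equal points are known to vanish. *)
have -> : comb_image s = \sum_(h <- hs) \sum_(p <- s | p.2.1 == h) p.1 *: phi p.2.1 p.2.2.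
  rewrite /comb_image (exchange_big_dep xpredT) //=; apply: eq_big_seq => p ps.
  under eq_bigl do rewrite eq_sym.
  rewrite -big_filter filter_pred1_uniq ?big_seq1 ?undup_uniq // mem_undup.
  by apply/mapP; exists p.
rewrite big1 // => h _.
transitivity (phi h (\sum_(p <- s | p.2.1 == h) p.1 *: p.2.2)).
  2: by rewrite (dirac_comb_eq0 s0) (linear_zero (phi_linear h)).
elim: s {s0 hs} => [|p s IH]; first by rewrite !big_nil (linear_zero (phi_linear h)).
rewrite !big_cons; case: eqP => [ph|_]; last exact: IH.
by rewrite ph phi_linear IH.
Qed.

(** The universal property of the space of Dirac elements as direct sum,
    indexed by H, of copies of the compactly supported functions. Every
    structure map is defined through it. *)
Definition dirac_lift (u : A) : V := comb_image (sval (cid (dirac_comb_ex u))).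

Lemma comb_image_eq s t : dirac_comb s = dirac_comb t -> comb_image s = comb_image t.
Proof.
pose opp := map (fun p : R[i] * (H * Cc M) => (- p.1, p.2)).
have combN r : dirac_comb (opp r) = - dirac_comb r.
  by rewrite /dirac_comb big_map -sumrN; apply: eq_bigr => p _; rewrite scaleNr.
have imN r : comb_image (opp r) = - comb_image r.
  by rewrite /comb_image big_map -sumrN; apply: eq_bigr => p _; rewrite scaleNr.
move=> st; apply/eqP; rewrite -subr_eq0; apply/eqP.
rewrite -imN -[LHS]big_cat; apply: comb_image_eq0.
have -> : dirac_comb (s ++ opp t) = dirac_comb s + dirac_comb (opp t).
  by rewrite /dirac_comb big_cat.
by rewrite combN st subrr.
Qed.

Lemma dirac_liftE s : dirac_lift (dirac_comb s) = comb_image s.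
Proof. by apply: comb_image_eq; rewrite -(svalP (cid (dirac_comb_ex (dirac_comb s)))). Qed.

Lemma dirac_lift_gen h f : dirac_lift (dirac_gen h f) = phi h f.
Proof.
have -> : dirac_gen h f = dirac_comb [:: (1, (h, f))].
  by rewrite /dirac_comb big_seq1 scale1r.
by rewrite dirac_liftE /comb_image big_seq1 scale1r.
Qed.

Lemma dirac_lift_linear : linear dirac_lift.
Proof.
move=> a u v; have [s ->] := dirac_comb_ex u; have [t ->] := dirac_comb_ex v.
have -> : a *: dirac_comb s + dirac_comb t
    = dirac_comb ([seq (a * p.1, p.2) | p <- s] ++ t).
  rewrite /dirac_comb big_cat big_map scaler_sumr; congr (_ + _).
  by apply: eq_bigr => p _; rewrite scalerA.
rewrite !dirac_liftE /comb_image big_cat big_map scaler_sumr; congr (_ + _).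
by apply: eq_bigr => p _; rewrite scalerA.
Qed.

End Lift.

End DiracElements.

(** * Tensor products over the base algebra *)

Section TensorTheory.
Variables (K : fieldType) (S : Type) (E F : lmodType K).
Variables (actE : S -> E -> E) (actF : S -> F -> F).
Local Notation T := (tensor actE actF).
Local Notation "a (x) b" := (tens a b : T) (at level 40).

Lemma tensDl a a' b : (a + a') (x) b = a (x) b + a' (x) b.
Proof. by rewrite [RHS]tensor_addE; apply: tensor_piP; exact: TensorDl. Qed.

Lemma tensDr a b b' : a (x) (b + b') = a (x) b + a (x) b'.
Proof. by rewrite [RHS]tensor_addE; apply: tensor_piP; exact: TensorDr. Qed.

Lemma tensZl c a b : (c *: a) (x) b = c *: (a (x) b).
Proof. by rewrite [RHS]tensor_scaleE. Qed.

Lemma tensZr c a b : a (x) (c *: b) = c *: (a (x) b).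
Proof. by rewrite -tensZl; apply: tensor_piP; exact: TensorZr. Qed.

Lemma tens_act r a b : (actE r a) (x) b = a (x) (actF r b).
Proof. by apply: tensor_piP; exact: TensorAct. Qed.

Lemma tens_linearl b : linear (fun a => a (x) b).
Proof. by move=> c a a'; rewrite tensDl tensZl. Qed.

Lemma tens_linearr a : linear (fun b => a (x) b).
Proof. by move=> c b b'; rewrite tensDr tensZr. Qed.

Lemma tensor_ind (P : T -> Prop) : P 0 -> (forall t u, P t -> P u -> P (t + u)) ->
  (forall a b, P (a (x) b)) -> forall t, P t.
Proof.
move=> P0 PD Pt; elim/tensorW => s; elim: s => [|[a b] s IH]; first exact: P0.
by rewrite -cat1s -tensor_addE; exact: PD (Pt a b) IH.
Qed.

Definition balanced (V : lmodType K) (beta : E -> F -> V) :=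
  [/\ forall b, linear (beta^~ b), forall a, linear (beta a) &
      forall r a b, beta (actE r a) b = beta a (actF r b)].

Lemma tensor_lift_tens (V : lmodType K) (beta : E -> F -> V) a b :
  balanced beta -> tensor_lift beta (a (x) b) = beta a b.
Proof. by move=> [bl br bb]; rewrite tensor_liftE // big_seq1. Qed.

Lemma tensor_lift_linear (V : lmodType K) (beta : E -> F -> V) :
  balanced beta -> linear (tensor_lift beta : T -> V).
Proof.
move=> [bl br bb] c; elim/tensorW => s; elim/tensorW => t.
rewrite -[X in tensor_lift _ X]/(tensor_add (tensor_scale c _) _).
rewrite tensor_scaleE tensor_addE !tensor_liftE //.
rewrite big_cat big_map scaler_sumr; congr (_ + _); apply: eq_bigr => p _ /=.
by have := bl p.2 c p.1 0; rewrite (linear_zero (bl p.2)) !addr0.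
Qed.

Lemma tensor_ext (V : lmodType K) (f g : T -> V) : linear f -> linear g ->
  (forall a b, f (a (x) b) = g (a (x) b)) -> f =1 g.
Proof.
have linD (h : T -> V) t u : linear h -> h (t + u) = h t + h u.
  by move=> lh; have := lh 1 t u; rewrite !scale1r.
move=> lf lg fg; apply: tensor_ind => // [|t u ft fu]; first by rewrite !linear_zero.
by rewrite !linD // ft fu.
Qed.

End TensorTheory.

Section ExtensionTheory.
Variables (K : fieldType) (R A : lmodType K).
Variables (mulR : R -> R -> R) (mulA : A -> A -> A).
Variables (iota : R -> A) (act : R -> A -> A).
Hypothesis baseP : comm_algebra_with_local_units mulR.
Hypothesis extP : algebra_extension mulR mulA iota act.
Local Notation "a ** b" := (mulA a b) (at level 40, left associativity).
Local Notation AA := (AA act).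

Let mul_linearl b : linear (mulA^~ b). Proof. exact: (ext_bilinear extP).1. Qed.
Let mul_linearr a : linear (mulA a). Proof. exact: (ext_bilinear extP).2. Qed.
Let mulA_assoc : associative mulA := ext_mulA extP.
Let actE r a : act r a = iota r ** a := ext_act extP r a.

Lemma act_linear r : linear (act r).
Proof. by move=> c a b; rewrite !actE mul_linearr. Qed.

Lemma act_act r s a : act r (act s a) = act s (act r a).
Proof. by rewrite !actE !mulA_assoc -!(ext_mul extP) (base_mulC baseP). Qed.

Lemma actAA_balanced r : balanced act act (fun a b => tens (act r a) b : AA).
Proof.
split=> [b|a|s a b].
- exact: linear_compose (tens_linearl _ _ _) (act_linear r).
- exact: tens_linearr.
- by rewrite act_act tens_act.
Qed.

Lemma actAA_tens r a b : actAA r (tens a b : AA) = tens (act r a) b.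
Proof. exact: tensor_lift_tens (actAA_balanced r). Qed.

Lemma actAA_linear r : linear (actAA r : AA -> AA).
Proof. exact: tensor_lift_linear (actAA_balanced r). Qed.

Lemma ractl_balanced r : balanced act act (fun a b => tens (a ** iota r) b : AA).
Proof.
split=> [b|a|s a b].
- exact: linear_compose (tens_linearl _ _ _) (mul_linearl _).
- exact: tens_linearr.
- by rewrite -tens_act !actE mulA_assoc.
Qed.

Lemma ractr_balanced r : balanced act act (fun a b => tens a (b ** iota r) : AA).
Proof.
split=> [b|a|s a b].
- exact: tens_linearl.
- exact: linear_compose (tens_linearr _ _ _) (mul_linearl _).
- by rewrite tens_act !actE mulA_assoc.
Qed.

Lemma ractl_tens r a b : ractl mulA iota r (tens a b : AA) = tens (a ** iota r) b.
Proof. exact: tensor_lift_tens (ractl_balanced r). Qed.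

Lemma ractr_tens r a b : ractr mulA iota r (tens a b : AA) = tens a (b ** iota r).
Proof. exact: tensor_lift_tens (ractr_balanced r). Qed.

Lemma ractl_linear r : linear (ractl mulA iota r : AA -> AA).
Proof. exact: tensor_lift_linear (ractl_balanced r). Qed.

Lemma ractr_linear r : linear (ractr mulA iota r : AA -> AA).
Proof. exact: tensor_lift_linear (ractr_balanced r). Qed.

(** The product with a pure tensor on the right is defined for every left
    factor t. It depends in a balanced way on that pure tensor when the two
    right actions agree on t, by rmulAA_act and rmulAA_actr; this is how the
    product of tensors becomes well defined. *)
Definition rmulAA (c d : A) (t : AA) : AA :=
  tensor_lift (fun a b => tens (a ** c) (b ** d) : AA) t.

Lemma rmulAA_balanced c d : balanced act act (fun a b => tens (a ** c) (b ** d) : AA).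
Proof.
split=> [b|a|s a b].
- exact: linear_compose (tens_linearl _ _ _) (mul_linearl _).
- exact: linear_compose (tens_linearr _ _ _) (mul_linearl _).
- by rewrite !actE -!mulA_assoc -!actE tens_act.
Qed.

Lemma rmulAA_tens c d a b : rmulAA c d (tens a b) = tens (a ** c) (b ** d).
Proof. exact: tensor_lift_tens (rmulAA_balanced c d). Qed.

Lemma rmulAA_linear c d : linear (rmulAA c d).
Proof. exact: tensor_lift_linear (rmulAA_balanced c d). Qed.

Lemma rmulAA_act r c d t : rmulAA (act r c) d t = rmulAA c d (ractl mulA iota r t).
Proof.
move: t; apply: tensor_ext.
- exact: rmulAA_linear.
- exact: linear_compose (rmulAA_linear c d) (ractl_linear r).
- by move=> a b; rewrite ractl_tens !rmulAA_tens actE mulA_assoc.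
Qed.

Lemma rmulAA_actr r c d t : rmulAA c (act r d) t = rmulAA c d (ractr mulA iota r t).
Proof.
move: t; apply: tensor_ext.
- exact: rmulAA_linear.
- exact: linear_compose (rmulAA_linear c d) (ractr_linear r).
- by move=> a b; rewrite ractr_tens !rmulAA_tens actE mulA_assoc.
Qed.

Lemma mulAA_balanced t : takeuchi mulA iota t -> balanced act act (fun c d => rmulAA c d t).
Proof.
move=> tt; split=> [d|c|r c d]; last by rewrite rmulAA_act rmulAA_actr tt.
  move=> k c c'; move: t {tt}; apply: tensor_ext; first exact: rmulAA_linear.
    move=> l u v; rewrite !rmulAA_linear !scalerDr !scalerA mulrC addrACA.
    by rewrite -!addrA; congr (_ + _); rewrite addrCA.
  by move=> a b; rewrite !rmulAA_tens mul_linearr tens_linearl.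
move=> k d d'; move: t {tt}; apply: tensor_ext; first exact: rmulAA_linear.
  move=> l u v; rewrite !rmulAA_linear !scalerDr !scalerA mulrC addrACA.
  by rewrite -!addrA; congr (_ + _); rewrite addrCA.
by move=> a b; rewrite !rmulAA_tens mul_linearr tens_linearr.
Qed.

Lemma mulAA_tens t c d : takeuchi mulA iota t -> mulAA mulA t (tens c d) = rmulAA c d t.
Proof. by move=> /mulAA_balanced tb; exact: tensor_lift_tens. Qed.

Lemma mulAA_linearr t : takeuchi mulA iota t -> linear (mulAA mulA t : AA -> AA).
Proof. by move=> /mulAA_balanced tb; exact: tensor_lift_linear. Qed.

Lemma mulAA_linearl u : linear (fun t : AA => mulAA mulA t u).
Proof.
move=> k t t'; rewrite /mulAA /tensor_lift scaler_sumr -big_split; apply: eq_bigr => p _ /=.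
exact: rmulAA_linear.
Qed.

Lemma assoc_inner_balanced c :
  balanced act act (fun a b => tens a (tens b c : AA) : tensor act (actAA (act := act))).
Proof.
split=> [b|a|r a b].
- exact: tens_linearl.
- exact: linear_compose (tens_linearr _ _ _) (tens_linearl _ _ _).
- by rewrite tens_act actAA_tens.
Qed.

Lemma assoc_inner_linear c : linear (fun u : AA =>
  tensor_lift (fun a b => tens a (tens b c : AA) : tensor act (actAA (act := act))) u).
Proof. exact: tensor_lift_linear (assoc_inner_balanced c). Qed.

(** The values are themselves lifts in u, and so their dependence on (u, c) is
    checked on pure tensors u. *)
Lemma tensor_assoc_balanced : balanced (actAA (act := act)) act (fun u c =>
  tensor_lift (fun a b => tens a (tens b c : AA) : tensor act (actAA (act := act))) u).
Proof.
split=> [c|u|r u c]; first exact: assoc_inner_linear.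
  move=> k c c'; move: u; apply: tensor_ext; first exact: assoc_inner_linear.
    move=> l u v; rewrite !assoc_inner_linear !scalerDr !scalerA mulrC addrACA.
    by rewrite -!addrA; congr (_ + _); rewrite addrCA.
  move=> a b; rewrite !(tensor_lift_tens _ _ (assoc_inner_balanced _)).
  by rewrite tens_linearr tens_linearr.
move: u; apply: tensor_ext.
- exact: linear_compose (assoc_inner_linear c) (actAA_linear r).
- exact: assoc_inner_linear.
- move=> a b; rewrite actAA_tens !(tensor_lift_tens _ _ (assoc_inner_balanced _)).
  by rewrite tens_act actAA_tens tens_act.
Qed.

Lemma tensor_assoc_tens a b c :
  tensor_assoc (tens (tens a b : AA) c : tensor (actAA (act := act)) act)
  = tens a (tens b c : AA).
Proof.
rewrite /tensor_assoc (tensor_lift_tens _ _ tensor_assoc_balanced).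
exact: tensor_lift_tens (assoc_inner_balanced c).
Qed.

Lemma tensor_assoc_linear : linear (@tensor_assoc K R A act).
Proof. exact: tensor_lift_linear tensor_assoc_balanced. Qed.

End ExtensionTheory.

(** * Algebraic structure of the Dirac bialgebroid *)

Section DiracBialgebroid.
Variables (R : realType) (m n : nat).
Variables (M : manifoldType R m) (H : lieGroupType R n).
Variables (act : M -> H -> M) (act_action : smooth_right_action act).
Local Notation A := (Dirac M H).
Local Notation C := (Cc M).
Local Notation AA := (AA (@dirac_act R m n M H)).
Local Notation gen := (@dirac_gen R m n M H).
Local Notation tr := (translate act).
Implicit Types (u v w : A) (f g : C) (h k : H).

(** Reduces the identities in the axioms of a bialgebroid and of an antipode to
    computations with generators. *)
Lemma dirac_ext (V : lmodType R[i]) (S T : A -> V) : linear S -> linear T ->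
  (forall h f, S (gen h f) = T (gen h f)) -> S =1 T.
Proof.
move=> lS lT ST; apply: dirac_ind => // [|a u v Su Sv]; last by rewrite lS lT Su Sv.
by rewrite (linear_zero lS) (linear_zero lT).
Qed.

Lemma smooth_map_act h : smooth_map (fun x => act x h).
Proof.
exact: (smooth_map_comp (smooth_map_pair (smooth_map_id M) (smooth_map_cst M h))
  (ract_smooth act_action)).
Qed.

Lemma actK h x : act (act x h) h^-1%g = x.
Proof. by rewrite (ractM act_action) mulgV (ract1 act_action). Qed.

(** The support of x |-> f (x h) is the image of the support of f under the
    translation by the inverse of h, hence compact; so the default value in the
    definition of translate does not occur. *)
Lemma translateE h f x : tr h f x = f (act x h).
Proof.
rewrite /translate insubdK //; apply/asboolP; split.
  exact: smooth_fun_comp (smooth_map_act h) (@Cc_smooth _ _ _ f).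
have [ch _] := smooth_map_act h^-1%g.
have cI : compact ((act^~ h^-1%g) @` csupport f).
  by apply: continuous_compact (@Cc_compact _ _ _ f); exact: continuous_subspaceT.
have clI : closed ((act^~ h^-1%g) @` csupport f).
  by apply: compact_closed cI; exact: manifold_hausdorff.
apply: subclosed_compact cI _; first exact: closed_closure.
rewrite [X in _ `<=` X](closure_id _).1 //; apply: closureS => y /= fy.
by exists (act y h); [exact: csupportP|exact: actK].
Qed.

Lemma translate_linear h : linear (tr h).
Proof. by move=> a f g; apply: Cc_eqP => x; rewrite translateE -[RHS]/(a * tr h f x + tr h g x) !translateE. Qed.

Lemma translateM h f g : tr h (Cc_mul f g) = Cc_mul (tr h f) (tr h g).
Proof. by apply: Cc_eqP => x; rewrite translateE /= !translateE. Qed.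

Lemma translate_translate h k f : tr h (tr k f) = tr (h * k)%g f.
Proof. by apply: Cc_eqP => x; rewrite !translateE (ractM act_action). Qed.

Lemma translate1 f : tr 1%g f = f.
Proof. by apply: Cc_eqP => x; rewrite translateE (ract1 act_action). Qed.

Lemma Cc_mul_linearl g : linear (@Cc_mul R m M ^~ g).
Proof. exact: (Cc_mul_bilinear M).1. Qed.

Lemma Cc_mul_linearr f : linear (@Cc_mul R m M f).
Proof. exact: (Cc_mul_bilinear M).2. Qed.

Lemma gen_linear h : linear (gen h).
Proof. exact: dirac_gen_linear. Qed.

Definition mul_gen h1 f1 h2 f2 : A := gen (h1 * h2)%g (Cc_mul f1 (tr h1 f2)).

Lemma mul_gen_linearr h1 f1 h2 : linear (mul_gen h1 f1 h2).
Proof.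
exact: linear_compose (gen_linear _) (linear_compose (Cc_mul_linearr f1) (translate_linear h1)).
Qed.

Definition dirac_mul u v : A := dirac_lift (fun h f => dirac_lift (mul_gen h f) v) u.

Lemma mul_gen_lift_linear v h : linear (fun f => dirac_lift (mul_gen h f) v).
Proof.
move=> a f f'; move: v; apply: dirac_ext.
- by apply: dirac_lift_linear => h2; exact: mul_gen_linearr.
- move=> b u v; rewrite !(dirac_lift_linear (mul_gen_linearr _ _)) !scalerDr !scalerA.
  by rewrite [a * b]mulrC addrACA.
- move=> h2 f2; rewrite !(dirac_lift_gen (mul_gen_linearr _ _)) /mul_gen.
  by rewrite Cc_mul_linearl gen_linear.
Qed.

Lemma dirac_mul_gen h1 f1 h2 f2 : dirac_mul (gen h1 f1) (gen h2 f2) = mul_gen h1 f1 h2 f2.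
Proof.
rewrite /dirac_mul (dirac_lift_gen (mul_gen_lift_linear _)).
by rewrite (dirac_lift_gen (mul_gen_linearr _ _)).
Qed.

Lemma dirac_mul_linearl v : linear (dirac_mul^~ v).
Proof. by apply: dirac_lift_linear; exact: mul_gen_lift_linear. Qed.

Lemma dirac_mul_linearr u : linear (dirac_mul u).
Proof.
move=> a v v'; move: u; apply: dirac_ext; first exact: dirac_mul_linearl.
  move=> b u w; rewrite !(dirac_mul_linearl _ b) !scalerDr !scalerA.
  by rewrite [a * b]mulrC addrACA.
move=> h f; rewrite /dirac_mul !(dirac_lift_gen (mul_gen_lift_linear _)).
by rewrite dirac_lift_linear // => h2; exact: mul_gen_linearr.
Qed.

Definition dirac_eps u : C := dirac_lift (fun _ f => f) u.

Let id_linear (h : H) : linear (fun f : C => f). Proof. by []. Qed.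

Lemma dirac_eps_gen h f : dirac_eps (gen h f) = f.
Proof. exact: (dirac_lift_gen id_linear). Qed.

Lemma dirac_eps_linear : linear dirac_eps.
Proof. exact: dirac_lift_linear id_linear. Qed.

Definition antipode_gen h f : A := gen h^-1%g (tr h^-1%g f).

Lemma antipode_gen_linear h : linear (antipode_gen h).
Proof. exact: linear_compose (gen_linear _) (translate_linear _). Qed.

Definition dirac_antipode u : A := dirac_lift antipode_gen u.

Lemma dirac_antipode_gen h f : dirac_antipode (gen h f) = antipode_gen h f.
Proof. exact: (dirac_lift_gen antipode_gen_linear). Qed.

Lemma dirac_antipode_linear : linear dirac_antipode.
Proof. exact: dirac_lift_linear antipode_gen_linear. Qed.

Lemma dirac_act_gen r h f : dirac_act r (gen h f) = gen h (Cc_mul r f).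
Proof. by apply: Dirac_eqP => F x /=; rewrite mulrCA mulrA. Qed.

Lemma dirac_act_linear r : linear (@dirac_act R m n M H r).
Proof. by move=> a u v; apply: Dirac_eqP. Qed.

Lemma tens_gen_mul f g r h :
  (tens (gen h (Cc_mul r f)) (gen h g) : AA) = tens (gen h f) (gen h (Cc_mul r g)).
Proof. by rewrite -!dirac_act_gen tens_act. Qed.

(** Any two functions that act as units on f give the same tensor: f is
    replaced by g' f, then g' moves to the right factor, and g moves back to
    the left one. *)
Lemma tens_gen_unit f g g' h : Cc_mul g f = f -> Cc_mul g' f = f ->
  (tens (gen h f) (gen h g) : AA) = tens (gen h f) (gen h g').
Proof.
move=> gf g'f; rewrite -{1}g'f tens_gen_mul Cc_mulC -tens_gen_mul.
by rewrite gf.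
Qed.

Definition unit_of f : C := sval (cid (Cc_local_unit [:: f])).

Lemma unit_ofP f : Cc_mul (unit_of f) f = f.
Proof. by rewrite /unit_of; case: cid => g /= -> //; rewrite mem_head. Qed.

Definition Delta_gen h f : AA := tens (gen h f) (gen h (unit_of f)).

Lemma Delta_genE h f g : Cc_mul g f = f -> Delta_gen h f = tens (gen h f) (gen h g).
Proof. by move=> gf; apply: tens_gen_unit => //; exact: unit_ofP. Qed.

(** A common unit for f and f' computes all three values, although the chosen
    units differ. *)
Lemma Delta_gen_linear h : linear (Delta_gen h).
Proof.
move=> a f f'; have [g gP] := Cc_local_unit [:: f; f'].
have gf : Cc_mul g f = f by apply: gP; rewrite mem_head.
have gf' : Cc_mul g f' = f' by apply: gP; rewrite !inE eqxx orbT.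
rewrite (Delta_genE h gf) (Delta_genE h gf') (@Delta_genE h _ g); last first.
  by rewrite Cc_mul_linearr gf gf'.
by rewrite gen_linear tens_linearl.
Qed.

Definition dirac_Delta u : AA := dirac_lift Delta_gen u.

Lemma dirac_Delta_gen h f g : Cc_mul g f = f ->
  dirac_Delta (gen h f) = tens (gen h f) (gen h g).
Proof. by move=> gf; rewrite /dirac_Delta (dirac_lift_gen Delta_gen_linear) (Delta_genE h gf). Qed.

Lemma dirac_Delta_linear : linear dirac_Delta.
Proof. exact: dirac_lift_linear Delta_gen_linear. Qed.

Lemma dirac_structureP : dirac_structure act dirac_mul dirac_Delta dirac_eps dirac_antipode.
Proof.
split; [exact: dirac_mul_gen|exact: dirac_Delta_gen|exact: dirac_eps_gen|exact: dirac_antipode_gen].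
Qed.

Lemma Cc_base : comm_algebra_with_local_units (@Cc_mul R m M).
Proof.
split; [exact: Cc_mul_bilinear|exact: Cc_mulA|exact: Cc_mulC|exact: Cc_local_unit].
Qed.

Lemma dirac_mul_act r u : dirac_mul (gen 1%g r) u = dirac_act r u.
Proof.
move: u; apply: dirac_ext; [exact: dirac_mul_linearr|exact: dirac_act_linear|].
by move=> h f; rewrite dirac_mul_gen dirac_act_gen /mul_gen mul1g translate1.
Qed.

Lemma gen_mul_iota h f r : dirac_mul (gen h f) (gen 1%g r) = gen h (Cc_mul f (tr h r)).
Proof. by rewrite dirac_mul_gen /mul_gen mulg1. Qed.

Lemma dirac_mulA : associative dirac_mul.
Proof.
move=> u v w; move: u; apply: dirac_ext; first exact: dirac_mul_linearl.
  exact: linear_compose (dirac_mul_linearl w) (dirac_mul_linearl v).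
move=> h1 f1; move: v; apply: dirac_ext.
- exact: linear_compose (dirac_mul_linearr _) (dirac_mul_linearl w).
- exact: linear_compose (dirac_mul_linearl w) (dirac_mul_linearr _).
move=> h2 f2; move: w; apply: dirac_ext.
- exact: linear_compose (dirac_mul_linearr _) (dirac_mul_linearr _).
- exact: dirac_mul_linearr.
move=> h3 f3; rewrite !dirac_mul_gen /mul_gen mulgA.
by rewrite translateM translate_translate Cc_mulA.
Qed.

Lemma dirac_gen_inj h : injective (gen h).
Proof.
move=> f g fg; apply: Cc_eqP => x.
have oneP : (fun=> 1) \in @Cinf_pred R (m + n) (M * H)%type.
  by apply/asboolP; exact: smooth_fun_cst.
have := congr1 (fun u : A => u (MkCinf oneP) x) fg.
by rewrite /= !mulr1.
Qed.

(** A right unit for [[E_h, f]] must be 1 on the translate of the support of f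
    by h, because multiplication on the right by r multiplies f by x |-> r (x
    h). Requiring that r be 1 on a compact set, rather than naming r, is what
    survives sums. *)
Lemma dirac_local_units (s : seq A) : exists r, forall a, a \in s ->
  dirac_mul (gen 1%g r) a = a /\ dirac_mul a (gen 1%g r) = a.
Proof.
suff [L cL LP] : exists2 L : set M, compact L & forall a, a \in s ->
    forall r : C, (forall x, L x -> r x = 1) ->
    dirac_mul (gen 1%g r) a = a /\ dirac_mul a (gen 1%g r) = a.
  have [r rL] := Cc_unit_compact cL; exists r => a a_s; exact: LP a_s r rL.
have one a : exists2 L : set M, compact L & forall r : C, (forall x, L x -> r x = 1) ->
    dirac_mul (gen 1%g r) a = a /\ dirac_mul a (gen 1%g r) = a.
  move: a; apply: dirac_ind => [|a u v [L cL Lu] [L' cL' Lv]|h f].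
  - exists set0 => [|r _]; first exact: compact0.
    split; first exact: (linear_zero (dirac_mul_linearr (gen 1%g r))).
    exact: (linear_zero (dirac_mul_linearl (gen 1%g r))).
  - exists (L `|` L') => [|r rL]; first exact: compactU.
    have [u1 u2] := Lu r (fun x Lx => rL x (or_introl Lx)).
    have [v1 v2] := Lv r (fun x Lx => rL x (or_intror Lx)).
    by rewrite dirac_mul_linearr dirac_mul_linearl u1 u2 v1 v2.
  - exists (csupport f `|` (act^~ h) @` csupport f).
      apply: compactU; first exact: Cc_compact.
      apply: continuous_compact (@Cc_compact _ _ _ f); apply: continuous_subspaceT.
      exact: (smooth_map_act h).1.
    move=> r rL; rewrite dirac_mul_act dirac_act_gen gen_mul_iota; split.
      by rewrite Cc_mul_unitE // => x fx; apply: rL; left.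
    rewrite Cc_mulC Cc_mul_unitE // => x fx; rewrite translateE; apply: rL.
    by right; exists x.
elim: s => [|a s [L cL LP]]; first by exists set0 => //; exact: compact0.
have [L' cL' La] := one a; exists (L' `|` L); first exact: compactU.
move=> b; rewrite inE => /predU1P[->|bs] r rL.
  by apply: La => x Lx; apply: rL; left.
by apply: LP => // x Lx; apply: rL; right.
Qed.

Lemma dirac_extension : algebra_extension (@Cc_mul R m M) dirac_mul (gen 1%g) (@dirac_act R m n M H).
Proof.
split.
- by split; [exact: dirac_mul_linearl|exact: dirac_mul_linearr].
- exact: dirac_mulA.
- exact: gen_linear.
- exact: dirac_gen_inj.
- by move=> r r'; rewrite gen_mul_iota translate1.
- exact: dirac_local_units.
- by move=> r u; rewrite dirac_mul_act.
Qed.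

Let baseP := Cc_base.
Let extP := dirac_extension.

(** Both right actions of r multiply f by x |-> r (x h), either in the left
    factor or in the right one, and the two factors are balanced. *)
Lemma dirac_takeuchi u : takeuchi dirac_mul (gen 1%g) (dirac_Delta u).
Proof.
move=> r; move: u; apply: dirac_ext.
- exact: linear_compose (ractl_linear extP r) dirac_Delta_linear.
- exact: linear_compose (ractr_linear extP r) dirac_Delta_linear.
move=> h f; rewrite (dirac_Delta_gen h (unit_ofP f)).
rewrite (ractl_tens extP) (ractr_tens extP) !gen_mul_iota.
by rewrite Cc_mulC tens_gen_mul Cc_mulC.
Qed.

Lemma swap_balanced : balanced (@dirac_act R m n M H) (@dirac_act R m n M H)
  (fun b c => tens c b : AA).
Proof.
by split=> [b|a|r a b]; [exact: tens_linearr|exact: tens_linearl|rewrite tens_act].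
Qed.

Lemma eps_act_linear (b : A) : linear (fun u => dirac_act (dirac_eps u) b).
Proof.
move=> a u v; rewrite dirac_eps_linear; move: b; apply: dirac_ext.
- exact: dirac_act_linear.
- move=> c b b'; rewrite !dirac_act_linear !scalerDr !scalerA.
  by rewrite [a * c]mulrC addrACA.
- by move=> h f; rewrite !dirac_act_gen Cc_mul_linearl gen_linear.
Qed.

Lemma dirac_eps_act r u : dirac_eps (dirac_act r u) = Cc_mul r (dirac_eps u).
Proof.
move: u; apply: dirac_ext.
- exact: linear_compose dirac_eps_linear (dirac_act_linear r).
- exact: linear_compose (Cc_mul_linearr r) dirac_eps_linear.
- by move=> h f; rewrite dirac_act_gen !dirac_eps_gen.
Qed.

Lemma dirac_actM r s u : dirac_act r (dirac_act s u) = dirac_act (Cc_mul r s) u.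
Proof.
by rewrite -!dirac_mul_act dirac_mulA gen_mul_iota translate1.
Qed.

Lemma counitl_balanced : balanced (@dirac_act R m n M H) (@dirac_act R m n M H)
  (fun b c => dirac_act (dirac_eps b) c).
Proof.
split=> [b|a|r a b]; [exact: eps_act_linear|exact: dirac_act_linear|].
by rewrite dirac_eps_act dirac_actM Cc_mulC.
Qed.

Lemma counitr_balanced : balanced (@dirac_act R m n M H) (@dirac_act R m n M H)
  (fun b c => dirac_act (dirac_eps c) b).
Proof.
split=> [b|a|r a b]; [exact: dirac_act_linear|exact: eps_act_linear|].
by rewrite dirac_eps_act dirac_actM Cc_mulC.
Qed.

Lemma dirac_Delta_act r u : dirac_Delta (dirac_act r u) = actAA r (dirac_Delta u).
Proof.
move: u; apply: dirac_ext.
- exact: linear_compose dirac_Delta_linear (dirac_act_linear r).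
- exact: linear_compose (actAA_linear baseP extP r) dirac_Delta_linear.
move=> h f; rewrite dirac_act_gen (dirac_Delta_gen h (unit_ofP f)) (actAA_tens baseP extP).
rewrite dirac_act_gen; apply: dirac_Delta_gen.
by rewrite Cc_mulC -Cc_mulA [Cc_mul f _]Cc_mulC unit_ofP.
Qed.

Lemma Delta_left_balanced : balanced (@dirac_act R m n M H) (@dirac_act R m n M H)
  (fun b c => tens (dirac_Delta b) c :
     tensor (actAA (act := @dirac_act R m n M H)) (@dirac_act R m n M H)).
Proof.
split=> [b|a|r a b].
- exact: linear_compose (tens_linearl _ _ _) dirac_Delta_linear.
- exact: tens_linearr.
- by rewrite dirac_Delta_act tens_act.
Qed.

Lemma Delta_right_balanced : balanced (@dirac_act R m n M H) (@dirac_act R m n M H)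
  (fun b c => tens b (dirac_Delta c) :
     tensor (@dirac_act R m n M H) (actAA (act := @dirac_act R m n M H))).
Proof.
split=> [b|a|r a b].
- exact: tens_linearl.
- exact: linear_compose (tens_linearr _ _ _) dirac_Delta_linear.
- by rewrite dirac_Delta_act tens_act.
Qed.

Lemma dirac_coassoc u :
  tensor_assoc (tensor_lift (fun b c => tens (dirac_Delta b) c :
     tensor (actAA (act := @dirac_act R m n M H)) (@dirac_act R m n M H)) (dirac_Delta u))
  = tensor_lift (fun b c => tens b (dirac_Delta c) :
     tensor (@dirac_act R m n M H) (actAA (act := @dirac_act R m n M H))) (dirac_Delta u).
Proof.
move: u; apply: dirac_ext.
- apply: (linear_compose (tensor_assoc_linear baseP extP)).
  exact: linear_compose (tensor_lift_linear Delta_left_balanced) dirac_Delta_linear.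
- exact: linear_compose (tensor_lift_linear Delta_right_balanced) dirac_Delta_linear.
(* With g a unit for f and g' a unit for g, the coefficients of the two sides
    are f (x) (g (x) g) and f (x) (g (x) g'). If f is written g f in the second
    one, the extra g crosses both tensor signs and turns g' into g. *)
move=> h f; set g := unit_of f; have gf : Cc_mul g f = f := unit_ofP f.
set g' := unit_of g; have g'g : Cc_mul g' g = g := unit_ofP g.
rewrite (dirac_Delta_gen h gf) (tensor_lift_tens _ _ Delta_left_balanced).
rewrite (tensor_lift_tens _ _ Delta_right_balanced) (dirac_Delta_gen h gf).
rewrite (tensor_assoc_tens baseP extP) (dirac_Delta_gen h g'g).
rewrite -[in RHS]gf -[in RHS]dirac_act_gen tens_act (actAA_tens baseP extP).
rewrite tens_act dirac_act_gen Cc_mulC g'g.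
by rewrite [in LHS]/g.
Qed.

Lemma dirac_Delta_mul u v :
  dirac_Delta (dirac_mul u v) = mulAA dirac_mul (dirac_Delta u) (dirac_Delta v).
Proof.
move: v; apply: dirac_ext.
- exact: linear_compose dirac_Delta_linear (dirac_mul_linearr u).
- exact: linear_compose (mulAA_linearr extP (dirac_takeuchi u)) dirac_Delta_linear.
move=> h2 f2; move: u; apply: dirac_ext.
- exact: linear_compose dirac_Delta_linear (dirac_mul_linearl _).
- exact: linear_compose (mulAA_linearl extP _) dirac_Delta_linear.
move=> h1 f1; set g1 := unit_of f1; set g2 := unit_of f2.
have g1f : Cc_mul g1 f1 = f1 := unit_ofP f1.
have g2f : Cc_mul g2 f2 = f2 := unit_ofP f2.
(* The product of the right factors has coefficient g1 (h1 g2), which is a unit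
    for the coefficient f1 (h1 f2) of the product of the left factors. *)
rewrite (dirac_Delta_gen h2 g2f) (mulAA_tens extP _ _ (dirac_takeuchi _)).
rewrite (dirac_Delta_gen h1 g1f) (rmulAA_tens extP) !dirac_mul_gen.
apply: dirac_Delta_gen.
rewrite Cc_mulA -[Cc_mul (Cc_mul g1 _) f1]Cc_mulA [Cc_mul _ f1]Cc_mulC Cc_mulA g1f.
by rewrite -Cc_mulA -translateM g2f.
Qed.

Lemma dirac_bialgebroid :
  bialgebroid (@Cc_mul R m M) dirac_mul (gen 1%g) dirac_Delta dirac_eps.
Proof.
split.
- exact: baseP.
- exact: extP.
- exact: dirac_Delta_linear.
- exact: dirac_Delta_act.
- exact: dirac_eps_linear.
- exact: dirac_eps_act.
- exact: dirac_coassoc.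
- apply: dirac_ext => //.
    exact: linear_compose (tensor_lift_linear counitl_balanced) dirac_Delta_linear.
  move=> h f; rewrite (dirac_Delta_gen h (unit_ofP f)) (tensor_lift_tens _ _ counitl_balanced).
  by rewrite dirac_eps_gen dirac_act_gen Cc_mulC unit_ofP.
- apply: dirac_ext => //.
    exact: linear_compose (tensor_lift_linear counitr_balanced) dirac_Delta_linear.
  move=> h f; rewrite (dirac_Delta_gen h (unit_ofP f)) (tensor_lift_tens _ _ counitr_balanced).
  by rewrite dirac_eps_gen dirac_act_gen unit_ofP.
- apply: dirac_ext.
  + exact: linear_compose (tensor_lift_linear swap_balanced) dirac_Delta_linear.
  + exact: dirac_Delta_linear.
  move=> h f; rewrite (dirac_Delta_gen h (unit_ofP f)) (tensor_lift_tens _ _ swap_balanced).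
  move: (unit_of f) (unit_ofP f) => g gf.
  by rewrite -[X in tens _ (gen h X) = _]gf Cc_mulC -tens_gen_mul Cc_mulC gf.
- exact: dirac_takeuchi.
- exact: dirac_eps_gen.
- by move=> r r'; exact: dirac_Delta_gen.
- move=> u v; move: v; apply: dirac_ext.
  + exact: linear_compose dirac_eps_linear (dirac_mul_linearr u).
  + apply: (linear_compose dirac_eps_linear).
    apply: (linear_compose (dirac_mul_linearr u)).
    exact: linear_compose (gen_linear _) dirac_eps_linear.
  move=> h2 f2; move: u; apply: dirac_ext.
  + exact: linear_compose dirac_eps_linear (dirac_mul_linearl _).
  + exact: linear_compose dirac_eps_linear (dirac_mul_linearl _).
  by move=> h1 f1; rewrite dirac_eps_gen gen_mul_iota dirac_mul_gen !dirac_eps_gen.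
- exact: dirac_Delta_mul.
Qed.

Lemma dirac_antipode_mul u v :
  dirac_antipode (dirac_mul u v) = dirac_mul (dirac_antipode v) (dirac_antipode u).
Proof.
move: u; apply: dirac_ext.
- exact: linear_compose dirac_antipode_linear (dirac_mul_linearl v).
- exact: linear_compose (dirac_mul_linearr _) dirac_antipode_linear.
move=> h1 f1; move: v; apply: dirac_ext.
- exact: linear_compose dirac_antipode_linear (dirac_mul_linearr _).
- exact: linear_compose (dirac_mul_linearl _) dirac_antipode_linear.
move=> h2 f2; rewrite dirac_mul_gen !dirac_antipode_gen dirac_mul_gen /antipode_gen /mul_gen.
rewrite invgM translateM !translate_translate -mulgA mulVg mulg1.
by congr (gen _ _); exact: Cc_mulC.
Qed.

(** As S reverses products and fixes the base, it turns the left action on its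
    argument into a right action. *)
Lemma antipode_balanced : balanced (@dirac_act R m n M H) (@dirac_act R m n M H)
  (fun b c => dirac_mul (dirac_antipode b) c).
Proof.
split=> [b|a|r a b].
- exact: linear_compose (dirac_mul_linearl b) dirac_antipode_linear.
- exact: dirac_mul_linearr.
- rewrite -!dirac_mul_act dirac_antipode_mul dirac_antipode_gen /antipode_gen.
  by rewrite invg1 translate1 dirac_mulA.
Qed.

Lemma dirac_antipodeP : antipode dirac_mul (gen 1%g) dirac_Delta dirac_eps dirac_antipode.
Proof.
split.
- exact: dirac_antipode_linear.
- apply: dirac_ext => //.
    exact: linear_compose dirac_antipode_linear dirac_antipode_linear.
  move=> h f; rewrite !dirac_antipode_gen /antipode_gen invgK translate_translate mulgV.
  by rewrite translate1.
- by move=> r; rewrite dirac_antipode_gen /antipode_gen invg1 translate1.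
- exact: dirac_antipode_mul.
- apply: dirac_ext.
  + exact: linear_compose (tensor_lift_linear antipode_balanced) dirac_Delta_linear.
  + apply: (linear_compose (gen_linear _)).
    exact: linear_compose dirac_eps_linear dirac_antipode_linear.
  move=> h f; rewrite (dirac_Delta_gen h (unit_ofP f)) (tensor_lift_tens _ _ antipode_balanced).
  rewrite dirac_antipode_gen dirac_mul_gen /mul_gen mulVg dirac_eps_gen.
  by rewrite -translateM Cc_mulC unit_ofP.
Qed.

End DiracBialgebroid.

(** * Topology of the Dirac bialgebroid *)

Section DiracTopology.
Variables (R : realType) (m n : nat).
Variables (M : manifoldType R m) (H : lieGroupType R n).
Local Notation A := (Dirac M H).
Local Notation C := (Cc M).
Local Notation CMH := (Cinf (M * H)%type).
Local Notation AA := (AA (@dirac_act R m n M H)).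
Local Notation gen := (@dirac_gen R m n M H).
Implicit Types (u v w : A) (f g : C) (h k : H) (F G : CMH).

Lemma smooth_map_slice h : smooth_map (fun x : M => (x, h)).
Proof. exact: smooth_map_pair (smooth_map_id M) (smooth_map_cst M h). Qed.

Definition slice h : CMH -> Cinf M := Cinf_pull (smooth_map_slice h).
HB.instance Definition _ h := GRing.Linear.on (slice h).

Lemma dirac_genE h f F : gen h f F = Cc_cut f (slice h F).
Proof. exact: Cc_eqP. Qed.

(** The generator [[E_h, f]] restricts to the slice at h and multiplies by f;
    both operations are continuous. *)
Lemma dirac_E_t' u : E_t' u.
Proof.
have CP := Cc_nbhs0_base M; have FC := lcbase_filter CP.
move: u; apply: dirac_ind => [|a u v [lu cu mu] [lv cv mv]|h f].
- split.
  + by move=> a F G; rewrite scaler0 addr0.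
  + move=> V NV; apply: filterE => F; exact: (lc_nbhs0_singleton CP NV).
  + by move=> f F; apply: Cc_eqP => x /=; rewrite mulr0.
- split.
  + move=> b F G; rewrite !DiracE lu lv !scalerDr !scalerA [a * b]mulrC.
    by rewrite addrACA.
  + exact: continuous0_lin.
  + move=> f F; rewrite !DiracE mu mv.
    by rewrite (Cc_mul_bilinear M).2.
- split.
  + by move=> b F G; rewrite !dirac_genE !linearP.
  + move=> V /(@Cc_cut_continuous R m M f)/(Cinf_pull_continuous (smooth_map_slice h)).
    by apply: filterS => F; rewrite -[X in _ -> X]/(V (gen h f F)) dirac_genE.
  + by move=> g F; apply: Cc_eqP => x /=; rewrite mulrCA.
Qed.

Definition dirac_ev F (u : A) : C := u F.

Fact dirac_ev_linear F : linear (dirac_ev F). Proof. by []. Qed.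
HB.instance Definition _ F := GRing.isLinear.Build R[i] A C _ (dirac_ev F)
  (dirac_ev_linear F).

Lemma dirac_bounded u B : bounded0 (Cinf_nbhs0 _) B ->
  bounded0 (Cc_nbhs0 M) [set u F | F in B].
Proof.
have [lu cu _] := dirac_E_t' u.
pose L : {linear CMH -> C} := HB.pack (u : CMH -> C) (GRing.isLinear.Build _ _ _ _ (u : CMH -> C) lu).
exact: (@bounded0_image _ _ _ _ _ L).
Qed.

(** The evaluations at a bounded set of functions are bounded at each Dirac
    element, as continuous linear maps preserve bounded sets. *)
Lemma Dirac_nbhs0_base : locally_convex_base (@Dirac_nbhs0 R m n M H).
Proof.
apply: (@uniform_locally_convex _ _ _ _ (Cc_nbhs0_base M) _ dirac_ev
  (bounded0 (Cinf_nbhs0 _))).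
- exact: bounded0_set0.
- exact: bounded0U.
- exact: dirac_bounded.
Qed.

Lemma pairing_balanced F G : balanced (@dirac_act R m n M H) (@dirac_act R m n M H)
  (fun u v => Cc_mul (u F) (v G)).
Proof.
split=> [v|u|r u v].
- by move=> a u u'; rewrite DiracE (Cc_mul_bilinear M).1.
- by move=> a v v'; rewrite DiracE (Cc_mul_bilinear M).2.
- have [_ _ mu] := dirac_E_t' u; have [_ _ mv] := dirac_E_t' v.
  by rewrite -[dirac_act r u F]/(u (Cc_scale r F)) -[dirac_act r v G]/(v (Cc_scale r G)) mu mv
    Cc_mulA [Cc_mul r _]Cc_mulC.
Qed.

Definition pairing F G (t : AA) : C := dirac_pairing F G t.

Fact pairing_linear F G : linear (pairing F G).
Proof. exact: tensor_lift_linear (pairing_balanced F G). Qed.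
HB.instance Definition _ F G := GRing.isLinear.Build R[i] AA C _ (pairing F G)
  (pairing_linear F G).

Lemma pairing_tens F G u v : dirac_pairing F G (tens u v : AA) = Cc_mul (u F) (v G).
Proof. exact: tensor_lift_tens (pairing_balanced F G). Qed.

(** On generators the pairing is f g F(-, h) G(-, k), so this reduces to
    bounded sets of smooth functions being stable under products. *)
Lemma bounded_pairing_tens u v B1 B2 :
  bounded0 (Cinf_nbhs0 _) B1 -> bounded0 (Cinf_nbhs0 _) B2 ->
  bounded0 (Cc_nbhs0 M) ((fun p : CMH * CMH => Cc_mul (u p.1) (v p.2)) @` (B1 `*` B2)).
Proof.
have CP := Cc_nbhs0_base M; have [bl br] := Cc_mul_bilinear M.
have b0 (T : CMH * CMH -> C) : (forall p, T p = 0) ->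
    bounded0 (Cc_nbhs0 M) (T @` (B1 `*` B2)).
  move=> T0; apply: bounded0_sub (lcbase_absorb CP 0).
  by move=> _ [p _ <-]; exact: T0.
move=> bB1 bB2; move: u; apply: dirac_ind => [|a u u' bu bu'|h f].
- by apply: b0 => p; exact: (linear_zero (bl (v p.2))).
- have := bounded0_lin CP a bu bu'.
  by congr bounded0; apply: eq_imagel => p _; rewrite DiracE bl.
move: v; apply: dirac_ind => [|a v v' bv bv'|k g].
- by apply: b0 => p; exact: (linear_zero (br (gen h f p.1))).
- have := bounded0_lin CP a bv bv'.
  by congr bounded0; apply: eq_imagel => p _; rewrite DiracE br.
have bF := bounded0_image (Cinf_pull_continuous (smooth_map_slice h)) bB1.
have bG := bounded0_image (Cinf_pull_continuous (smooth_map_slice k)) bB2.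
have := bounded0_image (@Cc_cut_continuous R m M (Cc_mul f g)) (bounded_Cinf_mul bF bG).
apply: bounded0_sub => _ [[F G] /= [BF BG] <-].
exists (Cinf_mul (slice h F) (slice k G)).
  by exists (slice h F), (slice k G); split=> //; [exists F|exists G].
by apply: Cc_eqP => x /=; rewrite mulrACA.
Qed.

(** Products B1 `*` B2 of bounded sets are not stable under unions; allowing
    their subsets repairs this without changing the topology. *)
Lemma Dirac2_nbhs0_base : locally_convex_base (@Dirac2_nbhs0 R m n M H).
Proof.
have CP := Cc_nbhs0_base M.
pose bdd (X : set (CMH * CMH)) := exists B1 B2, [/\ bounded0 (Cinf_nbhs0 _) B1,
  bounded0 (Cinf_nbhs0 _) B2 & X `<=` B1 `*` B2].
have -> : @Dirac2_nbhs0 R m n M H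
    = uniform_nbhs0 (Cc_nbhs0 M) (fun p : CMH * CMH => pairing p.1 p.2) bdd.
  apply/seteqP; split=> U.
    move=> [B1 [B2 [V [bB1 bB2 NV UP]]]]; exists (B1 `*` B2), V; split=> //.
      by exists B1, B2; split.
    by move=> t tP; apply: UP => F G BF BG; exact: (tP (F, G)).
  move=> [X [V [[B1 [B2 [bB1 bB2 XB]]] NV UP]]]; exists B1, B2, V; split=> // t tP.
  by apply: UP => -[F G] /XB[BF BG]; exact: tP.
apply: uniform_locally_convex => //.
- by exists set0, set0; split=> //; exact: bounded0_set0.
- move=> X Y [B1 [B2 [bB1 bB2 XB]]] [B1' [B2' [bB1' bB2' YB]]].
  exists (B1 `|` B1'), (B2 `|` B2'); split; [exact: bounded0U|exact: bounded0U|].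
  by move=> p [/XB[? ?]|/YB[? ?]]; split; [left|left|right|right].
- move=> t X [B1 [B2 [bB1 bB2 XB]]].
  apply: (@bounded0_sub _ _ _ _ ((fun p => pairing p.1 p.2 t) @` (B1 `*` B2))).
    by apply: image_subset.
  move: t; apply: tensor_ind => [|t u bt bu|u v].
  + apply: bounded0_sub (lcbase_absorb CP 0).
    by move=> _ [p _ <-]; rewrite linear0.
  + have := bounded0_lin CP 1 bt bu.
    by congr bounded0; apply: eq_imagel => p _; rewrite scale1r linearD.
  + have := bounded_pairing_tens u v bB1 bB2.
    by congr bounded0; apply: eq_imagel => p _; rewrite -pairing_tens.
Qed.

Variables (act : M -> H -> M) (act_action : smooth_right_action act).
Local Notation tr := (translate act).
Local Notation mul := (dirac_mul act).

(** The coproduct is dual to the product of functions on the arrows, which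
    explains its continuity. *)
Lemma pairing_Delta F G u :
  dirac_pairing F G (dirac_Delta u) = u (Cinf_mul F G).
Proof.
move: u; apply: dirac_ext.
- exact: linear_compose (pairing_linear F G) (@dirac_Delta_linear R m n M H).
- exact: dirac_ev_linear.
- move=> h f; rewrite (dirac_Delta_gen h (unit_ofP f)) pairing_tens.
  apply: Cc_eqP => x /=; rewrite mulrACA; congr (_ * _); rewrite mulrC.
  exact: (congr1 (fun g : C => g x) (unit_ofP f)).
Qed.

Lemma dirac_Delta_continuous :
  continuous0 (@Dirac_nbhs0 R m n M H) (@Dirac2_nbhs0 R m n M H) (@dirac_Delta R m n M H).
Proof.
move=> U [B1 [B2 [V [bB1 bB2 NV UP]]]].
exists [set X | exists F G, [/\ B1 F, B2 G & X = Cinf_mul F G]], V; split=> //.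
  exact: bounded_Cinf_mul.
move=> u uP; apply: UP => F G BF BG; rewrite pairing_Delta; apply: uP.
by exists F, G.
Qed.

Fact const1P : (fun=> 1) \in @Cinf_pred R (m + n) (M * H)%type.
Proof. by apply/asboolP; exact: smooth_fun_cst. Qed.

(** Reduces the continuity of the counit to that of an evaluation. *)
Lemma dirac_eps_at1 u : dirac_eps u = u (MkCinf const1P).
Proof.
move: u; apply: dirac_ext.
- exact: dirac_eps_linear.
- exact: dirac_ev_linear.
- by move=> h f; rewrite dirac_eps_gen; apply: Cc_eqP => x /=; rewrite mulr1.
Qed.

Lemma dirac_eps_continuous :
  continuous0 (@Dirac_nbhs0 R m n M H) (Cc_nbhs0 M) (@dirac_eps R m n M H).
Proof.
move=> V NV; exists [set MkCinf const1P], V; split=> //; first exact: bounded_Cinf1.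
by move=> u uP; rewrite /= dirac_eps_at1; exact: uP.
Qed.

Lemma smooth_left_shift h :
  smooth_map (fun p : M * H => (act p.1 h^-1%g, (h * p.2)%g) : (M * H)%type).
Proof.
apply: smooth_map_pair.
  exact: (smooth_map_comp (smooth_map_fst M H) (smooth_map_act act_action h^-1%g)).
exact: (smooth_map_comp (smooth_map_pair (smooth_map_cst _ h) (smooth_map_snd M H))
  (lie_mul_smooth (s := H))).
Qed.

Lemma smooth_right_shift h :
  smooth_map (fun p : M * H => (p.1, (p.2 * h)%g) : (M * H)%type).
Proof.
apply: smooth_map_pair; first exact: smooth_map_fst.
exact: (smooth_map_comp (smooth_map_pair (smooth_map_snd M H) (smooth_map_cst _ h))
  (lie_mul_smooth (s := H))).
Qed.

(** Left multiplication by a generator is dual to the left translation of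
    arrows: composing (x, h) with (x h, k) gives (x, h k), the image of (x h,
    k) under the shift. *)
Lemma dirac_mul_genl h f v F :
  mul (gen h f) v F = Cc_mul f (tr h (v (Cinf_pull (smooth_left_shift h) F))).
Proof.
move: v; apply: dirac_ext.
- exact: linear_compose (dirac_ev_linear F) (dirac_mul_linearr act_action _).
- apply: (linear_compose (Cc_mul_linearr f)).
  exact: linear_compose (translate_linear act_action h) (dirac_ev_linear _).
- move=> k g; rewrite dirac_mul_gen //; apply: Cc_eqP => x /=.
  by rewrite !(translateE act_action) /= (actK act_action) mulrA.
Qed.

Definition act_pull g : CMH := Cinf_pull (ract_smooth act_action) (Cinf_of_Cc g).

(** Right multiplication by a generator is dual to composing (x, k) with (x k,
    h). The value f (x k) at the second arrow is a smooth function on M * H, so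
    that the product is again an evaluation of u. *)
Lemma dirac_mul_genr h f u F :
  mul u (gen h f) F = u (Cinf_mul (act_pull f) (Cinf_pull (smooth_right_shift h) F)).
Proof.
move: u; apply: dirac_ext.
- exact: linear_compose (dirac_ev_linear F) (dirac_mul_linearl act_action _).
- exact: dirac_ev_linear.
- move=> k g; rewrite dirac_mul_gen //; apply: Cc_eqP => x /=.
  by rewrite (translateE act_action) mulrA.
Qed.

(** Translation alone moves supports; after multiplication by f all the images
    are supported in the support of f, which is the situation of
    Cc_Cc_continuous. *)
Lemma translate_mul_continuous h f :
  continuous0 (Cc_nbhs0 M) (Cc_nbhs0 M) (fun g => Cc_mul f (tr h g)).
Proof.
have lT : linear (fun g => Cc_mul f (tr h g)).
  exact: linear_compose (Cc_mul_linearr f) (translate_linear act_action h).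
pose T : {linear C -> C} := HB.pack (fun g => Cc_mul f (tr h g))
  (GRing.isLinear.Build _ _ _ _ (fun g => Cc_mul f (tr h g)) lT).
suff: continuous0 (Cc_nbhs0 M) (Cc_nbhs0 M) T by [].
apply: (@Cc_Cc_continuous R m m M M T
  (fun F : Cinf M => Cinf_mul (Cinf_of_Cc f) (Cinf_pull (smooth_map_act act_action h) F)) (csupport f)).
- exact: Cc_compact.
- by move=> g; apply: csupport_sub => x /= ->; rewrite mul0r.
- by move=> V /(@Cinf_mul_continuous _ _ _ (Cinf_of_Cc f))/(Cinf_pull_continuous (smooth_map_act act_action h)).
- by move=> g x /=; rewrite (translateE act_action).
Qed.

(** Continuity is linear in a, so that a may be a generator. The transposition
    formula then replaces a bounded set of functions by its pullback along the
    shift. *)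
Lemma dirac_mull_continuous a :
  continuous0 (@Dirac_nbhs0 R m n M H) (@Dirac_nbhs0 R m n M H) (mul a).
Proof.
have DP := Dirac_nbhs0_base; have FD := lcbase_filter DP.
move: a; apply: dirac_ind => [|c a b ca cb|h f] U NU.
- apply: filterE => v; rewrite /= (linear_zero (dirac_mul_linearl act_action v)).
  exact: (lc_nbhs0_singleton DP NU).
- have := continuous0_lin FD DP c ca cb NU; apply: filterS => v.
  by rewrite /= (dirac_mul_linearl act_action v).
- have [B [V [bB NV UP]]] := NU.
  exists (Cinf_pull (smooth_left_shift h) @` B), [set g | V (Cc_mul f (tr h g))].
  split; first exact: bounded0_image (Cinf_pull_continuous _) bB.
    exact: translate_mul_continuous.
  move=> v vP; apply: UP => F BF; rewrite dirac_mul_genl; apply: vP.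
  by exists F.
Qed.

Lemma dirac_mulr_continuous b :
  continuous0 (@Dirac_nbhs0 R m n M H) (@Dirac_nbhs0 R m n M H) (mul^~ b).
Proof.
have DP := Dirac_nbhs0_base; have FD := lcbase_filter DP.
move: b; apply: dirac_ind => [|c a b ca cb|h f] U NU.
- apply: filterE => v; rewrite /= (linear_zero (dirac_mul_linearr act_action v)).
  exact: (lc_nbhs0_singleton DP NU).
- have := continuous0_lin FD DP c ca cb NU; apply: filterS => v.
  by rewrite /= (dirac_mul_linearr act_action v).
- have [B [V [bB NV UP]]] := NU.
  exists (Cinf_mul (act_pull f) @` (Cinf_pull (smooth_right_shift h) @` B)), V.
  split=> //.
    apply: (bounded0_image (@Cinf_mul_continuous _ _ _ (act_pull f))).
    exact: bounded0_image (Cinf_pull_continuous _) bB.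
  move=> v vP; apply: UP => F BF; rewrite dirac_mul_genr; apply: vP.
  by exists (Cinf_pull (smooth_right_shift h) F) => //; exists F.
Qed.

Lemma dirac_locally_convex :
  locally_convex_bialgebroid (@Cc_mul R m M) mul (gen 1%g)
    (Cc_nbhs0 M) (@Dirac_nbhs0 R m n M H) (@Dirac2_nbhs0 R m n M H)
    (@dirac_Delta R m n M H) (@dirac_eps R m n M H).
Proof.
split.
- exact: dirac_bialgebroid.
- exact: locally_convex_baseW (Cc_nbhs0_base M).
- exact: locally_convex_baseW Dirac_nbhs0_base.
- exact: locally_convex_baseW Dirac2_nbhs0_base.
- exact: dirac_Delta_continuous.
- exact: dirac_eps_continuous.
- exact: dirac_mull_continuous.
- exact: dirac_mulr_continuous.
Qed.

End DiracTopology.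

Theorem proposition5p3 (R : realType) (m n : nat)
    (M : manifoldType R m) (H : lieGroupType R n)
    (M_second_countable : @second_countable M)
    (H_second_countable : @second_countable H)
    (act : M -> H -> M) (act_action : smooth_right_action act) :
  (forall u : Dirac M H, E_t' u) /\
  exists (mul : Dirac M H -> Dirac M H -> Dirac M H)
         (Delta : Dirac M H -> AA (@dirac_act R m n M H))
         (eps : Dirac M H -> Cc M)
         (S : Dirac M H -> Dirac M H),
    [/\ dirac_structure act mul Delta eps S,
        locally_convex_bialgebroid (@Cc_mul R m M) mul
          (dirac_gen (1%g : H))
          (Cc_nbhs0 M) (@Dirac_nbhs0 R m n M H) (@Dirac2_nbhs0 R m n M H)
          Delta eps &
        antipode mul (dirac_gen (1%g : H)) Delta eps S].
Proof.
split; first exact: dirac_E_t'.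
exists (dirac_mul act), (@dirac_Delta R m n M H), (@dirac_eps R m n M H),
  (dirac_antipode act); split.
- exact: dirac_structureP.
- exact: dirac_locally_convex.
- exact: dirac_antipodeP.
Qed.
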